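(* Let $(p,q,r)\in P\cup P_1\cup P_2$, $\lambda,\mu>0$, $\theta=d(1-1/q)$, $\theta_0=d-(\lambda+d)/p$, $\theta_1=d+(\mu-d)/r$, and let $$w(t)=(t_1^2+\ldots+t_d^2)^{\theta/2},\quad w_0(t)=(t_1^2+\ldots+t_d^2)^{\theta_0/2},\quad w_j(t)=t_j^{\theta_1},\ j=1,\ldots,d,\qquad t\in\mathbb R_+^d.$$ Put $$\alpha=\frac\mu{p\mu+r\lambda},\qquad\beta=\frac\lambda{p\mu+r\lambda}.$$ Then for all $x$ such that $w_0x\in L_p(\mathbb R_+^d)$ and $w_jx\in L_r(\mathbb R_+^d)$, $j=1,\ldots,d$, the inequality $$\|wx\|_{L_q(\mathbb R_+^d)}\le C\|w_0x\|_{L_p(\mathbb R_+^d)}^{p\alpha}\left(\max_{1\le j\le d}\|w_jx\|_{L_r(\mathbb R_+^d)}\right)^{r\beta}$$ holds and is sharp (the constant cannot be replaced by a smaller one), where $$C=\frac{d^\beta}{(p\alpha)^\alpha(r\beta)^\beta}\left(\frac I{\lambda+\mu}B\left(\frac\alpha{1/q-\alpha-\beta},\frac\beta{1/q-\alpha-\beta}\right)\right)^{1/q-\alpha-\beta},$$ $B$ is the Euler beta-function, and $$I=\int_{\Pi_+^{d-1}}\frac{J(\omega)\,d\omega}{\left(\sum_{k=1}^d\widetilde t_k^{\,d(r-1)+\mu}(\omega)\right)^{\frac\beta{1/q-\alpha-\beta}}}.$$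
   Context: Parameter sets (all exponents finite): $P=\{(p,q,r):1\le q<p,r<\infty\}$, $P_1=\{(p,q,r):1\le q=r<p<\infty\}$, $P_2=\{(p,q,r):1\le q=p<r<\infty\}$. $\mathbb R_+=[0,+\infty)$, $\mathbb R_+^d$ carries Lebesgue measure, functions are real- or complex-valued. $\Pi_+^{d-1}=[0,\pi/2]^{d-1}$, $\omega=(\omega_1,\ldots,\omega_{d-1})$, $J(\omega)=\sin^{d-2}\omega_1\sin^{d-3}\omega_2\cdots\sin\omega_{d-2}$, and $\widetilde t_1(\omega)=\cos\omega_1$, $\widetilde t_2(\omega)=\sin\omega_1\cos\omega_2$, ..., $\widetilde t_{d-1}(\omega)=\sin\omega_1\cdots\sin\omega_{d-2}\cos\omega_{d-1}$, $\widetilde t_d(\omega)=\sin\omega_1\cdots\sin\omega_{d-2}\sin\omega_{d-1}$. (For $d=1$, $\Pi_+^{0}$ is a single point of mass $1$, $\widetilde t_1=1$, $J=1$, so that $I=1$.) *)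

(* Defs.v *)
From HB Require Import structures.
From mathcomp Require Import all_boot all_order all_algebra.
From mathcomp Require Import complex.
From mathcomp Require Import all_classical all_reals all_analysis.

Set Implicit Arguments.
Unset Strict Implicit.
Unset Printing Implicit Defensive.
Import Order.TTheory GRing.Theory Num.Theory.
Import numFieldNormedType.Exports.

Local Open Scope classical_set_scope.
Local Open Scope ring_scope.

(* The n-dimensional Lebesgue measure on n.-tuple R, by recursion on n: the
   image of a product measure under (a, t) |-> a :: t. In dimension 0 it is the
   unit mass at the only point. *)

Definition cons_pair (T : Type) (n : nat) (z : T * n.-tuple T) :
  n.+1.-tuple T := [tuple of z.1 :: z.2].

Lemma measurable_cons_pair d (T : measurableType d) n :
  measurable_fun [set: T * n.-tuple T] (@cons_pair T n).
Proof. exact: measurable_cons. Qed.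

Section cons_measure.
Context d (T : measurableType d) (R : realType) (n : nat).
Variables (m1 : {sigma_finite_measure set T -> \bar R})
          (m2 : {sigma_finite_measure set (n.-tuple T) -> \bar R}).
Local Open Scope ereal_scope.

Definition cons_measure : set (n.+1.-tuple T) -> \bar R :=
  pushforward (m1 \x m2) (@cons_pair T n).

Let cons_measure0 : cons_measure set0 = 0.
Proof. by rewrite /cons_measure /pushforward preimage_set0 measure0. Qed.

Let cons_measure_ge0 A : 0 <= cons_measure A.
Proof.
by rewrite /cons_measure /pushforward; exact: (measure_ge0 (m1 \x m2)).
Qed.

Let cons_measure_sigma_additive : semi_sigma_additive cons_measure.
Proof.
have mf := @measurable_cons_pair _ T n.
exact: (@measure_semi_sigma_additive _ _ _
  (measure_function_pushforward__canonical__measure_function_Measure _ mf)).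
Qed.

HB.instance Definition _ := isMeasure.Build _ _ _ cons_measure
  cons_measure0 cons_measure_ge0 cons_measure_sigma_additive.

Let cons_measure_sigma_finite : sigma_finite setT cons_measure.
Proof.
have /sigma_finiteP[F [TF ndF Foo]] := sigma_finiteT m1.
have /sigma_finiteP[G [TG ndG Goo]] := sigma_finiteT m2.
pose u (t : n.+1.-tuple T) : T * n.-tuple T := (thead t, [tuple of behead t]).
have mu_ : measurable_fun setT u.
  by apply/measurable_fun_pairP; split;
    [exact: measurable_tnth|exact: measurable_behead].
have uK : cancel (@cons_pair T n) u.
  by move=> [a s]; rewrite /u /cons_pair/=; congr pair; exact/val_inj.
exists (fun k => u @^-1` (F k `*` G k)).
  apply/esym; rewrite -subTset => t _.
  have [i _ Fi] : (\bigcup_i F i) (u t).1 by rewrite -TF.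
  have [j _ Gj] : (\bigcup_i G i) (u t).2 by rewrite -TG.
  exists (maxn i j) => //; split.
    by move: Fi; exact/subsetPset/ndF/leq_maxl.
  by move: Gj; exact/subsetPset/ndG/leq_maxr.
move=> k; have [mF Fk] := Foo k; have [mG Gk] := Goo k; split.
  by rewrite -[X in measurable X]setTI; apply: mu_ => //; exact: measurableX.
rewrite /cons_measure /pushforward -comp_preimage.
rewrite (_ : u \o _ = idfun)//; last by apply/funext => z /=; rewrite uK.
by rewrite preimage_id product_measure1E// lte_mul_pinfty// ge0_fin_numE.
Qed.

HB.instance Definition _ := Measure_isSigmaFinite.Build _ _ _ cons_measure
  cons_measure_sigma_finite.

End cons_measure.

Section lebesgue_tuple.
Variable R : realType.

Fixpoint lebesgue_tuple (n : nat) :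
    {sigma_finite_measure set (n.-tuple (measurableTypeR R)) -> \bar R} :=
  match n with
  | 0%N => @dirac _ (0.-tuple (measurableTypeR R)) [tuple] R
  | n'.+1 => cons_measure (@lebesgue_measure R) (lebesgue_tuple n')
  end.

Lemma lebesgue_tuple_box (n : nat) (a b : n.-tuple R) :
  (forall i, tnth a i <= tnth b i) ->
  lebesgue_tuple n [set t | forall i, tnth t i \in `[tnth a i, tnth b i]] =
  (\prod_(i < n) (tnth b i - tnth a i))%:E.
Proof.
elim: n a b => [|n IH] a b ab.
  rewrite /= diracE big_ord0 mem_set//= => -[] //.
rewrite /= /cons_measure /pushforward.
pose a' := [tuple of behead a]; pose b' := [tuple of behead b].
have tb (c : n.+1.-tuple R) i : tnth [tuple of behead c] i = tnth c (lift ord0 i).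
  by rewrite [in RHS](tuple_eta c) tnthS.
have -> : @cons_pair (measurableTypeR R) n @^-1`
    [set t | forall i, tnth t i \in `[tnth a i, tnth b i]] =
    `[tnth a ord0, tnth b ord0]%classic `*`
    [set t | forall i, tnth t i \in `[tnth a' i, tnth b' i]].
  apply/seteqP; split => -[x t]/= H.
    split; first exact: (H ord0).
    by move=> i; have := H (lift ord0 i); rewrite /cons_pair tnthS !tb.
  case: H => H0 H i; case: (unliftP ord0 i) => [j ->|-> //].
  by rewrite /cons_pair tnthS -!tb.
rewrite product_measure1E//; last first.
  rewrite (_ : mkset _ = \bigcap_(i in [set: 'I_n])
     ((@tnth _ (measurableTypeR R) ^~ i) @^-1` `[tnth a' i, tnth b' i]%classic)); last first.
    apply/seteqP; split => t /= H i; first by move=> _; exact: H.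
    exact: (H i Logic.I).
  apply: fin_bigcap_measurable => // i _.
  rewrite -[X in measurable X]setTI; exact: measurable_tnth.
rewrite IH; last by move=> i; rewrite !tb.
rewrite big_ord_recl/= lebesgue_measure_itv/= lte_fin EFinM.
have := ab ord0; rewrite le_eqVlt => /orP[/eqP ->|->].
  by rewrite ltxx subrr !mul0e.
by rewrite EFinB; under eq_bigr do rewrite !tb.
Qed.

End lebesgue_tuple.

Section lebesgue_spaces.
Context (R : realType) (d : nat).
Implicit Types (D : set (d.-tuple (measurableTypeR R))) (p : R).
Implicit Types f g : d.-tuple (measurableTypeR R) -> R[i].

Definition Lp_norm D p f : \bar R :=
  'N[lebesgue_tuple R d]_p%:E[(fun t => (Normc.normc (f t))%:E) \_ D].

(* A function is Lebesgue measurable when it agrees almost everywhere with a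
   Borel function; the sigma-algebra of n.-tuple R is the Borel one. *)
Definition ae_measurable D f := exists g,
  [/\ measurable_fun D (fun t => complex.Re (g t) : measurableTypeR R),
      measurable_fun D (fun t => complex.Im (g t) : measurableTypeR R) &
      {ae lebesgue_tuple R d, forall t, D t -> f t = g t}].

Definition in_Lp D p f := ae_measurable D f /\ (Lp_norm D p f < +oo)%E.

Definition weighted (w : d.-tuple (measurableTypeR R) -> R) f :
  d.-tuple (measurableTypeR R) -> R[i] := fun t => (w t)%:C%C * f t.

Definition orthant : set (d.-tuple (measurableTypeR R)) :=
  [set t | forall i, 0 <= tnth t i].

Definition real_valued : set (d.-tuple (measurableTypeR R) -> R[i]) :=
  [set f | forall t, complex.Im (f t) = 0].

End lebesgue_spaces.
Arguments orthant : clear implicits.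
Arguments real_valued : clear implicits.

(* C is the smallest real constant with L x <= C * M x for all x in X. *)
Definition sharp_constant (R : realType) (T : Type) (X : set T)
    (L M : T -> \bar R) (C : R) :=
  (forall x, X x -> L x <= C%:E * M x)%E /\
  (forall C' : R, (forall x, X x -> L x <= C'%:E * M x)%E -> C <= C').

Definition euler_beta (R : realType) (a b : R) : R :=
  \int[@lebesgue_measure R]_(s in `[0, 1])
    (s `^ (a - 1) * (1 - s) `^ (b - 1)).

Section spherical_coordinates.
Context (R : realType) (d : nat).
Implicit Type omega : d.-1.-tuple (measurableTypeR R).

(* Indices start at 0: tnth omega i is omega_{i+1}, and sphere_coord k is the
   coordinate numbered k+1, which has no cosine factor when k = d - 1. *)
Definition sphere_coord (k : 'I_d) omega : R :=
  (\prod_(i < d.-1 | (i < k)%N) sin (tnth omega i)) *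
  (\prod_(i < d.-1 | i == k :> nat) cos (tnth omega i)).

Definition sphere_jacobian omega : R :=
  \prod_(i < d.-1) sin (tnth omega i) ^+ (d.-2 - i).

Definition angle_box : set (d.-1.-tuple (measurableTypeR R)) :=
  [set omega | forall i, 0 <= tnth omega i <= pi / 2].

Definition angular_integral (s e : R) : R :=
  \int[lebesgue_tuple R d.-1]_(omega in angle_box)
    (sphere_jacobian omega / (\sum_(k < d) sphere_coord k omega `^ s) `^ e).

End spherical_coordinates.

(* Main.v *)
(* For positive multipliers [a1], [a2], Young's inequality at each point [t] bounds
   [xi ^ q] by a linear combination of the integrands of the [L_p]- and [L_r]-norms
   plus a remainder that does not depend on [xi], with equality when [xi] solves the
   Euler-Lagrange equation [w_q xi^(q-1) = w_p xi^(p-1) / a1 + w_r xi^(r-1) / a2].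
   Integrating the remainder in polar coordinates splits off the angular integral and
   leaves a radial one, which becomes a beta integral once the share [u] of the
   [L_r]-term in this equation is taken as the variable; the multiplicative inequality
   is the optimum over [a1] and [a2]. The solution for [a1 = a2 = 1] is invariant under
   permutations of the coordinates, so all its [L_r]-norms agree with their maximum, and
   it gives equality. *)

Require Import Defs.
From HB Require Import structures.
From mathcomp Require Import all_boot all_order all_algebra.
From mathcomp Require Import perm complex.
From mathcomp Require Import all_classical all_reals all_analysis.
From mathcomp Require Import measurable_realfun.
From mathcomp Require Import ring lra.

Set Implicit Arguments.
Unset Strict Implicit.
Unset Printing Implicit Defensive.
Import Order.TTheory GRing.Theory Num.Theory.
Import numFieldNormedType.Exports.

Local Open Scope classical_set_scope.
Local Open Scope ring_scope.

(** With [rho] the Euclidean norm of [t], [e = d(r-1) + mu], [s] the ratio of [sum_j t_j^e] to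
    [rho^e], and [y = rho^d xi], the three integrands become [rho^(-d)] times [y^q],
    [rho^(-lambda) y^p] and [rho^mu s y^r]. The pointwise problem thus involves only [rho] and [s],
    and in polar coordinates [rho^(-d)] turns the radial element into [d rho / rho]. The
    Euler-Lagrange equation has in general no closed solution, but [rho] and [y] are explicit in the
    share [u]: [u^(p-q)] is proportional to [rho^kappa (1-u)^(r-q)] with
    [kappa = lambda(r-q) + mu(p-q)], and [y^q] to [(1-u)^G u^H], where [G = q mu / kappa] and
    [H = q lambda / kappa] are the two parameters of the beta function in [C]. The obstacle is the
    boundary cases [p = q] and [r = q]: on part of the radii the equation has no positive solution,
    the share is stuck at 0 or 1, and [y = 0]. The definitions absorb this, so all exponents share
    one argument. The factor [d^beta] comes from bounding the sum of the [d] integrals of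
    [|w_j x|^r] by [d] times the largest. *)

(** * Transfer of integrals, null sets, and iterated integrals over rectangles *)

Section integral_transfer.
Local Open Scope ereal_scope.
Context d1 d2 (X : measurableType d1) (Y : measurableType d2) (R : realType).
Variables (mu : {measure set X -> \bar R}) (nu : {measure set Y -> \bar R}).
Variables (D : set Y) (phi : Y -> X) (h : Y -> R).
Hypotheses (mD : measurable D) (mphi : measurable_fun D phi)
  (mh : measurable_fun D h) (h0 : forall y, D y -> (0 <= h y)%R)
  (muE : forall A, measurable A ->
    mu A = \int[nu]_(y in D) (\1_A (phi y) * h y)%:E).

Import HBNNSimple.

(** The hypothesis [muE] is the case of an indicator. Linearity extends it to simple functions, and
    monotone convergence along [nnsfun_approx] to all nonnegative measurable ones. *)
Lemma ge0_integral_transfer (f : X -> \bar R) :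
  measurable_fun setT f -> (forall x, 0 <= f x) ->
  \int[mu]_x f x = \int[nu]_(y in D) (f (phi y) * (h y)%:E).
Proof.
move=> mf f0; pose f_ := nnsfun_approx measurableT mf.
have mfphi (g : X -> \bar R) : measurable_fun setT g ->
    measurable_fun D (fun y => g (phi y) * (h y)%:E).
  move=> mg; apply: emeasurable_funM; first exact: measurableT_comp mphi.
  exact/measurable_EFinP.
have fE x : f x = limn (fun n => (f_ n x)%:E).
  by apply/esym/cvg_lim => //; exact: cvg_nnsfun_approx.
have nd_f x : nondecreasing_seq (fun n => (f_ n x)%:E).
  by move=> m n mn; rewrite lee_fin; exact/lefP/nd_nnsfun_approx.
transitivity (limn (fun n => \int[mu]_x (f_ n x)%:E)).
  rewrite -monotone_convergence//.
  - by apply: eq_integral => x _; exact: fE.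
  - by move=> n; exact/measurable_EFinP.
  - by move=> n x _; rewrite lee_fin.
transitivity (limn (fun n => \int[nu]_(y in D) ((f_ n (phi y))%:E * (h y)%:E))); last first.
  rewrite -monotone_convergence//.
  - apply: eq_integral => y /[!inE] Dy; rewrite fE.
    apply: cvg_lim => //; apply: (@cvgeZr _ \oo R (fun n => (f_ n (phi y))%:E)) => //.
    exact: ereal_nondecreasing_is_cvgn.
  - by move=> n; apply: (mfphi (fun x => (f_ n x)%:E)); exact/measurable_EFinP.
  - by move=> n y Dy; rewrite -EFinM lee_fin mulr_ge0// h0.
  - by move=> y Dy m n mn; apply: lee_wpmul2r; rewrite ?lee_fin ?h0//; exact: nd_f.
congr (limn _); apply/funext => n.
under eq_integral do rewrite fimfunE -fsumEFin//.
rewrite ge0_integral_fsum//; last 2 first.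
- by move=> r; exact/measurable_EFinP/measurable_funM.
- by move=> r x _; rewrite nnfun_muleindic_ge0.
transitivity (\sum_(r \in range (f_ n))
    \int[nu]_(y in D) ((r * \1_(f_ n @^-1` [set r]) (phi y))%:E * (h y)%:E)).
  apply: eq_fsbigr => r /set_mem [x _ <-].
  rewrite integralZl_indic_nnsfun// integral_indic// setIT muE//.
  rewrite -ge0_integralZl//.
  - by apply: eq_integral => y _; rewrite -EFinM mulrA EFinM.
  - apply/measurable_EFinP; apply: measurable_funM => //.
    by apply: measurableT_comp.
  - by move=> y Dy; rewrite lee_fin mulr_ge0// ?h0.
  - by rewrite lee_fin.
rewrite -ge0_integral_fsum//.
- apply: eq_integral => y /[!inE] Dy.
  rewrite -ge0_mule_fsuml; last by move=> r; rewrite EFinM nnfun_muleindic_ge0.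
  by rewrite fsumEFin// -fimfunE.
- by move=> r; apply: (mfphi (fun x => (r * \1_(f_ n @^-1` [set r]) x)%:E)); exact/measurable_EFinP/measurable_funM.
- by move=> r y Dy; apply: mule_ge0; [rewrite EFinM nnfun_muleindic_ge0|rewrite lee_fin h0].
Qed.

End integral_transfer.

Section integral_off_negligible.
Local Open Scope ereal_scope.
Context d (T : measurableType d) (R : realType).
Variable mu : {measure set T -> \bar R}.
Implicit Types f g : T -> \bar R.

Import HBNNSimple.

(** Neither function has to be measurable, which matters because the functions of the theorem are
    Borel only up to a null set. The integral of [f] is a supremum over simple functions below [f],
    and such a function, set to zero on [N], lies below [g] everywhere. *)
Lemma ge0_le_integral_off_null (N : set T) f g :
  measurable N -> mu N = 0 -> (forall x, 0 <= f x) -> (forall x, 0 <= g x) ->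
  (forall x, ~ N x -> f x <= g x) -> \int[mu]_x f x <= \int[mu]_x g x.
Proof.
move=> mN N0 f0 g0 fg; rewrite ge0_integralTE//; apply: ge_ereal_sup => _ [k/= kf <-].
have mk : measurable_fun setT (EFin \o k) by exact/measurable_EFinP.
rewrite -integralT_nnsfun (ge0_negligible_integral mN)//=; last first.
  by move=> x _; rewrite lee_fin.
have mTN : measurable (setT `\` N) by exact: measurableD.
pose k' := proj_nnsfun k mTN.
rewrite [leLHS](_ : _ = \int[mu]_x (k' x)%:E); last first.
  rewrite integral_mkcond; apply: eq_integral => x _; rewrite patchE /k' /= mindicE.
  by case: ifPn => _; rewrite ?mulr1 ?mulr0.
rewrite integralT_nnsfun ge0_integralTE//; apply: ereal_sup_ubound; exists k' => //= x.
rewrite mindicE; case: (boolP (x \in _)) => [/set_mem[_ Nx]|_]; last by rewrite mulr0.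
by rewrite mulr1 (le_trans (kf x))// fg.
Qed.

End integral_off_negligible.

Section tonelli_domain.
Local Open Scope ereal_scope.
Context d1 d2 (T1 : measurableType d1) (T2 : measurableType d2) (R : realType).
Variables (m1 : {sigma_finite_measure set T1 -> \bar R})
  (m2 : {sigma_finite_measure set T2 -> \bar R}).
Variables (D1 : set T1) (D2 : set T2) (f : T1 -> T2 -> \bar R).
Hypotheses (mD1 : measurable D1) (mD2 : measurable D2)
  (mf : measurable_fun (D1 `*` D2) (fun z => f z.1 z.2))
  (f0 : forall x y, D1 x -> D2 y -> 0 <= f x y).

Let g := (fun z => f z.1 z.2) \_ (D1 `*` D2).

Let mg : measurable_fun setT g.
Proof. by apply/(measurable_restrictT _ _).1 => //; exact: measurableX. Qed.

Let g0 z : 0 <= g z.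
Proof. by rewrite /g patchE; case: ifPn => // /set_mem[]; exact: f0. Qed.

Let gE x y : g (x, y) = if x \in D1 then if y \in D2 then f x y else 0 else 0.
Proof. by by rewrite /g patchE in_setX/=; case: (x \in D1); case: (y \in D2). Qed.

Let gF x : \int[m2]_y g (x, y) = ((fun x => \int[m2]_(y in D2) f x y) \_ D1) x.
Proof.
rewrite patchE; case: ifPn => xD1; last first.
  by rewrite integral0_eq// => y _; rewrite gE (negbTE xD1).
by rewrite [RHS]integral_mkcond; apply: eq_integral => y _; rewrite gE xD1 patchE.
Qed.

Let gG y : \int[m1]_x g (x, y) = ((fun y => \int[m1]_(x in D1) f x y) \_ D2) y.
Proof.
rewrite patchE; case: ifPn => yD2; last first.
  by rewrite integral0_eq// => x _; rewrite gE (negbTE yD2); case: ifP.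
by rewrite [RHS]integral_mkcond; apply: eq_integral => x _; rewrite gE yD2 patchE.
Qed.

Lemma ge0_tonelli_in : \int[m1]_(x in D1) \int[m2]_(y in D2) f x y =
  \int[m2]_(y in D2) \int[m1]_(x in D1) f x y.
Proof.
rewrite integral_mkcond [RHS]integral_mkcond.
under eq_integral do rewrite -gF.
under [in RHS]eq_integral do rewrite -gG.
exact: fubini_tonelli.
Qed.

Lemma measurable_fun_tonelli_in :
  measurable_fun D1 (fun x => \int[m2]_(y in D2) f x y).
Proof.
apply/(measurable_restrictT _ _).2 => //.
rewrite [X in measurable_fun _ X](_ : _ = fubini_F m2 g).
  exact: measurable_fun_fubini_tonelli_F.
by apply/funext => x; rewrite -gF.
Qed.

Lemma ge0_integral_setX : \int[m1 \x m2]_(z in D1 `*` D2) f z.1 z.2 =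
  \int[m1]_(x in D1) \int[m2]_(y in D2) f x y.
Proof.
rewrite integral_mkcond [RHS]integral_mkcond fubini_tonelli1//.
by apply: eq_integral => x _; exact: gF.
Qed.

End tonelli_domain.

(** * Change of variables on an interval *)

Section density_measure.
Local Open Scope ereal_scope.
Context d1 d2 (X : measurableType d1) (Y : measurableType d2) (R : realType).
Variables (nu : {measure set Y -> \bar R}) (D : set Y) (phi : Y -> X) (h : Y -> R).
Hypotheses (mD : measurable D) (mphi : measurable_fun D phi)
  (mh : measurable_fun D h) (h0 : forall y, D y -> (0 <= h y)%R).

(* The hypotheses are arguments so that the measure structure can be attached
   to the definition. *)
Definition image_density (_ : measurable D) (_ : measurable_fun D phi)
    (_ : measurable_fun D h) (_ : forall y, D y -> (0 <= h y)%R) (A : set X) :=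
  \int[nu]_(y in D `&` phi @^-1` A) (h y)%:E.

Local Notation dens := (image_density mD mphi mh h0).

Let image_density0 : dens set0 = 0.
Proof. by rewrite /image_density preimage_set0 setI0 integral_set0. Qed.

Let image_density_ge0 A : 0 <= dens A.
Proof. by apply: integral_ge0 => y [Dy _]; rewrite lee_fin h0. Qed.

Let image_density_sigma_additive : semi_sigma_additive dens.
Proof.
move=> A mA tA mUA; rewrite /image_density preimage_bigcup setI_bigcupr.
rewrite ge0_integral_bigcup//=.
- apply: is_cvg_ereal_nneg_natsum_cond => n _ _; exact: image_density_ge0.
- by move=> n; exact: mphi.
- apply/measurable_EFinP; apply: measurable_funS mh => //.
  by move=> y [n _ []].
- by move=> y [n _ [Dy _]]; rewrite lee_fin h0.
- move=> i j _ _ [y [[_ Ai] [_ Aj]]]; apply: (tA i j) => //.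
  by exists (phi y).
Qed.

HB.instance Definition _ := isMeasure.Build _ _ _ dens
  image_density0 image_density_ge0 image_density_sigma_additive.

Lemma image_densityE A : measurable A ->
  dens A = \int[nu]_(y in D) (\1_A (phi y) * h y)%:E.
Proof.
move=> mA; rewrite /image_density integral_mkcondr; apply: eq_integral => y _.
rewrite patchE indicE; case: ifPn => [/set_mem yA|/negP yA].
  by rewrite mem_set// mul1r.
by rewrite memNset ?mul0r// => yA'; apply: yA; exact/mem_set.
Qed.

End density_measure.

Section change_of_variables.
Context (R : realType).
Local Notation mu := (@lebesgue_measure R).
Variables (F f : R -> R) (a b : R).
Hypotheses (dF : forall x, x \in `]a, b[ -> is_derive x 1 F (f x))
  (cf : {in `]a, b[, continuous f}) (f0 : forall x, x \in `]a, b[ -> 0 < f x).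

Let cF : {in `]a, b[, continuous F}.
Proof.
move=> x xab; apply/differentiable_continuous; rewrite -derivable1_diffP.
by have [] := dF xab.
Qed.

Let incF x y : x \in `]a, b[ -> y \in `]a, b[ -> (F x < F y) = (x < y).
Proof.
have H u v : u \in `]a, b[ -> v \in `]a, b[ -> u < v -> F u < F v.
  move=> uab vab uv; apply: (@gtr0_derive1_lt_oo _ F a b) => //.
  - by move=> z zab; have [] := dF zab.
  - by move=> z zab; rewrite derive1E; have [_ ->] := dF zab; exact: f0.
  - by move=> z /[1!inE]; exact: cF.
move=> xab yab; apply/idP/idP; last exact: H.
by case: (ltgtP x y) => // [yx|->]; rewrite ?ltxx// => xy; have := lt_trans xy (H _ _ yab xab yx); rewrite ltxx.
Qed.

Let leF x y : x \in `]a, b[ -> y \in `]a, b[ -> (F x <= F y) = (x <= y).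
Proof. by move=> xab yab; rewrite !leNgt incF. Qed.

Section segment.
Variables (c d : R).
Hypotheses (ac : a < c) (cd : c < d) (db : d < b).

Let sub x : x \in `[c, d] -> x \in `]a, b[.
Proof.
rewrite !in_itv/= => /andP[cx xd].
by rewrite (lt_le_trans ac cx) (le_lt_trans xd db).
Qed.

Let cab : c \in `]a, b[. Proof. by apply: sub; rewrite in_itv/= lexx ltW. Qed.
Let dab : d \in `]a, b[. Proof. by apply: sub; rewrite in_itv/= lexx ltW. Qed.

Let FTC y : y \in `[c, d] -> (\int[mu]_(x in `[c, y]) (f x)%:E = (F y - F c)%:E)%E.
Proof.
move=> ycd; have := ycd; rewrite in_itv/= => /andP[]; rewrite le_eqVlt.
move=> /predU1P[<- _|cy yd]; first by rewrite set_itv1 integral_set1 subrr.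
have sub' z : z \in `[c, y] -> z \in `]a, b[.
  by rewrite in_itv/= => /andP[cz zy]; apply: sub; rewrite in_itv/= cz (le_trans zy).
rewrite (continuous_FTC2 (F := F) cy) ?EFinB//.
- by apply: continuous_in_subspaceT => z /[1!inE] /sub'; exact: cf.
- have yab : y \in `]a, b[ by apply: sub'; rewrite in_itv/= lexx ltW.
  split.
  + by move=> z zcy; have [] := dF (sub' _ (subset_itv_oo_cc zcy)).
  + by apply/cvg_at_right_filter/cF/cab.
  + by apply/cvg_at_left_filter/cF/yab.
- by move=> z zcy; rewrite derive1E; have [] := dF (sub' _ (subset_itv_oo_cc zcy)).
Qed.

Lemma segment_IVT y : F c <= y <= F d -> exists2 x, x \in `[c, d] & F x = y.
Proof.
move=> yFcd; apply: IVT => //; first exact: ltW.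
  by apply: continuous_in_subspaceT => z /[1!inE] /sub; exact: cF.
by rewrite /Num.min /Num.max incF// cd.
Qed.

Let mF : measurable_fun `[c, d] F.
Proof.
apply: subspace_continuous_measurable_fun => //.
by apply: continuous_in_subspaceT => z /[1!inE] /sub; exact: cF.
Qed.

Let mf : measurable_fun `[c, d] f.
Proof.
apply: subspace_continuous_measurable_fun => //.
by apply: continuous_in_subspaceT => z /[1!inE] /sub; exact: cf.
Qed.

Let f0' x : `[c, d]%classic x -> (0 <= f x)%R.
Proof. by move=> /= xcd; apply/ltW/f0/sub. Qed.

Let mcd : measurable (`[c, d]%classic : set (measurableTypeR R)). Proof. by []. Qed.
Let mFcd : measurable (`[F c, F d]%classic : set (measurableTypeR R)). Proof. by []. Qed.

Local Notation dens := (@image_density _ _ (measurableTypeR R) (measurableTypeR R) R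
  mu `[c, d] F f mcd mF mf f0').

(** The fundamental theorem of calculus: for [v = F y] the ray cuts the image segment at [v] and the
    parameter segment at [y]. Rays are a generating pi-system, so agreement on them identifies the
    two measures. *)
Let ray v : (mrestr mu mFcd `]-oo, v[ = dens `]-oo, v[)%E.
Proof.
have Fcd : F c < F d by rewrite incF.
have ccd : c \in `[c, d] by rewrite in_itv/= lexx ltW.
have dcd : d \in `[c, d] by rewrite in_itv/= lexx ltW.
rewrite /mrestr /image_density.
have [vc|cv] := leP v (F c).
  rewrite (_ : _ `&` _ = set0) ?measure0; last first.
    apply/seteqP; split => // x [/=]; rewrite !in_itv/= => xv /andP[Fx _].
    by have := le_lt_trans (le_trans vc Fx) xv; rewrite ltxx.
  rewrite (_ : _ `&` _ = set0) ?integral_set0//.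
  apply/seteqP; split => // x [/= xcd]; rewrite in_itv/= => Fxv.
  have := lt_le_trans Fxv vc; rewrite incF ?sub//.
  by move: xcd; rewrite in_itv/= => /andP[cx _]; rewrite ltNge cx.
have [vd|dv] := leP v (F d).
  have [y ycd Fy] : exists2 y, y \in `[c, d] & F y = v by apply: segment_IVT; rewrite (ltW cv).
  rewrite (_ : _ `&` _ = `[F c, v[%classic); last first.
    apply/seteqP; split => x /=; rewrite !in_itv/=.
      by move=> [xv /andP[-> _]].
    by move=> /andP[-> xv]; rewrite xv (le_trans (ltW xv)).
  rewrite (_ : _ `&` _ = `[c, y[%classic); last first.
    apply/seteqP; split => x /=; rewrite -Fy.
      by move=> [xcd]; rewrite !in_itv/= incF ?sub// => ->; move: xcd; rewrite in_itv/= => /andP[->].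
    rewrite !in_itv/= => /andP[cx xy]; have xcd : x \in `[c, d].
      by rewrite in_itv/= cx (le_trans (ltW xy))//; move: ycd; rewrite in_itv/= => /andP[].
    by rewrite incF ?sub//; move: xcd; rewrite in_itv/= => ->.
  rewrite lebesgue_measure_itv/= lte_fin cv.
  rewrite integral_itv_bndo_bndc; last first.
    apply/measurable_EFinP; apply: measurable_funS mf => //.
    move=> x /=; rewrite !in_itv/= => /andP[-> xy]; rewrite (le_trans (ltW xy))//.
    by move: ycd; rewrite in_itv/= => /andP[].
  by rewrite (FTC ycd) Fy EFinB.
rewrite (_ : _ `&` _ = `[F c, F d]%classic); last first.
  apply/seteqP; split => x /=; rewrite !in_itv/=; first by case.
  by move=> /andP[-> xd]; rewrite xd (le_lt_trans xd).
rewrite (_ : _ `&` _ = `[c, d]%classic); last first.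
  apply/seteqP; split => x /=; first by case.
  move=> xcd; split => //; rewrite in_itv/= (le_lt_trans _ dv)// leF ?sub//.
  by move: xcd; rewrite in_itv/= => /andP[].
by rewrite lebesgue_measure_itv/= lte_fin Fcd (FTC dcd) EFinB.
Qed.

Let measE A : measurable A ->
  (mrestr mu mFcd A = \int[mu]_(x in `[c, d]) (\1_A (F x) * f x)%:E)%E.
Proof.
move=> mA; rewrite -(@image_densityE _ _ (measurableTypeR R) (measurableTypeR R) R
  mu `[c, d] F f mcd mF mf f0' A mA).
apply: (@measure_unique _ R (measurableTypeR R) (@RGenInftyO.G R)
  (fun n => `]-oo, n%:R[%classic) (RGenInftyO.measurableE R) _ _ _
  (mrestr mu mFcd) dens) => //.
- move=> _ _ [u ->] [v ->]; exists (Num.min u v).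
  by apply/seteqP; split => x /=; rewrite !in_itv/= lt_min => /andP.
- by move=> n; exists n%:R.
- apply/seteqP; split => // x _; exists (Num.truncn `|x|).+1 => //=.
  by rewrite in_itv/= (le_lt_trans (ler_norm _))// truncnS_gt.
- by move=> _ [v ->]; exact: ray.
- move=> n; rewrite /mrestr (@le_lt_trans _ _ (mu `[F c, F d]%classic))//.
    by apply: le_measure; rewrite ?inE//; exact: measurableI.
  by rewrite lebesgue_measure_itv/=; case: ifP => _; rewrite -?EFinB ltry.
Qed.

Lemma ge0_change_of_variables_segment (g : R -> \bar R) : measurable_fun setT g -> (forall y, 0 <= g y)%E ->
  (\int[mu]_(y in `[F c, F d]) g y = \int[mu]_(x in `[c, d]) (g (F x) * (f x)%:E))%E.
Proof.
move=> mg g0.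
have ccd : c \in `[c, d] by rewrite in_itv/= lexx ltW.
have dcd : d \in `[c, d] by rewrite in_itv/= lexx ltW.
have mgD : measurable_fun setT (g \_ `[F c, F d]).
  by apply/(measurable_restrictT _ _).1 => //; exact: measurable_funTS.
rewrite (@eq_measure_integral _ _ _ _ (mrestr mu mFcd)); last first.
  by move=> A mA AD; rewrite /= /mrestr (setIidl AD).
rewrite integral_mkcond (@ge0_integral_transfer _ _ (measurableTypeR R) (measurableTypeR R) R
  (mrestr mu mFcd) mu _ _ _ mcd mF mf f0' measE)//; last first.
  by move=> y; exact: erestrict_ge0.
apply: eq_integral => x /set_mem/= xcd; rewrite patchE mem_set//=.
by move: (xcd); rewrite !in_itv/= => /andP[cx xd]; rewrite !leF ?sub// cx.
Qed.

End segment.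

(** No behaviour of [F] or [f] at the endpoints is assumed, since the substitutions made later, such
    as the tangent, blow up there. The open interval is exhausted by compact segments, on which the
    previous lemma applies. *)
Lemma ge0_change_of_variables (g : R -> \bar R) :
  measurable_fun setT g -> (forall y, 0 <= g y)%E ->
  (\int[mu]_(y in F @` `]a, b[) g y = \int[mu]_(x in `]a, b[) (g (F x) * (f x)%:E))%E.
Proof.
move=> mg g0.
have [ba|ab] := leP b a.
  by rewrite set_itv_ge ?image_set0 ?integral_set0// bnd_simp -leNgt.
(* The denominator starts at 3 so that already for [n = 0] twice the margin is less than [b - a] and
   [c n < d n]. *)
pose e n : R := (b - a) / n.+3%:R.
have e0 n : 0 < e n by rewrite divr_gt0// ?subr_gt0.
have e2 n : e n + e n < b - a.
  rewrite /e -mulr2n -[ltLHS]mulr_natr -mulrA gtr_pMr ?subr_gt0//.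
  by rewrite mulrC ltr_pdivrMr// mul1r ltr_nat.
pose c n := a + e n; pose d n := b - e n.
have ac n : a < c n by rewrite ltrDl.
have db n : d n < b by rewrite gtrBl.
have cd n : c n < d n by rewrite /c /d; have := e2 n; lra.
have ed m n : (m <= n)%N -> e n <= e m.
  by move=> mn; rewrite /e ler_pM2l ?subr_gt0// lef_pV2 ?posrE// ler_nat.
have cn m n : (m <= n)%N -> c n <= c m by move=> mn; rewrite lerD2l ed.
have dn m n : (m <= n)%N -> d m <= d n by move=> mn; rewrite lerD2l lerN2 ed.
have sub n x : x \in `[c n, d n] -> x \in `]a, b[.
  by rewrite !in_itv/= => /andP[cx xd]; rewrite (lt_le_trans (ac n))//= (le_lt_trans xd).
have cab n : c n \in `]a, b[ by apply: (sub n); rewrite in_itv/= lexx ltW.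
have dab n : d n \in `]a, b[ by apply: (sub n); rewrite in_itv/= lexx ltW.
have abE : `]a, b[%classic = \bigcup_n `[c n, d n]%classic.
  apply/seteqP; split => [x /=|x [n _ /sub]//]; rewrite in_itv/= => /andP[ax xb].
  pose n := Num.truncn ((b - a) / Num.min (x - a) (b - x)); exists n => //=.
  have m0 : 0 < Num.min (x - a) (b - x) by rewrite lt_min !subr_gt0 ax.
  have : e n <= Num.min (x - a) (b - x).
    rewrite ler_pdivrMr// mulrC -ler_pdivrMr// ltW//.
    by rewrite (lt_trans (truncnS_gt _))// ltr_nat.
  rewrite le_min => /andP[ex ey].
  by rewrite in_itv/=; apply/andP; rewrite /c /d; split; lra.
have imE : F @` `]a, b[ = \bigcup_n `[F (c n), F (d n)]%classic.
  rewrite abE image_bigcup; apply: eq_bigcup => // n _.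
  apply/seteqP; split => [_ [x/= xcd <-]|y/= ycd].
    by move: (xcd); rewrite !in_itv/= => /andP[cx xd];
    rewrite (leF (cab n) (sub n _ xcd)) (leF (sub n _ xcd) (dab n)) cx.
  by have [x xcd <-] := segment_IVT (ac n) (cd n) (db n) ycd; exists x.
have mfab : measurable_fun `]a, b[ f.
  apply: subspace_continuous_measurable_fun => //.
  by apply: continuous_in_subspaceT => z /[1!inE]; exact: cf.
have mFab : measurable_fun `]a, b[ F.
  apply: subspace_continuous_measurable_fun => //.
  by apply: continuous_in_subspaceT => z /[1!inE]; exact: cF.
have L : (\int[mu]_(y in `[F (c n), F (d n)]) g y @[n --> \oo] -->
    \int[mu]_(y in F @` `]a, b[) g y)%E.
  rewrite imE; apply: ge0_nondecreasing_set_cvg_integral => //.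
  - move=> m n mn; rewrite subsetEset => x /=; rewrite !in_itv/= => /andP[cx xd].
    by rewrite (le_trans _ cx) ?(le_trans xd)// leF// ?cn ?dn.
  - by move=> n; exact: measurable_funTS.
rewrite [X in X @ _ --> _](_ : _ =
    (fun n => \int[mu]_(x in `[c n, d n]) (g (F x) * (f x)%:E))%E) in L; last first.
  by apply/funext => n; rewrite ge0_change_of_variables_segment.
apply: (cvg_unique _ L) => //.
rewrite abE; apply: ge0_nondecreasing_set_cvg_integral => //.
- move=> m n mn; rewrite subsetEset => x /=; rewrite !in_itv/= => /andP[cx xd].
  by rewrite (le_trans _ cx) ?(le_trans xd)// ?cn ?dn.
- move=> n; apply: emeasurable_funM.
    apply: (measurableT_comp mg); apply: measurable_funS mFab => //; exact: sub.
  apply/measurable_EFinP; apply: measurable_funS mfab => //; exact: sub.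
- by move=> n x /= /sub xab; rewrite mule_ge0// lee_fin ltW// f0.
Qed.

End change_of_variables.

Section affine_change.
Local Open Scope ereal_scope.
Context (R : realType).
Local Notation mu := (@lebesgue_measure R).

Lemma ge0_integral_reflect (f : R -> \bar R) :
  measurable_fun setT f -> (forall x, 0 <= f x) ->
  \int[mu]_(x in `]0%R, 1%R[) f x = \int[mu]_(x in `]0%R, 1%R[) f (1 - x)%R.
Proof.
move=> mf f0; pose phi (x : measurableTypeR R) : measurableTypeR R := (1 - x)%R.
have mphi : measurable_fun setT phi by exact: measurable_funB.
have phiE a b : phi @^-1` `]a, b] = `[(1 - b)%R, (1 - a)%R[%classic.
  by apply/seteqP; split => x; rewrite /phi/= !in_itv/= => /andP[*]; apply/andP; split; lra.
have muE A : measurable A -> mu A = pushforward mu phi A.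
  apply: (@lebesgue_measure_unique R (pushforward mu phi)) => _ [[a b]] _ <-.
  rewrite [RHS](_ : _ = mu `[(1 - b)%R, (1 - a)%R[%classic); last by rewrite -phiE.
  rewrite /= !lebesgue_measure_itv/= !lte_fin.
  by rewrite ltrD2l ltrN2; case: ifP => // _; rewrite -!EFinB; congr (_%:E); lra.
rewrite (@eq_measure_integral _ _ _ _ (pushforward mu phi)); last first.
  by move=> A mA _; exact: muE.
rewrite (@ge0_integral_pushforward _ _ (measurableTypeR R) (measurableTypeR R) _ phi mphi mu)//; last exact: measurable_funTS.
congr (integral _ _ _); apply/seteqP.
by split => x; rewrite /phi/= !in_itv/= => /andP[*]; apply/andP; split; lra.
Qed.

Lemma ge0_integral_scale (k : R) (f : R -> \bar R) : (0 < k)%R ->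
  measurable_fun setT f -> (forall x, 0 <= f x) ->
  \int[mu]_(x in `]0%R, +oo[) f x = \int[mu]_(x in `]0%R, +oo[) (f (x * k)%R * k%:E).
Proof.
move=> k0 mf f0; pose phi (x : measurableTypeR R) : measurableTypeR R := (x * k)%R.
have mphi : measurable_fun setT phi by exact: measurable_funM.
have phiE a b : phi @^-1` `]a, b] = `](a / k)%R, (b / k)%R]%classic.
  by apply/seteqP; split => x; rewrite /phi/= !in_itv/= ltr_pdivrMr// ler_pdivlMr.
pose k' : {nonneg R} := NngNum (ltW k0).
have muE A : measurable A -> mu A = mscale k' (pushforward mu phi) A.
  apply: (@lebesgue_measure_unique R (mscale k' (pushforward mu phi))) => _ [[a b]] _ <-.
  rewrite [RHS](_ : _ = k%:E * mu `](a / k)%R, (b / k)%R]%classic); last by rewrite -phiE.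
  rewrite /= !lebesgue_measure_itv/= !lte_fin.
  rewrite ltr_pM2r ?invr_gt0//; case: ifP => // _; last by rewrite mule0.
  by rewrite -!EFinB -EFinM; congr (_%:E); field; rewrite gt_eqF.
rewrite (@eq_measure_integral _ _ _ _ (mscale k' (pushforward mu phi))); last first.
  by move=> A mA _; exact: muE.
rewrite ge0_integral_mscale//=; last exact: measurable_funTS.
rewrite (@ge0_integral_pushforward _ _ (measurableTypeR R) (measurableTypeR R) _ phi mphi mu)//; last exact: measurable_funTS.
rewrite (_ : phi @^-1` _ = `]0%R, +oo[%classic); last first.
  by apply/seteqP; split => x; rewrite /phi/= !in_itv/= !andbT pmulr_lgt0.
rewrite -ge0_integralZl//.
- by apply: eq_integral => x _; rewrite muleC.
- by apply: measurable_funTS; exact: measurableT_comp.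
- by move=> x _; exact: f0.
- by rewrite lee_fin ltW.
Qed.

End affine_change.

(** Inversion is written as [x (x^2)^(-1)], a real power of a nonnegative base; at [0] both sides
    are [0]. *)
Lemma measurable_inv (R : realType) : measurable_fun setT (fun x : R => x^-1).
Proof.
rewrite (_ : (fun _ => _) = (fun x : R => x * (x ^+ 2) `^ (-1))).
  apply: measurable_funM => //.
  apply: (@measurableT_comp _ _ _ _ _ _ (fun y : R => y `^ (-1)) _ (fun x : R => x ^+ 2)).
    exact: measurable_powR.
  exact: measurable_funX.
apply/funext => x; rewrite powR_inv1 ?sqr_ge0// expr2 invfM mulrA.
by have [->|x0] := eqVneq x 0; rewrite ?invr0 ?mul0r// mulfV// mul1r.
Qed.

Lemma measurable_cos (R : realType) : measurable_fun setT (@cos R).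
Proof. by apply: continuous_measurable_fun; exact: continuous_cos. Qed.

Lemma measurable_sin (R : realType) : measurable_fun setT (@sin R).
Proof. by apply: continuous_measurable_fun; exact: continuous_sin. Qed.

(** * Polar coordinates in the quarter plane *)

Section polar_plane.
Context (R : realType).
Local Notation mu := (@lebesgue_measure R).

Lemma tan_gt0_image (x : R) : 0 < x ->
  (fun w => x * tan w) @` `]0, pi / 2[ = `]0, +oo[%classic.
Proof.
move=> x0; apply/seteqP; split => [_ [w /= w0 <-]|y /=].
  rewrite !in_itv/= andbT mulr_gt0// /tan.
  move: w0; rewrite in_itv/= => /andP[w0 w1].
  by rewrite divr_gt0// ?sin_gt0_pihalf ?w0// cos_gt0_pihalf// w1 (lt_trans _ w0)// oppr_lt0 divr_gt0// pi_gt0.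
rewrite in_itv/= andbT => y0; exists (atan (y / x)) => /=; last first.
  by rewrite atanK mulrC mulfVK// gt_eqF.
by rewrite in_itv/= atan_ltpi2 -atan0 lt_atan// divr_gt0.
Qed.

Let cos_pos (w : R) : w \in `]0, pi / 2[ -> 0 < cos w.
Proof.
rewrite in_itv/= => /andP[w0 w1].
by rewrite cos_gt0_pihalf// w1 (lt_trans _ w0)// oppr_lt0 divr_gt0// pi_gt0.
Qed.

(** Two one-dimensional substitutions replace a planar Jacobian: [y = x tan w] for fixed [x], then,
    after exchanging the integrals, [x = rho cos w] for fixed [w]. Their derivatives [x / cos^2 w]
    and [cos w] multiply to [rho]. *)
Lemma ge0_polar_plane (g : R -> R -> \bar R) :
  measurable_fun setT (fun z : R * R => g z.1 z.2) -> (forall x y, 0 <= g x y)%E ->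
  (\int[mu]_(x in `]0%R, +oo[) \int[mu]_(y in `]0%R, +oo[) g x y =
   \int[mu]_(w in `]0%R, (pi / 2)%R[) \int[mu]_(rho in `]0%R, +oo[)
     (g (rho * cos w)%R (rho * sin w)%R * rho%:E))%E.
Proof.
move=> mg g0.
have mgc (d : measure_display) (T : measurableType d) (u v : T -> R) : measurable_fun setT u -> measurable_fun setT v ->
    measurable_fun setT (fun t => g (u t) (v t)).
  by move=> mu1 mv; apply: (@measurableT_comp _ _ _ _ _ _ _ _ (fun t => (u t, v t)) mg); exact: measurable_fun_pair.
have mcos := @measurable_cos R; have msin := @measurable_sin R.
have minv (h : R -> R) : measurable_fun setT h -> measurable_fun setT (fun x => (h x)^-1).
  by move=> mh; apply: measurableT_comp => //; exact: measurable_inv.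
have mtan : measurable_fun setT (@tan R) by apply: measurable_funM => //; exact: minv.
transitivity (\int[mu]_(x in `]0%R, +oo[) \int[mu]_(w in `]0%R, (pi / 2)%R[)
    (g x (x * tan w)%R * (x * (cos w ^+ 2)^-1)%:E))%E.
  apply: eq_integral => x; rewrite inE/= in_itv/= andbT => x0.
  have dT w : w \in `]0, pi / 2[ ->
      is_derive w 1 (fun w => x * tan w) (x * (cos w ^+ 2)^-1).
    by move=> /cos_pos cw; apply: is_deriveZ; apply: is_derive_tan; rewrite gt_eqF.
  rewrite -(tan_gt0_image x0) (ge0_change_of_variables dT)//.
  - move=> w /cos_pos cw; apply: cvgM; first exact: cvg_cst.
    apply: cvgV; first by rewrite expf_neq0// gt_eqF.
    apply: (@continuous_comp _ _ _ (@cos R) (fun y => y ^+ 2)); first exact: continuous_cos.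
    exact: exprn_continuous.
  - by move=> w /cos_pos cw; rewrite mulr_gt0// invr_gt0 exprn_gt0.
  - by apply: mgc.
rewrite (@ge0_tonelli_in _ _ _ _ R mu mu `]0%R, +oo[%classic `]0%R, (pi / 2)%R[%classic
  (fun x w => g x (x * tan w)%R * (x * (cos w ^+ 2)^-1)%:E)%E); [ | by [] | by [] | | ]; last 2 first.
  - apply: measurable_funTS; apply: emeasurable_funM.
      apply: mgc => //; apply: measurable_funM => //; exact: measurableT_comp.
    apply/measurable_EFinP; apply: measurable_funM => //.
    apply: (measurableT_comp (minv (fun w => cos w ^+ 2) _)) => //; exact: measurable_funX.
  - by move=> x w /=; rewrite in_itv/= andbT => x0 /cos_pos cw; rewrite mule_ge0// lee_fin divr_ge0 ?sqr_ge0 ?ltW.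
apply: eq_integral => w; rewrite inE/= => wI; have cw := cos_pos wI.
have cw0 : cos w != 0 by rewrite gt_eqF.
(* The absolute value makes the integrand nonnegative on the whole line, as the scaling lemma
   requires; on the half-line it changes nothing. The same device is used below for powers of the
   radius. *)
pose h x := (g x (x * tan w)%R * (`|x| * (cos w ^+ 2)^-1)%:E)%E.
transitivity (\int[mu]_(x in `]0%R, +oo[) h x)%E.
  apply: eq_integral => x; rewrite inE/= in_itv/= andbT => x0.
  by rewrite /h gtr0_norm.
rewrite (ge0_integral_scale cw).
- apply: eq_integral => x; rewrite inE/= in_itv/= andbT => x0.
  rewrite /h gtr0_norm ?mulr_gt0// -muleA -EFinM; congr (g _ _ * _%:E)%E.
    by rewrite /tan; field.
  by field.
- apply: emeasurable_funM; first by apply: mgc => //; exact: measurable_funM.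
  apply/measurable_EFinP; apply: measurable_funM => //; exact: measurableT_comp.
- by move=> x; rewrite mule_ge0// lee_fin divr_ge0 ?sqr_ge0.
Qed.

End polar_plane.

(** * Polar coordinates in the orthant *)

Section tuple_integral.
Context (R : realType).
Local Notation mu := (@lebesgue_measure R).
Local Notation leb := (lebesgue_tuple R).
Local Notation Rm := (measurableTypeR R).

Lemma ge0_integral_cons n (D1 : set Rm) (D2 : set (n.-tuple Rm))
    (D : set (n.+1.-tuple Rm)) (f : n.+1.-tuple Rm -> \bar R) :
  measurable D1 -> measurable D2 -> measurable D ->
  (forall x t, D (cons_pair (x, t)) <-> D1 x /\ D2 t) ->
  measurable_fun setT f -> (forall t, D t -> 0 <= f t)%E ->
  (\int[leb n.+1]_(t in D) f t =
   \int[mu]_(x in D1) \int[leb n]_(t in D2) f (cons_pair (x, t)))%E.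
Proof.
move=> mD1 mD2 mD DE mf f0.
have mc := @measurable_cons_pair _ Rm n.
rewrite (@eq_measure_integral _ _ _ _ (pushforward (mu \x leb n)%E (@cons_pair Rm n))); last first.
  by [].
rewrite (@ge0_integral_pushforward _ _ _ _ R _ mc (mu \x leb n)%E)//; first last.
- by move=> t /set_mem; exact: f0.
- exact: measurable_funTS.
have -> : @cons_pair Rm n @^-1` D = D1 `*` D2.
  by apply/seteqP; split => -[x t] /DE.
rewrite -(@ge0_integral_setX _ _ _ _ R mu (leb n) D1 D2 (fun x t => f (cons_pair (x, t))))//.
- apply: measurable_funTS.
  by rewrite (_ : (fun _ => _) = f \o @cons_pair Rm n); [exact: measurableT_comp|apply/funext => -[]].
- by move=> x t xD tD; apply: f0; apply/DE.
Qed.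

Lemma tnth_cons0 n (x : R) (t : n.-tuple R) : tnth (cons_pair (x, t)) ord0 = x.
Proof. by []. Qed.

Lemma tnth_consS n (x : R) (t : n.-tuple R) i :
  tnth (cons_pair (x, t)) (lift ord0 i) = tnth t i.
Proof. by rewrite /cons_pair tnthS. Qed.

Lemma measurable_forall_tnth n (P : set Rm) : measurable P ->
  measurable [set t : n.-tuple Rm | forall i, P (tnth t i)].
Proof.
move=> mP; rewrite (_ : mkset _ = \bigcap_(i in [set: 'I_n])
     ((@tnth _ Rm ^~ i) @^-1` P)); last first.
  by apply/seteqP; split => t /= H i; [move=> _; exact: H|exact: (H i Logic.I)].
apply: fin_bigcap_measurable => // i _.
rewrite -[X in measurable X]setTI; exact: measurable_tnth.
Qed.

Lemma forall_tnth_cons n (P : set R) (x : R) (t : n.-tuple R) :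
  (forall i, P (tnth (cons_pair (x, t)) i)) <-> P x /\ forall i, P (tnth t i).
Proof.
split=> [H|[Px Pt] i]; last first.
  by case: (unliftP ord0 i) => [j ->|->]; rewrite ?tnth_consS.
by split => [|i]; [exact: (H ord0)|rewrite -(tnth_consS x t); exact: H].
Qed.

Lemma measurable_orthant n : measurable (orthant R n).
Proof.
rewrite (_ : orthant R n = [set t | forall i, `[0, +oo[%classic (tnth t i)]); last first.
  by apply/seteqP; split => t H i; have := H i; rewrite /= in_itv/= andbT.
exact: measurable_forall_tnth.
Qed.

Lemma measurable_angle_box n : measurable (angle_box (R := R) (d := n)).
Proof.
rewrite (_ : @angle_box R n = [set t : n.-1.-tuple R | forall i, `[0, pi / 2]%classic (tnth t i)]); last first.
  by apply/seteqP; split => t H i; have := H i; rewrite /= in_itv.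
exact: measurable_forall_tnth.
Qed.

Lemma orthant_cons n x (t : n.-tuple R) :
  orthant R n.+1 (cons_pair (x, t)) <-> `[0, +oo[%classic x /\ orthant R n t.
Proof.
rewrite /= in_itv/= andbT; exact: (forall_tnth_cons [set x | 0 <= x]).
Qed.

Lemma angle_box_cons n x (t : n.-tuple R) :
  angle_box (d := n.+2) (cons_pair (x, t)) <->
  `[0, pi / 2]%classic x /\ angle_box (d := n.+1) t.
Proof.
rewrite /= in_itv/=; exact: (forall_tnth_cons [set x | 0 <= x <= pi / 2]).
Qed.

Definition sphere_point n (w : n.-tuple Rm) : n.+1.-tuple Rm :=
  [tuple @sphere_coord R n.+1 k w | k < n.+1].

Definition tuple_scale n (c : R) (t : n.-tuple Rm) : n.-tuple Rm :=
  [tuple c * tnth t k | k < n].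

(** This recursion, with the one for the Jacobian, drives the induction on the dimension in polar
    coordinates. *)
Lemma sphere_point_cons n (a : R) (w : n.-tuple Rm) :
  sphere_point (cons_pair (a, w)) =
  cons_pair (cos a, tuple_scale (sin a) (sphere_point w)).
Proof.
apply: eq_from_tnth => k; rewrite tnth_mktuple /sphere_coord.
case: (unliftP ord0 k) => [j ->|->]; last first.
  by rewrite tnth_cons0 big_pred0// mul1r (big_pred1 ord0).
rewrite tnth_consS !tnth_mktuple /sphere_coord mulrA; congr (_ * _).
  rewrite big_mkcond [in RHS]big_mkcond big_ord_recl tnth_cons0/=; congr (_ * _).
  by apply: eq_bigr => i _; rewrite tnth_consS.
rewrite big_mkcond [in RHS]big_mkcond big_ord_recl/= mul1r.
by apply: eq_bigr => i _; rewrite tnth_consS.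
Qed.

Lemma sphere_jacobian_cons n (a : R) (w : n.-tuple Rm) :
  @sphere_jacobian R n.+2 (cons_pair (a, w)) =
  sin a ^+ n * @sphere_jacobian R n.+1 w.
Proof.
rewrite /sphere_jacobian/= big_ord_recl tnth_cons0/= subn0; congr (_ * _).
apply: eq_bigr => i _; rewrite tnth_consS/=; congr (_ ^+ _).
by rewrite /bump/= add1n subnS -subn1 subnAC subn1.
Qed.

End tuple_integral.

Section polar_coordinates.
Context (R : realType).
Local Notation mu := (@lebesgue_measure R).
Local Notation leb := (lebesgue_tuple R).
Local Notation Rm := (measurableTypeR R).

Lemma measurable_cons_fun d (T : measurableType d) n (u : T -> Rm) (v : T -> n.-tuple Rm) :
  measurable_fun setT u -> measurable_fun setT v ->
  measurable_fun setT (fun x => cons_pair (u x, v x)).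
Proof. by move=> mu1 mv; exact: measurable_cons. Qed.

Lemma measurable_tuple_scale d (T : measurableType d) n (u : T -> Rm) (v : T -> n.-tuple Rm) :
  measurable_fun setT u -> measurable_fun setT v ->
  measurable_fun setT (fun x => tuple_scale (u x) (v x)).
Proof.
move=> mu1 mv; apply/measurable_fun_tnthP => i.
rewrite (_ : _ \o _ = fun x => u x * tnth (v x) i); last first.
  by apply/funext => x /=; rewrite tnth_mktuple.
apply: measurable_funM => //.
by apply: (@measurableT_comp _ _ _ _ _ _ (fun t => tnth t i)) => //; exact: measurable_tnth.
Qed.

Lemma measurable_sphere_point n : measurable_fun setT (@sphere_point R n).
Proof.
apply/measurable_fun_tnthP => i.
rewrite (_ : _ \o _ = @sphere_coord R n.+1 i); last first.
  by apply/funext => x /=; rewrite tnth_mktuple.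
rewrite (_ : @sphere_coord R n.+1 i = fun w =>
  (\prod_(j < n) if (j < i)%N then sin (tnth w j) else 1) *
  (\prod_(j < n) if (j == i :> nat) then cos (tnth w j) else 1)); last first.
  by apply/funext => w; rewrite /sphere_coord -!big_mkcond.
apply: measurable_funM; apply: measurable_prod => j _.
  case: (j < i)%N => //.
  by apply: (@measurableT_comp _ _ _ _ _ _ (@sin R)); [exact: measurable_sin|exact: measurable_tnth].
case: (j == i :> nat) => //.
by apply: (@measurableT_comp _ _ _ _ _ _ (@cos R)); [exact: measurable_cos|exact: measurable_tnth].
Qed.

Lemma measurable_sphere_jacobian n : measurable_fun setT (@sphere_jacobian R n).
Proof.
rewrite (_ : @sphere_jacobian R n =
  fun w => \prod_(i < n.-1) sin (tnth w i) ^+ (n.-2 - i))//.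
apply: measurable_prod => j _; apply: measurable_funX.
by apply: (@measurableT_comp _ _ _ _ _ _ (@sin R)); [exact: measurable_sin|exact: measurable_tnth].
Qed.

Lemma sin_ge0_box n (w : n.-1.-tuple R) i : angle_box w -> 0 <= sin (tnth w i).
Proof.
move=> /(_ i)/andP[w0 w1]; rewrite sin_ge0_pi// w0 (le_trans w1)//.
by rewrite ler_pdivrMr// ler_peMr// ?pi_ge0// ler1n.
Qed.

Lemma cos_ge0_box n (w : n.-1.-tuple R) i : angle_box w -> 0 <= cos (tnth w i).
Proof.
move=> /(_ i)/andP[w0 w1]; rewrite cos_ge0_pihalf// w1 andbT (le_trans _ w0)//.
by rewrite oppr_le0 divr_ge0// pi_ge0.
Qed.

Lemma sphere_jacobian_ge0 n (w : n.-1.-tuple R) : angle_box w -> 0 <= sphere_jacobian w.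
Proof. by move=> wB; apply: prodr_ge0 => i _; rewrite exprn_ge0// sin_ge0_box. Qed.

Lemma sphere_coord_ge0 n k (w : n.-1.-tuple R) : angle_box w -> 0 <= sphere_coord k w.
Proof.
by move=> wB; apply: mulr_ge0; apply: prodr_ge0 => i _; rewrite ?sin_ge0_box ?cos_ge0_box.
Qed.

Lemma measurable_fun_tuple0 (D : set (0.-tuple Rm)) (g : 0.-tuple Rm -> \bar R) :
  measurable_fun D g.
Proof.
move=> mD Y mY; set A := _ `&` _.
have [A0|A0] := pselect (A [tuple]).
  rewrite (_ : A = setT) //; apply/seteqP; split => // t _.
  by rewrite (tuple0 t).
rewrite (_ : A = set0) //; apply/seteqP; split => // t.
by rewrite (tuple0 t).
Qed.

Lemma measurable_fun_param_integral d1 d2 (T1 : measurableType d1) (T2 : measurableType d2)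
    (m2 : {sigma_finite_measure set T2 -> \bar R}) (D2 : set T2) (f : T1 -> T2 -> \bar R) :
  measurable D2 -> measurable_fun setT (fun z => f z.1 z.2) ->
  (forall x y, D2 y -> 0 <= f x y)%E ->
  measurable_fun setT (fun x => \int[m2]_(y in D2) f x y)%E.
Proof.
move=> mD2 mf f0; apply: measurable_fun_tonelli_in => //; first exact: measurable_funTS.
by move=> x y _; exact: f0.
Qed.

(** Induction on the dimension. The last [n + 1] coordinates are put in polar form with a radius
    [rho'], and then the pair formed by the first coordinate and [rho'] is put in plane polar form
    as [(rho cos a, rho sin a)]. The factors [rho'^n] and [rho] give [rho^(n+1) sin^n a], whose sine
    part is the new factor of the Jacobian. *)
Lemma ge0_polar_coordinates n (f : n.+1.-tuple Rm -> \bar R) :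
  measurable_fun setT f -> (forall t, 0 <= f t)%E ->
  (\int[leb n.+1]_(t in orthant R n.+1) f t =
   \int[leb n]_(w in @angle_box R n.+1) ((@sphere_jacobian R n.+1 w)%:E *
     \int[mu]_(rho in `]0%R, +oo[) (f (tuple_scale rho (sphere_point w)) * (rho ^+ n)%:E)))%E.
Proof.
elim: n f => [|n IHn] f mf f0.
  rewrite (@ge0_integral_cons R 0 `[0, +oo[%classic (orthant R 0)); [ |by []| | | | |]; first last.
  - by move=> t _.
  - by [].
  - by move=> x t; exact: orthant_cons.
  - exact: measurable_orthant.
  - exact: measurable_orthant.
  have mfc x : measurable_fun setT (fun t : 0.-tuple Rm => f (cons_pair (x, t))).
    by apply: (@measurableT_comp _ _ _ _ _ _ f _ (fun t => cons_pair (x, t))) => //; exact: measurable_cons_fun.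
  have mfr : measurable_fun setT (fun x : Rm => f (cons_pair (x, [tuple]))).
    by apply: (@measurableT_comp _ _ _ _ _ _ f _ (fun x => cons_pair (x, [tuple]))) => //; exact: measurable_cons_fun.
  have oT : orthant R 0 [tuple] by case.
  have bT : @angle_box R 1 [tuple] by case.
  rewrite [RHS](integral_dirac _ (@measurable_angle_box R 1) (@measurable_fun_tuple0 _ _)).
  rewrite diracE mem_set// mul1e /sphere_jacobian big_ord0 mul1e.
  rewrite [LHS](_ : _ = \int[mu]_(x in `[0%R, +oo[) f (cons_pair (x, [tuple])))%E; last first.
    apply: eq_integral => x _.
    by rewrite (integral_dirac _ (@measurable_orthant R 0) (@measurable_fun_tuple0 _ _)) diracE mem_set// mul1e.
  rewrite -integral_itv_obnd_cbnd; last exact: measurable_funTS.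
  apply: eq_integral => rho _.
  rewrite expr0 mule1; congr f; apply: eq_from_tnth => i.
  by rewrite ord1 tnth_cons0 !tnth_mktuple /sphere_coord !big_ord0 !mulr1.
have mB : measurable (@angle_box R n.+1) by exact: measurable_angle_box.
have mO : measurable (orthant R n.+1) by exact: measurable_orthant.
have mI : measurable (`]0, +oo[%classic : set Rm) by [].
have mQ : measurable (`]0, pi / 2[%classic : set Rm) by [].
rewrite (@ge0_integral_cons R n.+1 `[0, +oo[%classic (orthant R n.+1)); [ |by []|by [] | | | |]; first last.
- by move=> t _.
- by [].
- by move=> x t; exact: orthant_cons.
- exact: measurable_orthant.
pose fc x t := f (cons_pair (x, t)).
have mfc (d : measure_display) (T : measurableType d) (u : T -> Rm) (v : T -> n.+1.-tuple Rm) :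
    measurable_fun setT u -> measurable_fun setT v -> measurable_fun setT (fun x => fc (u x) (v x)).
  by move=> mu1 mv; apply: (@measurableT_comp _ _ _ _ _ _ f _ (fun x => cons_pair (u x, v x))) => //; exact: measurable_cons_fun.
have fc0 x t : (0 <= fc x t)%E by exact: f0.
rewrite -integral_itv_obnd_cbnd; last first.
  apply: measurable_funTS.
  by apply: (@measurable_fun_param_integral _ _ Rm _ (leb n.+1) (orthant R n.+1) fc) => //; exact: mfc.
pose h x w rho := (fc x (tuple_scale rho (@sphere_point R n w)) * (`|rho| ^+ n)%:E)%E.
have h0 x w rho : (0 <= h x w rho)%E by rewrite mule_ge0// lee_fin exprn_ge0.
have mh (d : measure_display) (T : measurableType d) (u v : T -> Rm) (w : T -> n.-tuple Rm) :
    measurable_fun setT u -> measurable_fun setT w -> measurable_fun setT v ->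
    measurable_fun setT (fun x => h (u x) (w x) (v x)).
  move=> mu1 mw mv; apply: emeasurable_funM.
    apply: mfc => //; apply: measurable_tuple_scale => //.
    by apply: (@measurableT_comp _ _ _ _ _ _ (@sphere_point R n)) => //; exact: measurable_sphere_point.
  apply/measurable_EFinP; apply: measurable_funX; exact: measurableT_comp.
pose J := @sphere_jacobian R n.+1.
have mJ : measurable_fun setT (EFin \o J).
  by apply/measurable_EFinP; exact: measurable_sphere_jacobian.
have J0 w : @angle_box R n.+1 w -> (0 <= (J w)%:E)%E.
  by move=> wB; rewrite lee_fin; exact: (@sphere_jacobian_ge0 n.+1).
pose H x w := (\int[mu]_(rho in `]0%R, +oo[) h x w rho)%E.
have H0 x w : (0 <= H x w)%E by exact: integral_ge0.
have mH (d : measure_display) (T : measurableType d) (u : T -> Rm) (w : T -> n.-tuple Rm) :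
    measurable_fun setT u -> measurable_fun setT w ->
    measurable_fun setT (fun x => H (u x) (w x)).
  move=> mu1 mw.
  apply: (@measurable_fun_param_integral _ _ T Rm mu `]0, +oo[%classic (fun x rho => h (u x) (w x) rho)) => //.
  by apply: mh => //; exact: measurableT_comp.
transitivity (\int[mu]_(x in `]0%R, +oo[) \int[leb n]_(w in @angle_box R n.+1)
   ((J w)%:E * H x w))%E.
  apply: eq_integral => x xI; rewrite (IHn (fc x)); last 2 first.
  - exact: (mfc _ _ (fun=> x) id).
  - exact: fc0.
  apply: eq_integral => w wB; congr (_ * _)%E.
  apply: eq_integral => rho; rewrite inE/= in_itv/= andbT => rho0.
  by rewrite /h gtr0_norm.
transitivity (\int[leb n]_(w in @angle_box R n.+1) \int[mu]_(x in `]0%R, +oo[)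
   ((J w)%:E * H x w))%E.
  apply: (@ge0_tonelli_in _ _ _ _ R mu (leb n) `]0%R, +oo[%classic (@angle_box R n.+1)
    (fun x w => (J w)%:E * H x w)%E) => //.
  - apply: measurable_funTS; apply: emeasurable_funM; last exact: (mH _ _ fst snd).
    exact: (@measurableT_comp _ _ _ _ _ _ (EFin \o J) setT snd).
  - by move=> x w _ wB; rewrite mule_ge0// J0.
pose k a w rho := (h (rho * cos a)%R w (rho * sin a)%R * `|rho|%:E)%E.
have k0 a w rho : (0 <= k a w rho)%E by rewrite mule_ge0// lee_fin.
have mk (d : measure_display) (T : measurableType d) (u v : T -> Rm) (w : T -> n.-tuple Rm) :
    measurable_fun setT u -> measurable_fun setT w -> measurable_fun setT v ->
    measurable_fun setT (fun x => k (u x) (w x) (v x)).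
  move=> mu1 mw mv; apply: emeasurable_funM.
    apply: mh => //; apply: measurable_funM => //; apply: (@measurableT_comp _ _ _ _ _ _ _ _ u) => //.
      exact: measurable_cos.
    exact: measurable_sin.
  apply/measurable_EFinP; exact: measurableT_comp.
pose K a w := (\int[mu]_(rho in `]0%R, +oo[) k a w rho)%E.
have K0 x w : (0 <= K x w)%E by exact: integral_ge0.
have mK (d : measure_display) (T : measurableType d) (u : T -> Rm) (w : T -> n.-tuple Rm) :
    measurable_fun setT u -> measurable_fun setT w ->
    measurable_fun setT (fun x => K (u x) (w x)).
  move=> mu1 mw.
  apply: (@measurable_fun_param_integral _ _ T Rm mu `]0, +oo[%classic (fun x rho => k (u x) (w x) rho)) => //.
  by apply: mk => //; exact: measurableT_comp.
transitivity (\int[leb n]_(w in @angle_box R n.+1) \int[mu]_(a in `]0%R, (pi / 2)%R[)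
   ((J w)%:E * K a w))%E.
  apply: eq_integral => w /set_mem wB.
  have mHw : measurable_fun (`]0%R, +oo[%classic : set Rm) (H^~ w) by apply: measurable_funTS; exact: (mH _ _ id (fun=> w)).
  have mKw : measurable_fun (`]0%R, (pi / 2)%R[%classic : set Rm) (K^~ w) by apply: measurable_funTS; exact: (mK _ _ id (fun=> w)).
  rewrite (@ge0_integralZl _ _ R mu _ mI _ mHw (J w)%:E (fun x _ => H0 x w) (J0 w wB)).
  rewrite (@ge0_integralZl _ _ R mu _ mQ _ mKw (J w)%:E (fun a _ => K0 a w) (J0 w wB)).
  have mhw : measurable_fun setT (fun z : Rm * Rm => h z.1 w z.2) by apply: (mh _ _ fst snd (fun=> w)).
  apply: (f_equal (fun z => (J w)%:E * z)%E).
  (* Here [x] is the first coordinate and [rho] the radius of the remaining ones. *)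
  rewrite [LHS](@ge0_polar_plane R (fun x rho => h x w rho) mhw (fun x rho => h0 x w rho)).
  apply: eq_integral => a _; apply: eq_integral => rho.
  by rewrite inE/= in_itv/= andbT => rho0; rewrite /k (gtr0_norm rho0).
transitivity (\int[mu]_(a in `]0%R, (pi / 2)%R[) \int[leb n]_(w in @angle_box R n.+1)
   ((J w)%:E * K a w))%E.
  apply: (@ge0_tonelli_in _ _ _ _ R (leb n) mu (@angle_box R n.+1) `]0%R, (pi / 2)%R[%classic
    (fun w a => (J w)%:E * K a w)%E) => //.
  - apply: measurable_funTS; apply: emeasurable_funM; last exact: (mK _ _ snd fst).
    exact: (@measurableT_comp _ _ _ _ _ _ (EFin \o J) setT fst).
  - by move=> w a wB _; rewrite mule_ge0// J0.
pose G t := ((@sphere_jacobian R n.+2 t)%:E * \int[mu]_(rho in `]0%R, +oo[)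
  (f (tuple_scale rho (@sphere_point R n.+1 t)) * (rho ^+ n.+1)%:E))%E.
have G0 t : @angle_box R n.+2 t -> (0 <= G t)%E.
  move=> tB; apply: mule_ge0; first by rewrite lee_fin; exact: (@sphere_jacobian_ge0 n.+2).
  apply: integral_ge0 => rho; rewrite /= in_itv/= andbT => rho0.
  by rewrite mule_ge0// lee_fin exprn_ge0// ltW.
have mG : measurable_fun setT G.
  apply: emeasurable_funM.
    by apply/measurable_EFinP; exact: (@measurable_sphere_jacobian n.+2).
  apply: (@measurable_fun_param_integral _ _ _ Rm mu `]0, +oo[%classic
    (fun t rho => f (tuple_scale rho (@sphere_point R n.+1 t)) * (rho ^+ n.+1)%:E)%E) => //.
    apply: emeasurable_funM; last by apply/measurable_EFinP; exact: measurable_funX.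
    apply: (@measurableT_comp _ _ _ _ _ _ f _ (fun z => tuple_scale z.2 (@sphere_point R n.+1 z.1))) => //.
    apply: measurable_tuple_scale => //.
    apply: (@measurableT_comp _ _ _ _ _ _ (@sphere_point R n.+1) _ fst) => //; exact: measurable_sphere_point.
  move=> x rho; rewrite /= in_itv/= andbT => rho0.
  by rewrite mule_ge0// lee_fin exprn_ge0// ltW.
rewrite [RHS](@ge0_integral_cons R n `[0, pi / 2]%classic (@angle_box R n.+1) (@angle_box R n.+2) G); first last.
- exact: G0.
- exact: mG.
- by move=> x t; exact: angle_box_cons.
- exact: (@measurable_angle_box R n.+2).
- exact: mB.
- by [].
have mGF (D : set Rm) : measurable D -> D `<=` `[0, pi / 2]%classic ->
    measurable_fun D (fun a => \int[leb n]_(w in @angle_box R n.+1) G (cons_pair (a, w)))%E.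
  move=> mD DI; apply: (@measurable_fun_tonelli_in _ _ Rm _ R (leb n) D (@angle_box R n.+1)
    (fun a w => G (cons_pair (a, w)))) => //.
    apply: measurable_funTS.
    by apply: (@measurableT_comp _ _ _ _ _ _ G _ (fun z => cons_pair (z.1, z.2))) => //; exact: measurable_cons_fun.
  by move=> a w aD wB; apply: G0; apply/angle_box_cons; split => //; exact: DI.
rewrite -integral_itv_obnd_cbnd; last by apply: mGF => // x /subset_itv_oc_cc.
rewrite -integral_itv_bndo_bndc; last by apply: mGF => // x /subset_itv_oo_cc.
apply: eq_integral => a; rewrite inE/= => aI; apply: eq_integral => w _.
rewrite /G sphere_jacobian_cons.
have sa : 0 < sin a.
  by move: aI; rewrite in_itv/=; exact: sin_gt0_pihalf.
rewrite (mulrC (sin a ^+ n)) EFinM -muleA; apply: (f_equal (fun z => (J w)%:E * z)%E).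
rewrite -(@ge0_integralZl _ _ R mu _ mI); last 3 first.
- apply: measurable_funTS; apply: emeasurable_funM.
    apply: (@measurableT_comp _ _ _ _ _ _ f _ (fun rho => tuple_scale rho (sphere_point (cons_pair (a, w))))) => //.
    exact: measurable_tuple_scale.
  by apply/measurable_EFinP; exact: measurable_funX.
- by move=> rho /=; rewrite in_itv/= andbT => rho0; rewrite mule_ge0// lee_fin exprn_ge0// ltW.
- by rewrite lee_fin exprn_ge0// ltW.
apply: eq_integral => rho; rewrite inE/= in_itv/= andbT => rho0.
rewrite /k /h /fc sphere_point_cons muleCA -muleA -!EFinM; congr (f _ * _%:E)%E.
  apply: eq_from_tnth => i; rewrite !tnth_mktuple.
  by case: (unliftP ord0 i) => [j ->|->]; rewrite ?tnth_consS ?tnth_cons0// !tnth_mktuple mulrA.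
by rewrite !gtr0_norm ?mulr_gt0// exprMn exprSr; ring.
Qed.

End polar_coordinates.

(** * Symmetry of the integral under exchange of coordinates *)

Section coordinate_swap.
Context (R : realType).
Local Notation mu := (@lebesgue_measure R).
Local Notation leb := (lebesgue_tuple R).
Local Notation Rm := (measurableTypeR R).

Definition tuple_perm n (s : {perm 'I_n}) (t : n.-tuple Rm) : n.-tuple Rm :=
  [tuple tnth t (s i) | i < n].

Lemma measurable_tuple_perm n (s : {perm 'I_n}) : measurable_fun setT (tuple_perm s).
Proof.
apply/measurable_fun_tnthP => i.
rewrite (_ : _ \o _ = fun t => tnth t (s i)); first exact: measurable_tnth.
by apply/funext => t /=; rewrite tnth_mktuple.
Qed.

Lemma ge0_integral_consT n (f : n.+1.-tuple Rm -> \bar R) :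
  measurable_fun setT f -> (forall t, 0 <= f t)%E ->
  (\int[leb n.+1]_t f t = \int[mu]_x \int[leb n]_t f (cons_pair (x, t)))%E.
Proof. by move=> mf f0; apply: ge0_integral_cons => // x t; split. Qed.

Lemma tuple_perm_lift n (i j : 'I_n) x (t : n.-tuple Rm) :
  tuple_perm (tperm (lift ord0 i) (lift ord0 j)) (cons_pair (x, t)) =
  cons_pair (x, tuple_perm (tperm i j) t).
Proof.
apply: eq_from_tnth => k; rewrite tnth_mktuple.
case: (unliftP ord0 k) => [l ->|->]; last by rewrite tpermD.
by rewrite -(inj_tperm _ _ _ (@lift_inj _ ord0)) !tnth_consS tnth_mktuple.
Qed.

Lemma tuple_perm01 n x y (t : n.-tuple Rm) :
  tuple_perm (tperm ord0 (lift ord0 ord0)) (cons_pair (x, cons_pair (y, t))) =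
  cons_pair (y, cons_pair (x, t)).
Proof.
apply: eq_from_tnth => k; rewrite tnth_mktuple.
case: (unliftP ord0 k) => [l ->|->]; last by rewrite tpermL tnth_consS.
case: (unliftP ord0 l) => [m ->|->]; last by rewrite tpermR !tnth_consS !tnth_cons0.
by rewrite tpermD ?tnth_consS.
Qed.

(** Only adjacent coordinates are exchanged, which suits the recursive definition of the measure: if
    both indices are positive, the first coordinate is split off and the induction applies;
    otherwise the first two coordinates are exchanged by Tonelli's theorem. *)
Lemma ge0_integral_tuple_swap n (i j : 'I_n) (f : n.-tuple Rm -> \bar R) :
  j = i.+1 :> nat -> measurable_fun setT f -> (forall t, 0 <= f t)%E ->
  (\int[leb n]_t f (tuple_perm (tperm i j) t) = \int[leb n]_t f t)%E.
Proof.
elim: n i j f => [[]//|n IHn] i j f ij mf f0.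
have mfp : measurable_fun setT (fun t => f (tuple_perm (tperm i j) t)).
  by apply: (@measurableT_comp _ _ _ _ _ _ f _ (tuple_perm (tperm i j))) => //; exact: measurable_tuple_perm.
rewrite [LHS](ge0_integral_consT mfp (fun t => f0 _)) [RHS](ge0_integral_consT mf f0).
case: (unliftP ord0 j) ij mfp => [j' ->|->//]; case: (unliftP ord0 i) => [i' ->|->] ij mfp.
  apply: eq_integral => x _.
  under eq_integral do rewrite tuple_perm_lift.
  apply: (IHn _ _ (fun t => f (cons_pair (x, t)))) => //; first by case: ij.
  by apply: (@measurableT_comp _ _ _ _ _ _ f _ (fun t => cons_pair (x, t))) => //; exact: measurable_cons_fun.
case: n j' IHn i j f mf f0 ij mfp => [[]//|n] j' _ _ _ f mf f0 [] j0 mfp.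
have j'E : j' = ord0 by exact/val_inj.
rewrite j'E in mfp *.
have mfx (x : Rm) : measurable_fun setT (fun t => f (cons_pair (x, t))).
  by apply: (@measurableT_comp _ _ _ _ _ _ f _ (fun t => cons_pair (x, t))) => //; exact: measurable_cons_fun.
under [RHS]eq_integral do rewrite (ge0_integral_consT (mfx _))//.
rewrite [RHS](@fubini_tonelli _ _ _ _ _ mu mu (fun z => \int[leb n]_t f (cons_pair (z.1, cons_pair (z.2, t)))))%E; last 2 first.
- apply: (@measurable_fun_param_integral _ _ _ _ _ (leb n) setT (fun z t => f (cons_pair (z.1, cons_pair (z.2, t))))) => //.
  apply: (@measurableT_comp _ _ _ _ _ _ f _ (fun z => cons_pair (z.1.1, cons_pair (z.1.2, z.2)))) => //.
  apply: measurable_cons_fun; first exact: measurableT_comp.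
  by apply: measurable_cons_fun => //; exact: measurableT_comp.
- by move=> z; apply: integral_ge0.
apply: eq_integral => x _.
pose sw := tuple_perm (tperm (ord0 : 'I_n.+2) (lift ord0 ord0)).
have mfs : measurable_fun setT (fun t => f (sw (cons_pair (x, t)))).
  by apply: (@measurableT_comp _ _ _ _ _ _ (f \o sw) _ (fun t => cons_pair (x, t))) => //; exact: measurable_cons_fun.
rewrite [LHS](ge0_integral_consT mfs (fun t => f0 _)).
by apply: eq_integral => y _; apply: eq_integral => t _; rewrite /sw tuple_perm01.
Qed.

(** Adjacent exchanges leave [Psi] and the orthant unchanged and move the distinguished coordinate
    one place at a time, so both sides equal the integral with coordinate number 0. *)
Lemma ge0_integral_orthant_coord n (i j : 'I_n) (phi : R -> R) (Psi : n.-tuple Rm -> \bar R) :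
  measurable_fun setT phi -> (forall x, 0 <= phi x) ->
  measurable_fun setT Psi -> (forall t, 0 <= Psi t)%E ->
  (forall s t, Psi (tuple_perm s t) = Psi t) ->
  (\int[leb n]_(t in orthant R n) ((phi (tnth t i))%:E * Psi t) =
   \int[leb n]_(t in orthant R n) ((phi (tnth t j))%:E * Psi t))%E.
Proof.
move=> mphi phi0 mPsi Psi0 PsiS.
pose f (i : 'I_n) t := ((phi (tnth t i))%:E * Psi t)%E.
have mf k : measurable_fun setT (f k \_ (orthant R n)).
  apply/(measurable_restrictT _ _).1; first exact: measurable_orthant.
  apply: measurable_funTS; apply: emeasurable_funM => //; apply/measurable_EFinP.
  by apply: (@measurableT_comp _ _ _ _ _ _ phi _ (fun t => tnth t k)) => //; exact: measurable_tnth.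
have f0 k t : (0 <= (f k \_ (orthant R n)) t)%E.
  by apply: erestrict_ge0 => {}t _; rewrite mule_ge0// lee_fin.
have step (k l : 'I_n) : l = k.+1 :> nat ->
    (\int[leb n]_(t in orthant R n) f k t = \int[leb n]_(t in orthant R n) f l t)%E.
  move=> kl; rewrite integral_mkcond -(ge0_integral_tuple_swap kl (mf k) (f0 k)) [RHS]integral_mkcond.
  apply: eq_integral => t _; rewrite !patchE.
  rewrite (_ : (tuple_perm (tperm k l) t \in orthant R n) = (t \in orthant R n)).
    by rewrite /f PsiS tnth_mktuple tpermL.
  apply/idP/idP => /set_mem tO; apply/mem_set => m; rewrite ?tnth_mktuple//.
  by have := tO (tperm k l m); rewrite tnth_mktuple tpermK.
suff H (k : 'I_n) : (\int[leb n]_(t in orthant R n) f k t =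
    \int[leb n]_(t in orthant R n) f (Ordinal (leq_ltn_trans (leq0n k) (ltn_ord k))) t)%E.
  by rewrite [LHS]H [RHS]H; apply: eq_integral => t _; congr (f _ _); exact/val_inj.
move: (Ordinal _) (erefl : 0%N = Ordinal (leq_ltn_trans (leq0n k) (ltn_ord k)) :> nat) => z z0.
case: k => k kn; elim: k kn => [|k IHk] kn.
  by apply: eq_integral => t _; congr (f _ _); exact/val_inj.
by rewrite -(step (Ordinal (ltnW kn)))//; exact: IHk.
Qed.

End coordinate_swap.

Section positive_integral.
Local Open Scope ereal_scope.
Context d (T : measurableType d) (R : realType).
Variable mu : {measure set T -> \bar R}.

Lemma integral_gt0 (D : set T) (f : T -> \bar R) : measurable D -> 0 < mu D ->
  measurable_fun D f -> (forall x, D x -> 0 < f x) -> 0 < \int[mu]_(x in D) f x.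
Proof.
move=> mD D0 mf f0; rewrite lt_neqAle integral_ge0 ?andbT; last by move=> x /f0/ltW.
apply/eqP => /esym I0.
have : \int[mu]_(x in D) `|f x| = 0.
  by rewrite -[RHS]I0; apply: eq_integral => x /set_mem /f0/ltW/gee0_abs.
move/(ae_eq_integral_abs mu mD mf) => [N [mN N0 DN]].
suff : mu D <= mu N by rewrite N0 leNgt D0.
apply: le_measure; rewrite ?inE// => x Dx; apply: DN => /= /(_ Dx).
by move=> fx0; have := f0 _ Dx; rewrite fx0 ltxx.
Qed.

End positive_integral.

(** * The beta function *)

Section beta.
Context (R : realType).
Local Notation mu := (@lebesgue_measure R).
Implicit Types a b u : R.

Lemma image_powR_itv a u : 0 < a -> 0 < u ->
  ((@powR R)^~ a) @` `]0, u[ = `]0, u `^ a[%classic.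
Proof.
move=> a0 u0; apply/seteqP; split => [_ [x /= xI <-]|y /=].
  move: xI; rewrite !in_itv/= => /andP[x0 xu]; rewrite powR_gt0//=.
  by rewrite gt0_ltr_powR// nnegrE ltW.
rewrite in_itv/= => /andP[y0 yu]; exists (y `^ a^-1) => /=; last first.
  by rewrite -powRrM mulVf ?gt_eqF// powRr1// ltW.
rewrite in_itv/= powR_gt0//= -[ltRHS](powRr1 (ltW u0)) -(mulfV (lt0r_neq0 a0)) powRrM.
by rewrite gt0_ltr_powR ?invr_gt0// nnegrE ?powR_ge0// ltW.
Qed.

Lemma integral_powR a u : 0 < a -> 0 < u ->
  (\int[mu]_(x in `]0%R, u[) (a * x `^ (a - 1))%:E = (u `^ a)%:E)%E.
Proof.
move=> a0 u0.
have dF x : x \in `]0, u[ -> is_derive x 1 ((@powR R)^~ a) (a * x `^ (a - 1)).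
  by rewrite in_itv/= => /andP[x0 _]; exact: is_derive1_powR.
transitivity (\int[mu]_(x in `]0%R, u[) (cst 1%E (x `^ a)%R * (a * x `^ (a - 1))%:E))%E.
  by apply: eq_integral => x _; rewrite mul1e.
rewrite -(ge0_change_of_variables dF)//.
- by rewrite image_powR_itv// integral_cst// mul1e /= lebesgue_measure_itv/= lte_fin powR_gt0// oppr0 adde0.
- move=> x; rewrite in_itv/= => /andP[x0 _].
  have cp : {for x, continuous (fun y : R => y `^ (a - 1))}.
    apply/differentiable_continuous; rewrite -derivable1_diffP.
    by have [] := is_derive1_powR (a - 1) x0.
  by apply: cvgM; [exact: cvg_cst|exact: cp].
- by move=> x; rewrite in_itv/= => /andP[x0 _]; rewrite mulr_gt0// powR_gt0.
Qed.

Let beta_int a b := (\int[mu]_(s in `]0%R, 1%R[) (s `^ (a - 1) * (1 - s) `^ (b - 1))%:E)%E.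

Let mpow c : measurable_fun setT (fun x : R => x `^ c).
Proof. exact: measurable_powR. Qed.

Let mpowC c : measurable_fun setT (fun x : R => (1 - x) `^ c).
Proof.
apply: (@measurableT_comp _ _ _ _ _ _ (fun x : R => x `^ c) _ (fun x : R => 1 - x)) => //.
exact: measurable_funB.
Qed.

Let mpowM c e : measurable_fun setT (fun x : R => (x `^ c * (1 - x) `^ e)%:E).
Proof. by apply/measurable_EFinP; exact: measurable_funM. Qed.

Let beta_int_ge0 a b : (0 <= beta_int a b)%E.
Proof. by apply: integral_ge0 => x _; rewrite lee_fin mulr_ge0 ?powR_ge0. Qed.

Let beta_int_sym a b : beta_int a b = beta_int b a.
Proof.
rewrite /beta_int (@ge0_integral_reflect R (fun s => (s `^ (a - 1) * (1 - s) `^ (b - 1))%:E)).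
- by apply: eq_integral => s _; rewrite subKr mulrC.
- exact: mpowM.
- by move=> x; rewrite lee_fin mulr_ge0 ?powR_ge0.
Qed.

(* Both sides equal the integral of [a x^(a-1) b y^(b-1)] over the triangle [x + y < 1]. *)
Let beta_int_shift a b : 0 < a -> 0 < b ->
  (a%:E * beta_int a (b + 1) = b%:E * beta_int (a + 1) b)%E.
Proof.
move=> a0 b0.
pose tri c e x y : \bar R := ((c * x `^ (c - 1)) * (e * y `^ (e - 1)) * (x + y < 1)%R%:R)%:E.
have triE c e : 0 < c -> 0 < e -> (c%:E * beta_int c (e + 1) =
    \int[mu]_(x in `]0%R, 1%R[) \int[mu]_(y in `]0%R, 1%R[) tri c e x y)%E.
  move=> c0 e0; rewrite /beta_int -ge0_integralZl//; last 3 first.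
  - by apply: measurable_funTS; exact: mpowM.
  - by move=> x _; rewrite lee_fin mulr_ge0 ?powR_ge0.
  - by rewrite lee_fin ltW.
  apply: eq_integral => x; rewrite inE/= in_itv/= => /andP[x0 x1].
  rewrite addrK -EFinM mulrA EFinM -integral_powR ?subr_gt0// -ge0_integralZl//; last 3 first.
  - by apply: measurable_funTS; apply/measurable_EFinP; exact: measurable_funM.
  - by move=> y _; rewrite lee_fin mulr_ge0 ?powR_ge0// ltW.
  - by rewrite lee_fin mulr_ge0 ?powR_ge0// ltW.
  rewrite integral_mkcond [RHS]integral_mkcond; apply: eq_integral => y _; rewrite !patchE.
  rewrite /tri !mem_setE !in_itv/= ltrBrDl.
  case: ltP => y0//=; case: ltP => xy; rewrite ?mulr1 ?mulr0.
    by rewrite (lt_trans _ xy) ?ltrDr.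
  by case: ifP.
have triC x y : tri a b x y = tri b a y x.
  by rewrite /tri (addrC x) (mulrC (a * _)).
rewrite (triE a b a0 b0) (beta_int_sym (a + 1) b) (triE b a b0 a0).
rewrite (@ge0_tonelli_in _ _ _ _ R mu mu `]0%R, 1%R[%classic `]0%R, 1%R[%classic (tri a b)); first last.
- by move=> x y _ _; rewrite lee_fin !mulr_ge0 ?powR_ge0// ltW.
- apply: measurable_funTS; apply/measurable_EFinP; apply: measurable_funM.
    by apply: measurable_funM; apply: measurable_funM => //; apply: (@measurableT_comp _ _ _ _ _ _ (fun x : R => x `^ _)) => //; exact: measurable_powR.
  rewrite (_ : (fun _ => _) = (\1_[set z : R * R | z.1 + z.2 < 1] : _ -> R)); last first.
    apply/funext => z; rewrite indicE; congr (nat_of_bool _)%:R.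
    by apply/idP/idP => [H|/set_mem//]; rewrite mem_set.
  apply: measurable_indic.
  rewrite (_ : mkset _ = setT `&` (fun z : R * R => z.1 + z.2) @^-1` `]-oo, 1[%classic); last first.
    by apply/seteqP; split => z /=; rewrite in_itv/=; [split|case].
  by apply: measurable_funD.
- by [].
- by [].
by apply: eq_integral => x _; apply: eq_integral => y _; exact: triC.
Qed.

Let beta_int_split a b : 0 < a -> 0 < b ->
  (beta_int a b = beta_int (a + 1) b + beta_int a (b + 1))%E.
Proof.
move=> a0 b0; rewrite /beta_int -ge0_integralD//; last 4 first.
- by move=> x _; rewrite lee_fin mulr_ge0 ?powR_ge0.
- by apply: measurable_funTS; exact: mpowM.
- by move=> x _; rewrite lee_fin mulr_ge0 ?powR_ge0.
- by apply: measurable_funTS; exact: mpowM.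
apply: eq_integral => x; rewrite inE/= in_itv/= => /andP[x0 x1].
rewrite -EFinD; congr (_%:E); rewrite !addrK.
rewrite -(mulr_powRB1 (ltW x0) a0) -(@mulr_powRB1 _ (1 - x) b) ?subr_ge0 ?ltW//; ring.
Qed.

(** If the second parameter exceeds 1, the factor in [1 - s] is at most 1 and what is left is an
    integrable power of [s]. The splitting and the symmetry reduce the general case to this one. *)
Let beta_int_fin a b : 0 < a -> 0 < b -> beta_int a b \is a fin_num.
Proof.
move=> a0 b0.
have F c e : 0 < c -> 0 < e -> beta_int c (e + 1) \is a fin_num.
  move=> c0 e0; rewrite ge0_fin_numE//.
  apply: (@le_lt_trans _ _ (c^-1%:E * (1 `^ c)%:E)%E); last by rewrite -EFinM ltry.
  rewrite -(integral_powR c0)// -ge0_integralZl//; last 3 first.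
  - by apply: measurable_funTS; apply/measurable_EFinP; exact: measurable_funM.
  - by move=> y _; rewrite lee_fin mulr_ge0 ?powR_ge0// ltW.
  - by rewrite lee_fin invr_ge0 ltW.
  apply: ge0_le_integral => //.
  - by move=> x _; rewrite lee_fin mulr_ge0 ?powR_ge0.
  - by apply: measurable_funTS; exact: mpowM.
  - by apply: measurable_funTS; apply/measurable_EFinP; do 2 apply: measurable_funM => //.
  - move=> x /=; rewrite in_itv/= => /andP[x0 x1]; rewrite -EFinM lee_fin mulKf ?gt_eqF// addrK.
    rewrite ger_pMr ?powR_gt0// -[leRHS](powRr0 (1 - x)).
    by apply: ger_powR; [rewrite subr_gt0 x1 gerBl ltW|exact: ltW].
by rewrite (beta_int_split a0 b0) fin_numD (F a b a0 b0) andbT (beta_int_sym (a + 1) b) (F b a b0 a0).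
Qed.

Lemma EFin_euler_beta a b : 0 < a -> 0 < b ->
  ((euler_beta a b)%:E =
   \int[mu]_(s in `]0%R, 1%R[) (s `^ (a - 1) * (1 - s) `^ (b - 1))%:E)%E.
Proof.
move=> a0 b0; rewrite /euler_beta /Rintegral.
rewrite -integral_itv_obnd_cbnd; last by apply: measurable_funTS; exact: mpowM.
rewrite -integral_itv_bndo_bndc; last by apply: measurable_funTS; exact: mpowM.
by rewrite fineK//; exact: beta_int_fin.
Qed.

Lemma euler_beta_sym a b : 0 < a -> 0 < b -> euler_beta a b = euler_beta b a.
Proof. by move=> a0 b0; apply: EFin_inj; rewrite (EFin_euler_beta a0 b0) (EFin_euler_beta b0 a0); exact: (beta_int_sym a b). Qed.

Lemma euler_beta_gt0 a b : 0 < a -> 0 < b -> 0 < euler_beta a b.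
Proof.
move=> a0 b0; rewrite -lte_fin EFin_euler_beta//; apply: integral_gt0 => //.
- by rewrite /= lebesgue_measure_itv/= lte_fin ltr01 oppr0 adde0 lte_fin.
- by apply: measurable_funTS; exact: mpowM.
- move=> x /=; rewrite in_itv/= => /andP[x0 x1].
  by rewrite lte_fin mulr_gt0// powR_gt0// subr_gt0.
Qed.

(** The shift and the splitting are two linear equations for the two beta values with one parameter
    raised by 1. Finiteness allows them to be solved among reals. *)
Lemma euler_betaSl a b : 0 < a -> 0 < b ->
  euler_beta (a + 1) b = a / (a + b) * euler_beta a b.
Proof.
move=> a0 b0; have a1 : 0 < a + 1 by rewrite addr_gt0.
have b1 : 0 < b + 1 by rewrite addr_gt0.
have := beta_int_split a0 b0; have := beta_int_shift a0 b0.
rewrite /beta_int -(EFin_euler_beta a0 b0) -(EFin_euler_beta a0 b1) -(EFin_euler_beta a1 b0).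
move: (euler_beta a b) (euler_beta (a + 1) b) (euler_beta a (b + 1)) => x y z.
rewrite -!EFinM -EFinD => -[E1] [->].
have ab : a + b != 0 by rewrite gt_eqF// addr_gt0.
by apply: (mulfI ab); rewrite mulrA mulrCA mulfV// mulr1 mulrDl mulrDr -E1 addrC.
Qed.

Lemma euler_betaSr a b : 0 < a -> 0 < b ->
  euler_beta a (b + 1) = b / (a + b) * euler_beta a b.
Proof.
move=> a0 b0; have b1 : 0 < b + 1 by rewrite addr_gt0.
by rewrite (euler_beta_sym a0 b1) (euler_betaSl b0 a0) (addrC b) (euler_beta_sym a0 b0).
Qed.

End beta.

(** * The Euler-Lagrange equation at a point *)

Section share.
Context (R : realType).
Implicit Types (P S z u y x r : R).

Lemma ler_powR_base r x y : 0 <= r -> 0 <= x -> x <= y -> x `^ r <= y `^ r.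
Proof.
by move=> r0 x0 xy; apply: ge0_ler_powR => //; rewrite nnegrE// (le_trans x0).
Qed.

Lemma ltr_powR_base r x y : 0 < r -> 0 <= x -> x < y -> x `^ r < y `^ r.
Proof.
by move=> r0 x0 xy; apply: gt0_ltr_powR => //; rewrite nnegrE// (le_trans x0)// ltW.
Qed.

Lemma powR_le_root r x y : 0 < r -> 0 <= x -> 0 <= y -> x <= y `^ r^-1 -> x `^ r <= y.
Proof.
move=> r0 x0 y0 xy; rewrite (@le_trans _ _ ((y `^ r^-1) `^ r))//.
  by apply: ler_powR_base => //; exact: ltW.
by rewrite -powRrM mulVf ?gt_eqF// powRr1.
Qed.

(* The share [u] of the [L_r]-term in the Euler-Lagrange equation solves
   [u ^ P = z (1 - u) ^ S]; when [P = 0] or [S = 0] the equation may have no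
   solution in (0, 1) and [u] sticks to an end of the interval. *)
Definition is_share P S z u :=
  [/\ 0 <= u <= 1, 0 < u -> u `^ P <= z * (1 - u) `^ S &
      u < 1 -> z * (1 - u) `^ S <= u `^ P].

(** In [u], the side [u ^ P] does not decrease, [z (1 - u) ^ S] does not increase, and one of them
    is strictly monotone because [P + S > 0]; so [u' < u] is impossible. The lemma yields both
    uniqueness and, through monotonicity in [z], measurability. *)
Lemma is_share_le P S z z' u u' : 0 <= P -> 0 <= S -> 0 < P + S -> 0 < z -> z <= z' ->
  is_share P S z u -> is_share P S z' u' -> u <= u'.
Proof.
move=> P0 S0 PS z0 zz' [/andP[u0 u1] hu _] [/andP[u0' u1'] _ hu'].
rewrite leNgt; apply/negP => u'u.
have up : 0 < u by exact: le_lt_trans u'u.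
have u'p : u' < 1 by exact: lt_le_trans u1.
have A : u `^ P <= z * (1 - u) `^ S := hu up.
have B : z' * (1 - u') `^ S <= u' `^ P := hu' u'p.
have C : z * (1 - u') `^ S <= z' * (1 - u') `^ S by rewrite ler_wpM2r ?powR_ge0.
have D1 : u' `^ P <= u `^ P by rewrite ler_powR_base// ltW.
have D2 : z * (1 - u) `^ S <= z * (1 - u') `^ S.
  by rewrite ler_pM2l// ler_powR_base ?subr_ge0// lerD2l lerN2 ltW.
have [P1|P1] := ltP 0 P.
  have : u' `^ P < u `^ P by exact: ltr_powR_base.
  by rewrite ltNge (le_trans A (le_trans D2 (le_trans C B))).
have S1 : 0 < S by move: PS; rewrite (le_anti (introT andP (conj P1 P0))) add0r.
have : z * (1 - u) `^ S < z * (1 - u') `^ S.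
  by rewrite ltr_pM2l// ltr_powR_base ?subr_ge0// ltrD2l ltrN2.
by rewrite ltNge (le_trans C (le_trans B (le_trans D1 A))).
Qed.

Lemma is_share_exists P S z : 0 <= P -> 0 <= S -> 0 < P + S -> 0 < z ->
  exists u, is_share P S z u.
Proof.
move=> P0 S0 PS z0.
have [P1|P1] := ltP 0 P; last first.
  have PE : P = 0 by apply: le_anti; rewrite P1.
  have S1 : 0 < S by move: PS; rewrite PE add0r.
  have [z1|z1] := leP z 1.
    (* With [P = 0] the equation reads [1 = z (1 - u) ^ S]: it can be solved explicitly for [z > 1],
       and otherwise the share is 0. *)
    by exists 0; split; rewrite ?lexx ?ler01 ?ltxx// subr0 powR1 mulr1 PE powRr0.
  have zi : z^-1 `^ S^-1 < 1.
    rewrite -[ltRHS](powRr1 ler01) -[X in _ < _ `^ X](mulfV (lt0r_neq0 S1)) powRrM powR1.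
    by rewrite ltr_powR_base ?invr_gt0 ?invr_ge0 ?(ltW z0)// invf_lt1.
  have E : z * (1 - (1 - z^-1 `^ S^-1)) `^ S = (1 - z^-1 `^ S^-1) `^ P.
    by rewrite PE powRr0 subKr -powRrM mulVf ?gt_eqF// powRr1 ?invr_ge0 ?(ltW z0)// mulfV ?gt_eqF.
  exists (1 - z^-1 `^ S^-1); split; rewrite ?E//.
  by rewrite subr_ge0 ltW//= gerBl powR_ge0.
have [S1|S1] := ltP 0 S; last first.
  have SE : S = 0 by apply: le_anti; rewrite S1.
  have [z1|z1] := leP 1 z.
    (* With [S = 0] the equation reads [u ^ P = z]: for [z >= 1] the share is 1, and otherwise [u]
       is the root. *)
    by exists 1; split; rewrite ?lexx ?ler01 ?ltxx// powR1 SE powRr0 mulr1.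
  have zi : z `^ P^-1 <= 1.
    rewrite -[leRHS](powRr1 ler01) -[X in _ <= _ `^ X](mulfV (lt0r_neq0 P1)) powRrM powR1.
    by rewrite ler_powR_base ?invr_ge0 ?(ltW z0) ?ltW.
  have E : z * (1 - z `^ P^-1) `^ S = (z `^ P^-1) `^ P.
    by rewrite SE powRr0 mulr1 -powRrM mulVf ?gt_eqF// powRr1// ltW.
  by exists (z `^ P^-1); split; rewrite ?E// powR_ge0.
pose h u := u `^ P - z * (1 - u) `^ S.
have half (X : R) : 0 < X -> exists c : R, [/\ 0 < c, c <= 1 / 2 & c <= X].
  move=> X0; exists (Num.min (1 / 2) X).
  by split; [rewrite lt_min X0 divr_gt0|rewrite ge_min lexx|rewrite ge_min lexx orbT].
have h2 (e : R) : 0 < (1 / 2) `^ e :> R by rewrite powR_gt0// divr_gt0.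
have zS : 0 < z * (1 / 2) `^ S by rewrite mulr_gt0.
have zP : 0 < z^-1 * (1 / 2) `^ P by rewrite mulr_gt0// invr_gt0.
(* The numbers [c] and [w] are so small that [h] is nonpositive at [c] and nonnegative at [1 - w].
   The intermediate value theorem is then used on a segment inside ]0, 1[, where real powers are
   differentiable. *)
have [c [c0 c2 cX]] := half _ (powR_gt0 P^-1 zS).
have [w [w0 w2 wX]] := half _ (powR_gt0 S^-1 zP).
have hc : h c <= 0.
  rewrite /h subr_le0 (@le_trans _ _ (z * (1 / 2) `^ S))//.
    exact: powR_le_root P1 (ltW c0) (ltW zS) cX.
  by rewrite ler_pM2l//; apply: ler_powR_base => //; clear -c2; lra.
have hw : 0 <= h (1 - w).
  rewrite /h subr_ge0 subKr mulrC -ler_pdivlMr// (@le_trans _ _ (z^-1 * (1 / 2) `^ P))//.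
    exact: powR_le_root S1 (ltW w0) (ltW zP) wX.
  by rewrite mulrC ler_pM2r ?invr_gt0//; apply: ler_powR_base => //; clear -w2; lra.
have cw : c <= 1 - w by clear -c2 w2; lra.
have [u ucw hu] : exists2 u, u \in `[c, 1 - w] & h u = 0.
  apply: IVT => //; last by rewrite ge_min hc le_max hw orbT.
  apply: continuous_in_subspaceT => x /[1!inE]/=; rewrite in_itv/= => /andP[cx xw].
  have x0 : 0 < x by exact: lt_le_trans cx.
  have x1 : 0 < 1 - x by rewrite subr_gt0 (le_lt_trans xw)// gtrBl.
  have cp e y : 0 < y -> {for y, continuous (fun y : R => y `^ e)}.
    move=> y0; apply/differentiable_continuous; rewrite -derivable1_diffP.
    by have [] := is_derive1_powR e y0.
  apply: cvgB; first exact: cp.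
  apply: cvgM; first exact: cvg_cst.
  apply: (@continuous_comp _ _ _ (fun x : R => 1 - x) (fun y : R => y `^ S)); last exact: cp.
  by apply: cvgB; [exact: cvg_cst|exact: cvg_id].
have E : u `^ P = z * (1 - u) `^ S by apply/eqP; rewrite -subr_eq0 -/(h u) hu.
exists u; split; rewrite ?E//; move: ucw; rewrite in_itv/= => /andP[cu uw].
by rewrite (le_trans (ltW c0) cu) (le_trans uw)// gerBl ltW.
Qed.

(** The value 0 for [z <= 0] keeps the function monotone on the whole line, from which its
    measurability is obtained. *)
Definition share P S z : R := if 0 < z then xget 0 (is_share P S z) else 0.

Lemma shareP P S z : 0 <= P -> 0 <= S -> 0 < P + S -> 0 < z -> is_share P S z (share P S z).
Proof.
move=> P0 S0 PS z0; rewrite /share z0.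
by have [u hu] := is_share_exists P0 S0 PS z0; exact: (xgetI _ hu).
Qed.

Lemma share_eq P S z u : 0 <= P -> 0 <= S -> 0 < P + S -> 0 < z ->
  is_share P S z u -> share P S z = u.
Proof.
move=> P0 S0 PS z0 hu; have h := shareP P0 S0 PS z0.
by apply: le_anti; rewrite (is_share_le _ _ _ z0 (lexx z) h hu)// (is_share_le _ _ _ z0 (lexx z) hu h).
Qed.

Lemma share_ge0_le1 P S z : 0 <= P -> 0 <= S -> 0 < P + S -> 0 <= share P S z <= 1.
Proof.
move=> P0 S0 PS; have [z0|z0] := ltP 0 z; first by have [] := shareP P0 S0 PS z0.
by rewrite /share ltNge z0/= lexx ler01.
Qed.

Lemma measurable_share P S : 0 <= P -> 0 <= S -> 0 < P + S ->
  measurable_fun setT (share P S).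
Proof.
move=> P0 S0 PS; apply: nondecreasing_measurable => // x y xy.
have [x0|x0] := ltP 0 x; last first.
  have /andP[y0 _] := share_ge0_le1 y P0 S0 PS.
  by rewrite [leLHS]/share ltNge x0.
apply: (is_share_le P0 S0 PS x0 xy); by apply: shareP => //; exact: lt_le_trans xy.
Qed.

Lemma is_share_oo P S z u : is_share P S z u -> 0 < u < 1 -> u `^ P = z * (1 - u) `^ S.
Proof. by move=> [_ h1 h2] /andP[u0 u1]; apply: le_anti; rewrite h1// h2. Qed.

Lemma is_share_of_eq P S z u : 0 < u < 1 -> u `^ P = z * (1 - u) `^ S -> is_share P S z u.
Proof. by move=> /andP[u0 u1] E; split; rewrite ?E ?lexx// !ltW. Qed.

Lemma powR_expR x r : 0 < x -> x `^ r = expR (r * ln x).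
Proof. by move=> x0; rewrite /powR gt_eqF. Qed.

(** * The share as variable of integration in place of the radius *)

Section radial.
Local Notation mu := (@lebesgue_measure R).
Variables (P S kappa c : R) (F : R -> R).
Hypotheses (P0 : 0 <= P) (S0 : 0 <= S) (PS : 0 < P + S) (kappa0 : 0 < kappa) (c0 : 0 < c).
Hypotheses (mF : measurable_fun setT F) (F0 : forall u, 0 <= F u) (Fz : F 0 = 0) (Fo : F 1 = 0).

(* [radius u] is the radius at which the share equals [u]. *)
Let radius u := expR ((P * ln u - S * ln (1 - u) - ln c) / kappa).
Let dradius u := (P / u + S / (1 - u)) / kappa * radius u.

Let radius_gt0 u : 0 < radius u. Proof. exact: expR_gt0. Qed.

Let share_radius u : 0 < u < 1 -> share P S (c * radius u `^ kappa) = u.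
Proof.
move=> u01; have /andP[u0 u1] := u01.
apply: share_eq => //; first by rewrite mulr_gt0// powR_gt0.
apply: is_share_of_eq => //.
have u1' : 0 < 1 - u by rewrite subr_gt0.
rewrite !powR_expR// /radius expRK -[X in X * _ * _](lnK c0) -!expRD; congr expR.
by field; rewrite gt_eqF.
Qed.

Let share_image rho : 0 < rho -> 0 < share P S (c * rho `^ kappa) < 1 ->
  (radius @` `]0, 1[) rho.
Proof.
move=> rho0 u01; set u := share _ _ _ in u01.
exists u; first by rewrite /= in_itv.
have /andP[u0 u1] := u01.
have u1' : 0 < 1 - u by rewrite subr_gt0.
have z0 : 0 < c * rho `^ kappa by rewrite mulr_gt0// powR_gt0.
have E := is_share_oo (shareP P0 S0 PS z0) u01; rewrite -/u in E.
rewrite -[RHS]lnK// /radius; congr expR.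
have : ln (u `^ P) = ln (c * rho `^ kappa * (1 - u) `^ S) by rewrite E.
rewrite ln_powR !lnM ?posrE ?mulr_gt0 ?powR_gt0// !ln_powR => ->.
by field; rewrite gt_eqF.
Qed.

Let dradiusP u : u \in `]0, 1[ -> is_derive u 1 radius (dradius u).
Proof.
rewrite in_itv/= => /andP[u0 u1].
have u1' : 0 < 1 - u by rewrite subr_gt0.
have d1 : is_derive u 1 (fun x : R => 1 - x) (0 - 1) by exact: is_deriveB.
have d2 : is_derive u 1 (fun x : R => ln (1 - x)) ((1 - u)^-1 * (0 - 1)).
  by apply: (@is_derive1_comp _ (@ln R) (fun x => 1 - x)); exact: is_derive1_ln.
have d3 : is_derive u 1 (fun x : R => (P * ln x - S * ln (1 - x) - ln c) / kappa)
    ((P / u - S * ((1 - u)^-1 * (0 - 1)) - 0) / kappa).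
  have d4 : is_derive u 1 (fun x : R => P * ln x - S * ln (1 - x) - ln c)
      (P / u - S * ((1 - u)^-1 * (0 - 1)) - 0).
    have e1 : is_derive u 1 (fun x : R => P * ln x) (P / u).
      by apply: is_deriveZ; exact: is_derive1_ln.
    have e2 : is_derive u 1 (fun x : R => S * ln (1 - x)) (S * ((1 - u)^-1 * (0 - 1))).
      exact: is_deriveZ.
    have e3 := is_deriveB e1 e2.
    exact: (is_deriveB e3 (is_derive_cst _ _ _)).
  rewrite (_ : (fun _ => _) = (fun x : R => kappa^-1 * (P * ln x - S * ln (1 - x) - ln c))); last first.
    by apply/funext => x; rewrite mulrC.
  by rewrite mulrC; exact: is_deriveZ.
have := @is_derive1_comp _ (@expR R) _ u _ _ (is_derive_expR _) d3.
rewrite (_ : _ * _ = dradius u)// /dradius /radius mulrC; congr (_ / _ * _); lra.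
Qed.

Let dradius_cont u : u \in `]0, 1[ -> {for u, continuous dradius}.
Proof.
move=> uI; have := uI; rewrite in_itv/= => /andP[u0 u1].
have u1' : 0 < 1 - u by rewrite subr_gt0.
have cr : {for u, continuous radius}.
  by apply/differentiable_continuous; rewrite -derivable1_diffP; have [] := dradiusP uI.
have c1 : {for u, continuous (fun x : R => P / x)}.
  by apply: cvgM; [exact: cvg_cst|apply: cvgV; rewrite ?gt_eqF//; exact: cvg_id].
have c2 : {for u, continuous (fun x : R => S / (1 - x))}.
  apply: cvgM; [exact: cvg_cst|apply: cvgV; rewrite ?gt_eqF//].
  by apply: cvgB; [exact: cvg_cst|exact: cvg_id].
by apply: cvgM; [apply: cvgM; [exact: cvgD|exact: cvg_cst]|exact: cr].
Qed.

(** Along [rho = radius u] one has [d rho / rho = (P / u + S / (1 - u)) du / kappa]. If [P] or [S]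
    vanishes, [radius] misses part of the half-line; there the share is 0 or 1, and the vanishing of
    [F] at both ends removes these radii. *)
Lemma ge0_integral_radial_share :
  (\int[mu]_(rho in `]0%R, +oo[) (F (share P S (c * rho `^ kappa)) / rho)%:E =
   \int[mu]_(u in `]0%R, 1%R[) (F u * ((P / u + S / (1 - u)) / kappa))%:E)%E.
Proof.
pose g rho := (F (share P S (c * rho `^ kappa)) * `|rho|^-1)%:E.
have g0 rho : (0 <= g rho)%E by rewrite lee_fin mulr_ge0// invr_ge0.
have mg : measurable_fun setT g.
  apply/measurable_EFinP; apply: measurable_funM.
    apply: (@measurableT_comp _ _ _ _ _ _ F) => //.
    apply: (@measurableT_comp _ _ _ _ _ _ (share P S)); first exact: measurable_share.
    by apply: measurable_funM => //; exact: measurable_powR.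
  by apply: (@measurableT_comp _ _ _ _ _ _ (@GRing.inv R)) => //; exact: measurable_inv.
transitivity (\int[mu]_(rho in radius @` `]0%R, 1%R[) g rho)%E.
  rewrite integral_mkcond [RHS]integral_mkcond; apply: eq_integral => rho _; rewrite !patchE.
  rewrite mem_setE in_itv/= andbT.
  case: ltP => rho0; last first.
    by rewrite memNset// => -[u _ ur]; have := radius_gt0 u; rewrite ur ltNge rho0.
  case: ifPn => [_|/negP rI]; first by rewrite /g gtr0_norm.
  have /andP[] := share_ge0_le1 (c * rho `^ kappa) P0 S0 PS.
  rewrite le_eqVlt => /predU1P[<- _|u0]; first by rewrite Fz mul0r.
  rewrite le_eqVlt => /predU1P[->|u1]; first by rewrite Fo mul0r.
  by exfalso; apply: rI; apply/mem_set/share_image => //; rewrite u0.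
rewrite (ge0_change_of_variables dradiusP)//.
- apply: eq_integral => u; rewrite inE/= in_itv/= => u01.
  rewrite /g share_radius// gtr0_norm// -EFinM; congr (_%:E).
  by rewrite /dradius; field; rewrite !gt_eqF//=; move: u01 => /andP[u0 u1]; rewrite ?u0 ?subr_gt0.
- move=> u; rewrite in_itv/= => /andP[u0 u1].
  rewrite mulr_gt0// divr_gt0// lt_neqAle eq_sym addr_ge0 ?divr_ge0 ?subr_ge0 ?(ltW u0) ?(ltW u1)// andbT.
  rewrite paddr_eq0 ?divr_ge0 ?subr_ge0 ?(ltW u0) ?(ltW u1)//.
  rewrite !mulf_eq0 !invr_eq0 (gt_eqF u0) (gt_eqF (_ : 0 < 1 - u)) ?subr_gt0// !orbF.
  by apply/negP => /andP[/eqP P_0 /eqP S_0]; move: PS; rewrite P_0 S_0 addr0 ltxx.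
Qed.

End radial.

End share.

(** * The pointwise bound and its case of equality *)

Section extremal.
Context (R : realType).
Local Notation mu := (@lebesgue_measure R).

(** Young's inequality with exponents [p / q] and [p / (p - q)], the factor [y ^ q] being balanced
    by a power of [y0] so that equality occurs at [y = y0]. *)
Lemma young_powR (q p y y0 : R) : 0 < q -> q <= p -> 0 <= y -> 0 < y0 ->
  y `^ q <= q / p * (y `^ p * y0 `^ (q - p)) + (1 - q / p) * y0 `^ q.
Proof.
move=> q0 qp y_ge0 y00; have p0 : 0 < p by exact: lt_le_trans qp.
move: qp; rewrite le_eqVlt => /predU1P[<-|qp].
  by rewrite divff ?gt_eqF// !subrr powRr0 mulr1 mul1r mul0r addr0.
have pq0 : 0 < p - q by rewrite subr_gt0.
have E : y `^ q = (y `^ q * y0 `^ (q * (q - p) / p)) * y0 `^ (q * (p - q) / p).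
  rewrite -mulrA -powRD; last by rewrite (gt_eqF y00) implybT.
  by rewrite (_ : _ + _ = 0) ?powRr0 ?mulr1//; field; rewrite gt_eqF.
rewrite {1}E (le_trans (conjugate_powR (p := p / q) (q := p / (p - q)) _ _ _ _ _))//.
- by rewrite mulr_ge0 ?powR_ge0.
- exact: powR_ge0.
- exact: divr_gt0.
- exact: divr_gt0.
- by field; rewrite !gt_eqF.
rewrite powRM ?powR_ge0// -!powRrM le_eqVlt; apply/orP; left; apply/eqP.
have -> : q * (p / q) = p by field; rewrite gt_eqF.
have -> : q * (q - p) / p * (p / q) = q - p by field; rewrite !gt_eqF.
have -> : q * (p - q) / p * (p / (p - q)) = q by field; rewrite !gt_eqF.
by field; rewrite !gt_eqF.
Qed.

Variables (p q r lam m a1 a2 : R).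
Hypotheses (q0 : 0 < q) (qp : q <= p) (qr : q <= r) (pqr : 0 < (p - q) + (r - q))
  (lam0 : 0 < lam) (m0 : 0 < m) (a10 : 0 < a1) (a20 : 0 < a2).

(** The exponent of the radius once the unknown function is eliminated from the Euler-Lagrange
    equation. It equals [p m + r lam - q (lam + m)], so dividing it by [q (p m + r lam)] gives
    [1/q - alpha - beta]. *)
Definition scaling_exponent := lam * (r - q) + m * (p - q).
Local Notation kappa := scaling_exponent.
Local Notation G := (q * m / kappa).
Local Notation H := (q * lam / kappa).

(** With [Y = y ^ q] and [y = rho ^ d xi], the Euler-Lagrange equation says that
    [1 - u = rho^(-lam) Y^((p-q)/q) / a1] and [u = rho^m s Y^((r-q)/q) / a2] add up to 1. Raising
    the first relation to the power [r - q], the second to [p - q], and eliminating [Y] gives the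
    equation solved here. *)
Definition extremal_share (rho s : R) : R :=
  share (p - q) (r - q) ((s `^ (p - q) * a1 `^ (r - q) / a2 `^ (p - q)) * rho `^ kappa).

(** The same two relations with [rho] eliminated instead: raise the first to the power [m], the
    second to [lam], multiply, and take the root of order [kappa / q]. At [u = 0] and [u = 1] the
    value is 0. *)
Definition extremal_pow (rho s : R) : R :=
  ((1 - extremal_share rho s) * a1) `^ G * (extremal_share rho s * a2 / s) `^ H.

Let P0 : 0 <= p - q. Proof. by rewrite subr_ge0. Qed.
Let S0 : 0 <= r - q. Proof. by rewrite subr_ge0. Qed.
Let p0 : 0 < p. Proof. exact: lt_le_trans qp. Qed.
Let r0 : 0 < r. Proof. exact: lt_le_trans qr. Qed.

Lemma scaling_exponent_gt0 : 0 < kappa.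
Proof.
rewrite /kappa lt_neqAle eq_sym addr_ge0 ?mulr_ge0 ?(ltW lam0) ?(ltW m0)// andbT.
rewrite paddr_eq0 ?mulr_ge0 ?(ltW lam0) ?(ltW m0)//.
rewrite !mulf_eq0 (gt_eqF lam0) (gt_eqF m0)/=; apply/negP => /andP[/eqP E1 /eqP E2].
by move: pqr; rewrite E1 E2 addr0 ltxx.
Qed.
Let kappa0 := scaling_exponent_gt0.

Let G0 : 0 < G. Proof. by rewrite divr_gt0// mulr_gt0. Qed.
Let H0 : 0 < H. Proof. by rewrite divr_gt0// mulr_gt0. Qed.

Lemma extremal_share_ge0_le1 rho s : 0 <= extremal_share rho s <= 1.
Proof. exact: share_ge0_le1. Qed.

Lemma extremal_pow_ge0 rho s : 0 <= extremal_pow rho s.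
Proof. by rewrite mulr_ge0// powR_ge0. Qed.

Section point.
Variables (rho s : R).
Hypotheses (rho0 : 0 < rho) (s0 : 0 < s).
Local Notation u := (extremal_share rho s).
Local Notation Y := (extremal_pow rho s).

Let z0 : 0 < (s `^ (p - q) * a1 `^ (r - q) / a2 `^ (p - q)) * rho `^ kappa.
Proof. by rewrite mulr_gt0 ?powR_gt0// divr_gt0 ?powR_gt0// mulr_gt0 ?powR_gt0. Qed.

Let uP : is_share (p - q) (r - q) ((s `^ (p - q) * a1 `^ (r - q) / a2 `^ (p - q)) * rho `^ kappa) u.
Proof. exact: shareP. Qed.

Let pow1 e : 1 `^ e = 1 :> R. Proof. by rewrite powR1. Qed.

Let Y0 : u = 0 -> Y = 0.
Proof. by move=> u_0; rewrite /extremal_pow u_0 !mul0r (powR0 (lt0r_neq0 H0)) mulr0. Qed.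

Let Y1 : u = 1 -> Y = 0.
Proof. by move=> u_1; rewrite /extremal_pow u_1 subrr !mul0r (powR0 (lt0r_neq0 G0)) mul0r. Qed.

Let cases : [\/ u = 0, u = 1 | 0 < u < 1].
Proof.
have /andP[] := extremal_share_ge0_le1 rho s.
rewrite le_eqVlt => /predU1P[<- _|u0]; first by constructor 1.
by rewrite le_eqVlt => /predU1P[->|u1]; [constructor 2|constructor 3; rewrite u0].
Qed.

Let Y_gt0 : 0 < u < 1 -> 0 < Y.
Proof.
move=> /andP[u0 u1].
by rewrite mulr_gt0// powR_gt0// ?divr_gt0// mulr_gt0// subr_gt0.
Qed.

Let lnP : 0 < u < 1 ->
  (p - q) * (ln u + ln a2 - ln s) =
  kappa * ln rho + (r - q) * (ln (1 - u) + ln a1).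
Proof.
move=> u01; have /andP[u0 u1] := u01; have u1' : 0 < 1 - u by rewrite subr_gt0.
have := congr1 (@ln R) (is_share_oo uP u01).
rewrite !lnM ?posrE ?mulr_gt0 ?invr_gt0 ?powR_gt0//.
by rewrite lnV ?posrE ?powR_gt0// !ln_powR => E; rewrite mulrBr mulrDr E; ring.
Qed.

Let lnY : 0 < u < 1 ->
  ln Y = G * (ln (1 - u) + ln a1) + H * (ln u + ln a2 - ln s).
Proof.
move=> /andP[u0 u1]; have u1' : 0 < 1 - u by rewrite subr_gt0.
rewrite /extremal_pow lnM ?posrE ?powR_gt0 ?divr_gt0 ?mulr_gt0// !ln_powR.
by rewrite !lnM ?posrE ?mulr_gt0 ?invr_gt0// lnV ?posrE.
Qed.

(** Linear in logarithms: after multiplication by [kappa], [lnY] expands the left side and [lnP]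
    replaces [(p - q)(ln u + ln a2 - ln s)], which leaves [kappa lam ln rho] as the term in the
    radius. *)
Let YP : 0 < u < 1 -> Y `^ ((p - q) / q) = (1 - u) * a1 * rho `^ lam.
Proof.
move=> u01; have /andP[u0 u1] := u01; have u1' : 0 < 1 - u by rewrite subr_gt0.
have Yp := Y_gt0 u01.
have f1 : 0 < (1 - u) * a1 by rewrite mulr_gt0.
have f2 : 0 < rho `^ lam by rewrite powR_gt0.
apply: ln_inj; [by rewrite posrE powR_gt0|by rewrite posrE mulr_gt0|].
rewrite lnM ?posrE// lnM ?posrE// !ln_powR lnY//.
apply: (mulfI (lt0r_neq0 kappa0)).
transitivity (m * (p - q) * (ln (1 - u) + ln a1) + lam * ((p - q) * (ln u + ln a2 - ln s))).
  by move: (ln (1 - u)) (ln u) => x y; field; rewrite !gt_eqF.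
by rewrite lnP// /scaling_exponent; ring.
Qed.

Let YS : 0 < u < 1 -> Y `^ ((r - q) / q) = u * a2 / (s * rho `^ m).
Proof.
move=> u01; have /andP[u0 u1] := u01; have u1' : 0 < 1 - u by rewrite subr_gt0.
have Yp := Y_gt0 u01.
have f1 : 0 < u * a2 by rewrite mulr_gt0.
have f2 : 0 < rho `^ m by rewrite powR_gt0.
have f3 : 0 < s * rho `^ m by rewrite mulr_gt0.
have f4 : 0 < (s * rho `^ m)^-1 by rewrite invr_gt0.
apply: ln_inj; [by rewrite posrE powR_gt0|by rewrite posrE mulr_gt0|].
rewrite lnM ?posrE// lnM ?posrE// lnV ?posrE// lnM ?posrE// !ln_powR lnY//.
apply: (mulfI (lt0r_neq0 kappa0)).
transitivity (m * ((r - q) * (ln (1 - u) + ln a1)) + lam * (r - q) * (ln u + ln a2 - ln s)).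
  by move: (ln (1 - u)) (ln u) => x y; field; rewrite !gt_eqF.
have -> : (r - q) * (ln (1 - u) + ln a1) =
  (p - q) * (ln u + ln a2 - ln s) - kappa * ln rho by rewrite lnP//; ring.
by rewrite /scaling_exponent; ring.
Qed.

(** Together with [extremal_powE_r] this is the Euler-Lagrange equation, the two terms taking the
    shares [1 - u] and [u] of [Y]. When the share is stuck at an end both sides vanish. *)
Lemma extremal_powE_p : rho `^ (- lam) * Y `^ (p / q) = a1 * (1 - u) * Y.
Proof.
have [u_0|u_1|u01] := cases.
- by rewrite (Y0 u_0) powR0 ?mulr0// gt_eqF// divr_gt0.
- by rewrite (Y1 u_1) powR0 ?mulr0// gt_eqF// divr_gt0.
have Yp := Y_gt0 u01.
have -> : p / q = 1 + (p - q) / q by field; rewrite gt_eqF.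
rewrite powRD ?(gt_eqF Yp) ?implybT// powRr1 ?ltW// YP// powRN.
by field; rewrite gt_eqF ?powR_gt0.
Qed.

Lemma extremal_powE_r : rho `^ m * s * Y `^ (r / q) = a2 * u * Y.
Proof.
have [u_0|u_1|u01] := cases.
- by rewrite (Y0 u_0) powR0 ?mulr0// gt_eqF// divr_gt0.
- by rewrite (Y1 u_1) powR0 ?mulr0// gt_eqF// divr_gt0.
have Yp := Y_gt0 u01.
have -> : r / q = 1 + (r - q) / q by field; rewrite gt_eqF.
rewrite powRD ?(gt_eqF Yp) ?implybT// powRr1 ?ltW// YS//.
by field; rewrite !gt_eqF ?powR_gt0.
Qed.

(** Inside the interval this is the average, with weights [1 - u] and [u], of Young's inequality for
    [p] and for [r], both taken at the point [Y ^ (1/q)]. At the ends the remainder is 0 and one of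
    the two other terms suffices. *)
Lemma extremal_bound y : 0 <= y ->
  y `^ q <= q / (p * a1) * (rho `^ (- lam) * y `^ p) +
            q / (r * a2) * (rho `^ m * s * y `^ r) +
            Y * ((1 - u) * (1 - q / p) + u * (1 - q / r)).
Proof.
move=> y0.
have N1 : 0 <= q / (p * a1) * (rho `^ (- lam) * y `^ p).
  by rewrite !mulr_ge0 ?invr_ge0 ?mulr_ge0 ?powR_ge0 ?ltW.
have N2 : 0 <= q / (r * a2) * (rho `^ m * s * y `^ r).
  by rewrite !mulr_ge0 ?invr_ge0 ?mulr_ge0 ?powR_ge0 ?ltW.
have [u_0|u_1|u01] := cases.
(* A share stuck at 0 forces [p = q] and [a1 rho ^ lam <= 1], so the [L_p]-term alone dominates
   [y ^ q]. *)
- rewrite (Y0 u_0) mul0r addr0; apply: ler_wpDr => //.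
  have [_ _] := uP; rewrite u_0 => /(_ ltr01); rewrite subr0 powR1 mulr1 => zle.
  have pq : p - q = 0.
    apply/eqP; apply: contraTT zle => P1.
    by rewrite powR0// -ltNge.
  have S1 : 0 < r - q by move: pqr; rewrite pq add0r.
  have : a1 * rho `^ lam <= 1.
    rewrite leNgt; apply/negP => lt1; move: zle.
    rewrite /scaling_exponent pq !powRr0 mul1r invr1 mulr1 mulr0 addr0 powRrM.
    rewrite -powRM ?powR_ge0 ?(ltW a10)// leNgt -[X in X < _](pow1 (r - q)).
    by rewrite ltr_powR_base.
  move=> le1; have pE : p = q by apply/eqP; rewrite -subr_eq0 pq.
  rewrite pE mulrA ler_peMl ?powR_ge0// powRN.
  have -> : q / (q * a1) / rho `^ lam = (a1 * rho `^ lam)^-1.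
    by field; rewrite !gt_eqF ?powR_gt0.
  by rewrite invf_ge1// mulr_gt0// powR_gt0.
(* A share stuck at 1 forces [r = q] and [s rho ^ m >= a2], so the [L_r]-term alone dominates
   [y ^ q]. *)
- rewrite (Y1 u_1) mul0r addr0; apply: ler_wpDl => //.
  have [_ + _] := uP; rewrite u_1 => /(_ ltr01); rewrite subrr powR1 => zle.
  have rq : r - q = 0.
    apply/eqP; apply: contraTT zle => S1.
    by rewrite powR0// mulr0 -ltNge.
  have P1 : 0 < p - q by move: pqr; rewrite rq addr0.
  have : 1 <= s * rho `^ m / a2.
    rewrite leNgt; apply/negP => lt1; move: zle.
    rewrite /scaling_exponent rq !powRr0 !mulr1 mulr0 add0r powRrM.
    have -> : s `^ (p - q) / a2 `^ (p - q) * (rho `^ m) `^ (p - q) = (s * rho `^ m / a2) `^ (p - q).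
      rewrite powRM ?mulr_ge0 ?powR_ge0 ?invr_ge0 ?(ltW s0) ?(ltW a20)//.
      rewrite powRM ?powR_ge0 ?(ltW s0)//.
      have -> : a2^-1 `^ (p - q) = (a2 `^ (p - q))^-1.
        by rewrite -(powR_inv1 (ltW a20)) -powRrM mulN1r powRN.
      by rewrite mulrAC.
    rewrite leNgt -[X in _ < X](pow1 (p - q)) ltr_powR_base//.
    by rewrite !mulr_ge0 ?powR_ge0 ?invr_ge0 ?(ltW s0) ?(ltW a20).
  move=> ge1; have rE : r = q by apply/eqP; rewrite -subr_eq0 rq.
  rewrite rE mulrA ler_peMl ?powR_ge0//.
  have -> : q / (q * a2) * (rho `^ m * s) = s * rho `^ m / a2 by field; rewrite !gt_eqF.
  by [].
have Yp := Y_gt0 u01; have /andP[u0 u1] := u01.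
have u1' : 0 < 1 - u by rewrite subr_gt0.
pose y0' := Y `^ q^-1.
have y0'0 : 0 < y0' by rewrite powR_gt0.
have y0'q : y0' `^ q = Y by rewrite -powRrM mulVf ?gt_eqF// powRr1// ltW.
have Ep : y0' `^ (q - p) = (rho `^ (- lam)) / ((1 - u) * a1).
  rewrite -powRrM (_ : q^-1 * (q - p) = - ((p - q) / q)); last by ring.
  rewrite powRN YP// powRN; by field; rewrite !gt_eqF ?powR_gt0.
have Er : y0' `^ (q - r) = (s * rho `^ m) / (u * a2).
  rewrite -powRrM (_ : q^-1 * (q - r) = - ((r - q) / q)); last by ring.
  rewrite powRN YS//; by field; rewrite !gt_eqF ?powR_gt0.
have A := young_powR q0 qp y0 y0'0; have B := young_powR q0 qr y0 y0'0.
rewrite y0'q Ep in A; rewrite y0'q Er in B.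
have A' := ler_wpM2l (ltW u1') A; have B' := ler_wpM2l (ltW u0) B.
have -> : y `^ q = (1 - u) * y `^ q + u * y `^ q by ring.
rewrite (le_trans (lerD A' B'))// le_eqVlt; apply/orP; left; apply/eqP.
by field; rewrite !gt_eqF.
Qed.

End point.
End extremal.

(** * Radial integrals of the solution as beta values *)

Section extremal_integrals.
Context (R : realType).
Local Notation mu := (@lebesgue_measure R).
Variables (p q r lam m a1 a2 : R).
Hypotheses (q0 : 0 < q) (qp : q <= p) (qr : q <= r) (pqr : 0 < (p - q) + (r - q))
  (lam0 : 0 < lam) (m0 : 0 < m) (a10 : 0 < a1) (a20 : 0 < a2).

Local Notation kappa := (scaling_exponent p q r lam m).
Local Notation G := (q * m / kappa).
Local Notation H := (q * lam / kappa).
Local Notation u := (extremal_share p q r lam m a1 a2).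
Local Notation Y := (extremal_pow p q r lam m a1 a2).

Let kappa0 : 0 < kappa. Proof. exact: scaling_exponent_gt0. Qed.
Let P0 : 0 <= p - q. Proof. by rewrite subr_ge0. Qed.
Let S0 : 0 <= r - q. Proof. by rewrite subr_ge0. Qed.
Let G0 : 0 < G. Proof. by rewrite divr_gt0// mulr_gt0. Qed.
Let H0 : 0 < H. Proof. by rewrite divr_gt0// mulr_gt0. Qed.
Let p0 : 0 < p. Proof. exact: lt_le_trans qp. Qed.
Let r0 : 0 < r. Proof. exact: lt_le_trans qr. Qed.

Lemma measurable_extremal_share d (T : measurableType d) (f g : T -> R) :
  measurable_fun setT f -> measurable_fun setT g ->
  measurable_fun setT (fun t => u (f t) (g t)).
Proof.
move=> mf mg.
apply: (@measurableT_comp _ _ _ _ _ _ (share (p - q) (r - q))); first exact: measurable_share.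
have mpow (h : T -> R) e : measurable_fun setT h -> measurable_fun setT (fun t => h t `^ e).
  by move=> mh; apply: (@measurableT_comp _ _ _ _ _ _ (fun x : R => x `^ e)) => //; exact: measurable_powR.
apply: measurable_funM; last exact: mpow.
by apply: measurable_funM => //; apply: measurable_funM => //; exact: mpow.
Qed.

Lemma measurable_extremal_pow d (T : measurableType d) (f g : T -> R) :
  measurable_fun setT f -> measurable_fun setT g ->
  measurable_fun setT (fun t => Y (f t) (g t)).
Proof.
move=> mf mg; have mu1 := measurable_extremal_share mf mg.
have mpow (h : T -> R) e : measurable_fun setT h -> measurable_fun setT (fun t => h t `^ e).
  by move=> mh; apply: (@measurableT_comp _ _ _ _ _ _ (fun x : R => x `^ e)) => //; exact: measurable_powR.
apply: measurable_funM; apply: mpow; apply: measurable_funM => //.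
- exact: measurable_funB.
- exact: measurable_funM.
- by apply: (@measurableT_comp _ _ _ _ _ _ (@GRing.inv R)) => //; exact: measurable_inv.
Qed.

(** The two terms of [d rho / rho] in the variable [u] lower the exponent of [u], respectively of
    [1 - u], by one; each leaves a beta integral. The result does not depend on [s]. *)
Let integral_radial (b c s : R) : 0 < b -> 0 < c -> 0 < s ->
  (\int[mu]_(rho in `]0%R, +oo[) (((1 - u rho s) `^ b * u rho s `^ c) / rho)%:E =
   (((p - q) * euler_beta c (b + 1) + (r - q) * euler_beta (c + 1) b) / kappa)%:E)%E.
Proof.
move=> b0 c0 s0.
have c10 : 0 < c + 1 by rewrite addr_gt0.
have b10 : 0 < b + 1 by rewrite addr_gt0.
pose F v := `|1 - v| `^ b * `|v| `^ c.
have mF : measurable_fun setT F.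
  apply: measurable_funM; (apply: (@measurableT_comp _ _ _ _ _ _ (fun x : R => x `^ _)); first exact: measurable_powR).
    by apply: measurableT_comp => //; exact: measurable_funB.
  exact: normr_measurable.
have z0 : 0 < s `^ (p - q) * a1 `^ (r - q) / a2 `^ (p - q).
  by rewrite divr_gt0 ?mulr_gt0 ?powR_gt0.
have F0 v : 0 <= F v by rewrite mulr_ge0 ?powR_ge0.
have Fz : F 0 = 0 by rewrite /F normr0 (powR0 (lt0r_neq0 c0)) mulr0.
have Fo : F 1 = 0 by rewrite /F subrr normr0 (powR0 (lt0r_neq0 b0)) mul0r.
have := ge0_integral_radial_share P0 S0 pqr kappa0 z0 mF F0 Fz Fo.
rewrite [X in X = _ -> _](_ : _ =
    \int[mu]_(rho in `]0%R, +oo[) (((1 - u rho s) `^ b * u rho s `^ c) / rho)%:E)%E; last first.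
  apply: eq_integral => rho _; congr ((_ * _)%:E).
  have /andP[u0 u1] := extremal_share_ge0_le1 lam m a1 a2 qp qr pqr rho s.
  by rewrite /F -/(u rho s) !ger0_norm ?subr_ge0.
move=> ->.
have mpq (a e : R) : measurable_fun (`]0, 1[%classic : set (measurableTypeR R)) (fun v : R => (v `^ a * (1 - v) `^ e)%:E).
  apply: measurable_funTS; apply/measurable_EFinP; apply: measurable_funM; first exact: measurable_powR.
  apply: (@measurableT_comp _ _ _ _ _ _ (fun x : R => x `^ e)); first exact: measurable_powR.
  exact: measurable_funB.
have pq0 (a e v : R) : (0 <= (v `^ a * (1 - v) `^ e)%:E)%E by rewrite lee_fin mulr_ge0 ?powR_ge0.
transitivity (\int[mu]_(v in `]0%R, 1%R[)
   (((p - q) / kappa)%:E * (v `^ (c - 1) * (1 - v) `^ (b + 1 - 1))%:E +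
   ((r - q) / kappa)%:E * (v `^ (c + 1 - 1) * (1 - v) `^ (b - 1))%:E))%E.
  apply: eq_integral => v; rewrite inE/= in_itv/= => /andP[v0 v1].
  have v1' : 0 < 1 - v by rewrite subr_gt0.
  rewrite -!EFinM -EFinD; congr (_%:E).
  rewrite /F !gtr0_norm// !addrK -(mulr_powRB1 (ltW v0) c0) -(mulr_powRB1 (ltW v1') b0).
  move: (v `^ _) ((1 - v) `^ _) => x y.
  by field; rewrite !gt_eqF.
rewrite ge0_integralD//; last 4 first.
- by move=> v _; rewrite mule_ge0// lee_fin divr_ge0// ltW.
- by apply: emeasurable_funM => //; exact: measurable_cst.
- by move=> v _; rewrite mule_ge0// lee_fin divr_ge0// ltW.
- by apply: emeasurable_funM => //; exact: measurable_cst.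
rewrite ge0_integralZl ?lee_fin ?divr_ge0 ?(ltW kappa0)//.
rewrite ge0_integralZl ?lee_fin ?divr_ge0 ?(ltW kappa0)//.
rewrite -(EFin_euler_beta c0 b10) -(EFin_euler_beta c10 b0) -!EFinM -EFinD; congr (_%:E).
by field; rewrite gt_eqF.
Qed.

Let Yfactor rho s : 0 < s ->
  Y rho s = (a1 `^ G * a2 `^ H * s `^ (- H)) * ((1 - u rho s) `^ G * u rho s `^ H).
Proof.
move=> s0; have /andP[u0 u1] := extremal_share_ge0_le1 lam m a1 a2 qp qr pqr rho s.
have u1' : 0 <= 1 - u rho s by rewrite subr_ge0.
rewrite /extremal_pow -mulrA !powRM ?mulr_ge0 ?invr_ge0 ?(ltW a10) ?(ltW a20) ?(ltW s0)//.
have -> : s^-1 `^ H = s `^ (- H) by rewrite -(powR_inv1 (ltW s0)) -powRrM mulN1r.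
ring.
Qed.

(** The integral of [Y / rho] over the radii at [s = 1], divided by [p m + r lam]: with this
    normalization the parts with factors [1 - u] and [u] are [p m] and [r lam] times it. *)
Definition extremal_constant := a1 `^ G * a2 `^ H / ((lam + m) * (p * m + r * lam)) * euler_beta G H.

Let sumGH : p * m + r * lam = kappa + q * (lam + m).
Proof. by rewrite /scaling_exponent; ring. Qed.

Let mradial b c s :
  measurable_fun setT (fun rho => (((1 - u rho s) `^ b * u rho s `^ c) / rho)%:E).
Proof.
have mu1 : measurable_fun setT (fun rho : R => u rho s).
  exact: (measurable_extremal_share (f := id) (g := fun=> s)).
have mpow (h : R -> R) e : measurable_fun setT h -> measurable_fun setT (fun t => h t `^ e).
  by move=> mh; apply: (@measurableT_comp _ _ _ _ _ _ (fun x : R => x `^ e)) => //; exact: measurable_powR.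
apply/measurable_EFinP; apply: measurable_funM; last exact: measurable_inv.
by apply: measurable_funM; apply: mpow => //; exact: measurable_funB.
Qed.

Let radial_ge0 b c s rho : 0 < rho -> (0 <= (((1 - u rho s) `^ b * u rho s `^ c) / rho)%:E)%E.
Proof. by move=> rho0; rewrite lee_fin divr_ge0 ?mulr_ge0 ?powR_ge0// ltW. Qed.

Let integral_radialZ (k b c s : R) : 0 <= k -> 0 < b -> 0 < c -> 0 < s ->
  (\int[mu]_(rho in `]0%R, +oo[) (k%:E * (((1 - u rho s) `^ b * u rho s `^ c) / rho)%:E) =
   (k * (((p - q) * euler_beta c (b + 1) + (r - q) * euler_beta (c + 1) b) / kappa))%:E)%E.
Proof.
move=> k0 b0 c0 s0; rewrite ge0_integralZl//.
- by rewrite integral_radial.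
- by apply: measurable_funTS; exact: mradial.
- by move=> rho /=; rewrite in_itv/= andbT; exact: radial_ge0.
Qed.

Let GH0 : 0 < H + G. Proof. exact: addr_gt0. Qed.
Let GHE : H + G = q * (lam + m) / kappa. Proof. by field; rewrite gt_eqF. Qed.
Let M0 : 0 < kappa + q * (lam + m). Proof. by apply: addr_gt0; [exact: kappa0|apply: mulr_gt0 => //; exact: addr_gt0]. Qed.

Lemma integral_extremal_p s : 0 < s ->
  (\int[mu]_(rho in `]0%R, +oo[) (Y rho s * (1 - u rho s) / rho)%:E =
   (s `^ (- H) * (p * m * extremal_constant))%:E)%E.
Proof.
move=> s0.
have G10 : 0 < G + 1 by rewrite addr_gt0.
transitivity (\int[mu]_(rho in `]0%R, +oo[) ((a1 `^ G * a2 `^ H * s `^ (- H))%:E *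
    (((1 - u rho s) `^ (G + 1) * u rho s `^ H) / rho)%:E))%E.
  apply: eq_integral => rho _; rewrite -EFinM; congr (_%:E).
  have /andP[u0 u1] := extremal_share_ge0_le1 lam m a1 a2 qp qr pqr rho s.
  have u1' : 0 <= 1 - u rho s by rewrite subr_ge0.
  by rewrite Yfactor// -(mulr_powRB1 u1' G10) addrK; ring.
rewrite integral_radialZ ?mulr_ge0 ?powR_ge0//; congr (_%:E).
rewrite (euler_betaSr H0 G10) (euler_betaSl H0 G10) (euler_betaSr H0 G0).
rewrite (euler_beta_sym H0 G0) /extremal_constant sumGH.
(* Since [(p - q) G + (r - q) H = q], the two beta values, reduced to [B(G, H)], combine into a
   single multiple in which [p], [q], [r] enter only through this sum. The companion integral gives
   [r] in the same way. *)
have E : (p - q) * (G + 1) + (r - q) * H = p.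
  have := kappa0; rewrite /scaling_exponent => k0.
  by field; rewrite gt_eqF.
move: (euler_beta G H) (a1 `^ G) (a2 `^ H) (s `^ (- H)) => x y z t.
have h1 := gt_eqF GH0; have h2 := gt_eqF M0.
have h3 : H + (G + 1) = (kappa + q * (lam + m)) / kappa.
  by rewrite addrA GHE; field; rewrite gt_eqF.
have GE : kappa * G = q * m by rewrite mulrC divfK// gt_eqF.
have GHE' := GHE; have k0 := kappa0.
move: (G) (H) GHE' E h1 h2 h3 GE => g h GHE' E h1 h2 h3 GE.
move: (kappa) k0 GHE' h2 h3 GE => k k0 GHE' h2 h3 GE.
have -> : y * z * t *
    (((p - q) * ((g + 1) / (h + (g + 1)) * (g / (h + g) * x)) +
      (r - q) * (h / (h + (g + 1)) * (g / (h + g) * x))) / k) =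
   y * z * t * (((p - q) * (g + 1) + (r - q) * h) * (g / (h + g) / (h + (g + 1)) * x) / k).
  by ring.
rewrite E GHE' h3; have -> : g = q * m / k by rewrite -GE mulrC mulKf// gt_eqF.
field.
by rewrite h2 !gt_eqF// addr_gt0.
Qed.

Lemma integral_extremal_r s : 0 < s ->
  (\int[mu]_(rho in `]0%R, +oo[) (Y rho s * u rho s / rho)%:E =
   (s `^ (- H) * (r * lam * extremal_constant))%:E)%E.
Proof.
move=> s0.
have H10 : 0 < H + 1 by rewrite addr_gt0.
transitivity (\int[mu]_(rho in `]0%R, +oo[) ((a1 `^ G * a2 `^ H * s `^ (- H))%:E *
    (((1 - u rho s) `^ G * u rho s `^ (H + 1)) / rho)%:E))%E.
  apply: eq_integral => rho _; rewrite -EFinM; congr (_%:E).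
  have /andP[u0 u1] := extremal_share_ge0_le1 lam m a1 a2 qp qr pqr rho s.
  by rewrite Yfactor// -(mulr_powRB1 u0 H10) addrK; ring.
rewrite integral_radialZ ?mulr_ge0 ?powR_ge0//; congr (_%:E).
rewrite (euler_betaSl H10 G0) (euler_betaSr H10 G0) (euler_betaSl H0 G0).
rewrite (euler_beta_sym H0 G0) /extremal_constant sumGH.
have E : (p - q) * G + (r - q) * (H + 1) = r.
  have := kappa0; rewrite /scaling_exponent => k0.
  by field; rewrite gt_eqF.
move: (euler_beta G H) (a1 `^ G) (a2 `^ H) (s `^ (- H)) => x y z t.
have h1 := gt_eqF GH0; have h2 := gt_eqF M0.
have h3 : H + 1 + G = (kappa + q * (lam + m)) / kappa.
  by rewrite addrAC GHE; field; rewrite gt_eqF.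
have GE : kappa * H = q * lam by rewrite mulrC divfK// gt_eqF.
have GHE' := GHE; have k0 := kappa0.
move: (G) (H) GHE' E h1 h2 h3 GE => g h GHE' E h1 h2 h3 GE.
move: (kappa) k0 GHE' h2 h3 GE => k k0 GHE' h2 h3 GE.
have -> : y * z * t *
    (((p - q) * (g / (h + 1 + g) * (h / (h + g) * x)) +
      (r - q) * ((h + 1) / (h + 1 + g) * (h / (h + g) * x))) / k) =
   y * z * t * (((p - q) * g + (r - q) * (h + 1)) * (h / (h + g) / (h + 1 + g) * x) / k).
  by ring.
rewrite E GHE' h3; have -> : h = q * lam / k by rewrite -GE mulrC mulKf// gt_eqF.
field.
by rewrite h2 !gt_eqF// addr_gt0.
Qed.

End extremal_integrals.

(** * Integrals of functions of the radius and of a homogeneous ratio *)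

Section homogeneous.
Context (R : realType) (n : nat).
Local Notation mu := (@lebesgue_measure R).
Local Notation leb := (lebesgue_tuple R).
Local Notation Rm := (measurableTypeR R).
Local Notation T := (n.+1.-tuple Rm).
Local Notation D := (orthant R n.+1).
Local Notation box := (@angle_box R n.+1).
Local Notation J := (@sphere_jacobian R n.+1).

Definition euclid (t : T) : R := (\sum_(i < n.+1) tnth t i ^+ 2) `^ 2^-1.
Definition coord_sum (e : R) (t : T) : R := \sum_(i < n.+1) tnth t i `^ e.
(** Homogeneous of degree zero: along a ray of the orthant it is constant and equals the sum in the
    denominator of the angular integral. *)
Definition shape_ratio (e : R) (t : T) : R := coord_sum e t / euclid t `^ e.
Definition sphere_sum (e : R) (w : n.-tuple Rm) : R :=
  \sum_(k < n.+1) @sphere_coord R n.+1 k w `^ e.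

Lemma measurable_euclid : measurable_fun setT euclid.
Proof.
apply: (@measurableT_comp _ _ _ _ _ _ (fun x : R => x `^ _)); first exact: measurable_powR.
by apply: measurable_sum => i; apply: measurable_funX; exact: measurable_tnth.
Qed.

Lemma measurable_coord_sum e : measurable_fun setT (coord_sum e).
Proof.
apply: measurable_sum => i.
apply: (@measurableT_comp _ _ _ _ _ _ (fun x : R => x `^ _)); first exact: measurable_powR.
exact: measurable_tnth.
Qed.

Lemma measurable_shape e : measurable_fun setT (shape_ratio e).
Proof.
apply: measurable_funM; first exact: measurable_coord_sum.
apply: (@measurableT_comp _ _ _ _ _ _ (@GRing.inv R)); first exact: measurable_inv.
apply: (@measurableT_comp _ _ _ _ _ _ (fun x : R => x `^ e)); first exact: measurable_powR.
exact: measurable_euclid.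
Qed.

Lemma measurable_sphere_sum e : measurable_fun setT (sphere_sum e).
Proof.
apply: measurable_sum => i.
apply: (@measurableT_comp _ _ _ _ _ _ (fun x : R => x `^ _)); first exact: measurable_powR.
rewrite (_ : @sphere_coord R n.+1 i = (fun t : T => tnth t i) \o @sphere_point R n); last first.
  by apply/funext => w /=; rewrite tnth_mktuple.
apply: measurableT_comp; [exact: measurable_tnth|exact: measurable_sphere_point].
Qed.

End homogeneous.

Lemma sphere_coord_sqr_sum (R : realType) n (w : n.-tuple (measurableTypeR R)) :
  \sum_(k < n.+1) @sphere_coord R n.+1 k w ^+ 2 = 1.
Proof.
rewrite (eq_bigr (fun k => tnth (sphere_point w) k ^+ 2)); last by move=> k _; rewrite tnth_mktuple.
elim: n w => [|n IHn] w.
  by rewrite big_ord_recl big_ord0 tnth_mktuple /sphere_coord !big_ord0 mulr1 expr1n addr0.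
have -> : w = cons_pair (thead w, [tuple of behead w]).
  by apply/val_inj; rewrite /cons_pair/=; case/tupleP: w => a w.
rewrite sphere_point_cons big_ord_recl tnth_cons0.
rewrite (eq_bigr (fun k => sin (thead w) ^+ 2 * tnth (sphere_point [tuple of behead w]) k ^+ 2)); last first.
  by move=> k _; rewrite tnth_consS tnth_mktuple exprMn.
by rewrite -mulr_sumr IHn mulr1 cos2Dsin2.
Qed.

Section homogeneous_integral.
Context (R : realType) (n : nat).
Local Notation mu := (@lebesgue_measure R).
Local Notation leb := (lebesgue_tuple R).
Local Notation Rm := (measurableTypeR R).
Local Notation T := (n.+1.-tuple Rm).
Local Notation D := (orthant R n.+1).
Local Notation box := (@angle_box R n.+1).
Local Notation J := (@sphere_jacobian R n.+1).

(** The squares of the coordinates sum to 1, so one of them is at least [1 / (n + 1)]. The uniform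
    lower bound makes the angular integrand bounded and its integral over the box finite. *)
Lemma sphere_sum_ge e (w : n.-tuple Rm) : 0 < e -> box w ->
  (n.+1%:R^-1) `^ (e / 2) <= sphere_sum e w.
Proof.
move=> e0 wB.
have [k kn] : exists k, n.+1%:R^-1 <= @sphere_coord R n.+1 k w ^+ 2.
  apply/existsP; rewrite -[X in is_true X]negbK negb_exists; apply/negP => /forallP H.
  have : \sum_(k < n.+1) @sphere_coord R n.+1 k w ^+ 2 < \sum_(k < n.+1) n.+1%:R^-1.
    apply: ltr_sum => [|k _]; first by apply/hasP; exists ord0; rewrite ?mem_index_enum.
    by rewrite ltNge; exact: H.
  by rewrite sphere_coord_sqr_sum sumr_const card_ord -[_ *+ _]mulr_natr mulVf ?pnatr_eq0// ltxx.
have c0 := @sphere_coord_ge0 R n.+1 k w wB.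
rewrite /sphere_sum (bigD1 k)//= -[leLHS]addr0 lerD//; last first.
  by apply: sumr_ge0 => i _; exact: powR_ge0.
have -> : sphere_coord k w `^ e = (sphere_coord k w ^+ 2) `^ (e / 2).
  by rewrite -powR_mulrn// -powRrM; congr (_ `^ _); field.
by apply: ler_powR_base => //; rewrite ?divr_ge0 ?(ltW e0) ?invr_ge0.
Qed.

Lemma sphere_sum_gt0 e (w : n.-tuple Rm) : 0 < e -> box w -> 0 < sphere_sum e w.
Proof.
by move=> e0 wB; apply: lt_le_trans (sphere_sum_ge e0 wB); rewrite powR_gt0 ?invr_gt0.
Qed.

Lemma euclid_sphere rho (w : n.-tuple Rm) : 0 < rho ->
  euclid (tuple_scale rho (sphere_point w)) = rho.
Proof.
move=> rho0; rewrite /euclid.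
rewrite (eq_bigr (fun k => rho ^+ 2 * @sphere_coord R n.+1 k w ^+ 2)); last first.
  by move=> k _; rewrite !tnth_mktuple exprMn.
by rewrite -mulr_sumr sphere_coord_sqr_sum mulr1 powR12_sqrt ?sqr_ge0// sqrtr_sqr gtr0_norm.
Qed.

Lemma shape_sphere e rho (w : n.-tuple Rm) : 0 < rho -> box w ->
  shape_ratio e (tuple_scale rho (sphere_point w)) = sphere_sum e w.
Proof.
move=> rho0 wB; rewrite /shape_ratio euclid_sphere// /coord_sum.
rewrite (eq_bigr (fun k => rho `^ e * @sphere_coord R n.+1 k w `^ e)); last first.
  move=> k _; rewrite !tnth_mktuple powRM ?(ltW rho0)//; exact: (@sphere_coord_ge0 R n.+1).
by rewrite -mulr_sumr mulrAC mulfV ?mul1r// gt_eqF// powR_gt0.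
Qed.

Lemma sphere_jacobian_le1 (w : n.-tuple Rm) : box w -> J w <= 1.
Proof.
move=> wB; apply: prodr_ile1 => i _.
have s0 := @sin_ge0_box R n.+1 w i wB.
by rewrite exprn_ge0 ?exprn_ile1 ?sin_le1.
Qed.

Let measure_subbox (a b : R) : a < b ->
  leb n [set t | forall i, tnth t i \in `[a, b]] = ((b - a) ^+ n)%:E.
Proof.
move=> ab; have := @lebesgue_tuple_box R n [tuple a | i < n] [tuple b | i < n].
under eq_set do under eq_forall do rewrite !tnth_mktuple.
move=> ->; last by move=> i; rewrite !tnth_mktuple ltW.
by under eq_bigr do rewrite !tnth_mktuple; rewrite prodr_const card_ord.
Qed.

Lemma angular_integrand_measurable e h :
  measurable_fun setT (fun w : n.-tuple Rm => (J w / sphere_sum e w `^ h)%:E).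
Proof.
apply/measurable_EFinP; apply: measurable_funM; first exact: (@measurable_sphere_jacobian R n.+1).
apply: (@measurableT_comp _ _ _ _ _ _ (@GRing.inv R)); first exact: measurable_inv.
apply: (@measurableT_comp _ _ _ _ _ _ (fun x : R => x `^ h)); first exact: measurable_powR.
exact: measurable_sphere_sum.
Qed.

Lemma EFin_angular_integral e h : 0 < e -> 0 < h ->
  ((angular_integral n.+1 e h)%:E =
   \int[leb n]_(w in box) (J w / sphere_sum e w `^ h)%:E)%E.
Proof.
move=> e0 h0; rewrite /angular_integral /Rintegral fineK//.
have g0 w : box w -> (0 <= (J w / sphere_sum e w `^ h)%:E)%E.
  by move=> wB; rewrite lee_fin divr_ge0 ?powR_ge0//; exact: (@sphere_jacobian_ge0 R n.+1).
rewrite ge0_fin_numE; last exact: integral_ge0.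
pose dl : R := (n.+1%:R^-1) `^ (e / 2).
have dl0 : 0 < dl by rewrite powR_gt0 ?invr_gt0.
have mB := @measurable_angle_box R n.+1.
apply: (@le_lt_trans _ _ (\int[leb n]_(w in box) (cst (dl `^ h)^-1%:E w))%E).
  apply: ge0_le_integral => //.
  - by apply: measurable_funTS; exact: angular_integrand_measurable.
  - move=> w wB; rewrite /cst lee_fin -[leRHS]mul1r.
    have s0 := sphere_sum_gt0 e0 wB.
    apply: ler_pM; rewrite ?invr_ge0 ?powR_ge0 ?sphere_jacobian_le1//.
      exact: (@sphere_jacobian_ge0 R n.+1).
    rewrite lef_pV2 ?posrE ?powR_gt0//.
    by apply: ler_powR_base; [exact: ltW|exact: ltW|exact: sphere_sum_ge].
have -> : box = [set t | forall i, tnth t i \in `[0, pi / 2]].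
  by apply/seteqP; split => t tB i; have := tB i; rewrite in_itv.
rewrite integral_cst; last first.
  have -> : [set t : n.-tuple Rm | forall i, tnth t i \in `[0, pi / 2]] = box; last by [].
  by apply/seteqP; split => t tB i; have := tB i; rewrite in_itv.
have := @measure_subbox 0 (pi / 2) _.
rewrite /= => ->; first by rewrite -EFinM ltry.
by rewrite divr_gt0// pi_gt0.
Qed.

Lemma angular_integral_gt0 e h : 0 < e -> 0 < h -> 0 < @angular_integral R n.+1 e h.
Proof.
move=> e0 h0; rewrite -lte_fin EFin_angular_integral//.
have pi0 := pi_gt0 R.
(* On this smaller box all sines are positive, hence so is the Jacobian, and its volume
   [(pi / 6) ^ n] is positive for every [n]. *)
pose B := [set t : n.-tuple Rm | forall i, tnth t i \in `[pi / 6, pi / 3]].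
have BB : B `<=` box.
  move=> t tB i; have := tB i; rewrite in_itv/= => /andP[a b].
  by apply/andP; split; [apply: le_trans a|apply: (le_trans b)]; clear -pi0; lra.
have mB : measurable B.
  exact: (@measurable_forall_tnth R n `[pi / 6, pi / 3]%classic).
have mb := @measurable_angle_box R n.+1.
apply: (@lt_le_trans _ _ (\int[leb n]_(w in B) (J w / sphere_sum e w `^ h)%:E)%E); last first.
  apply: ge0_subset_integral => //.
  - by apply: measurable_funTS; exact: angular_integrand_measurable.
  - move=> w wB; rewrite lee_fin divr_ge0 ?powR_ge0//; exact: (@sphere_jacobian_ge0 R n.+1).
apply: integral_gt0 => //.
- change (0 < leb n B)%E.
  have -> : leb n B = ((pi / 3 - pi / 6) ^+ n)%:E.
    by apply: measure_subbox; clear -pi0; lra.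
  by rewrite lte_fin exprn_gt0//; clear -pi0; lra.
- by apply: measurable_funTS; exact: angular_integrand_measurable.
- move=> w wB; rewrite lte_fin divr_gt0//; last by rewrite powR_gt0// sphere_sum_gt0//; exact: BB.
  apply: prodr_gt0 => i _; rewrite exprn_gt0// sin_gt0_pihalf//.
  have := wB i; rewrite in_itv/= => /andP[a b].
  by apply/andP; split; [apply: lt_le_trans a|apply: (le_lt_trans b)]; clear -pi0; lra.
Qed.

(** With [d = n + 1], the factor [rho ^ (-d)] reduces the radial Jacobian [rho ^ (d - 1)] to
    [1 / rho]. The radial integral then depends on the direction only through [s ^ (- h)], which
    produces the power [h] in the angular integral. *)
Lemma integral_homogeneous (F : R -> R -> R) (e h c : R) : 0 < e -> 0 < h -> 0 <= c ->
  (forall x y, 0 <= F x y) ->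
  measurable_fun setT (fun t : T => F (euclid t) (shape_ratio e t)) ->
  (forall s : R, (0 < s)%R -> (\int[mu]_(rho in `]0%R, +oo[) (F rho s / rho)%:E = (s `^ (- h) * c)%:E)%E) ->
  (\int[leb n.+1]_(t in D) (euclid t `^ (- n.+1%:R) * F (euclid t) (shape_ratio e t))%:E =
   (c * angular_integral n.+1 e h)%:E)%E.
Proof.
move=> e0 h0 c0 F0 mF FE.
rewrite (@ge0_polar_coordinates R n (fun t : T => (euclid t `^ (- n.+1%:R) * F (euclid t) (shape_ratio e t))%:E)); last 2 first.
- apply/measurable_EFinP; apply: measurable_funM => //.
  apply: (@measurableT_comp _ _ _ _ _ _ (fun x : R => x `^ _)); first exact: measurable_powR.
  exact: measurable_euclid.
- by move=> t; rewrite lee_fin mulr_ge0 ?powR_ge0.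
transitivity (\int[leb n]_(w in box) (c%:E * (J w / sphere_sum e w `^ h)%:E))%E; last first.
  rewrite ge0_integralZl ?lee_fin//.
  - by rewrite -EFin_angular_integral.
  - exact: (@measurable_angle_box R n.+1).
  - by apply: measurable_funTS; exact: angular_integrand_measurable.
  - move=> w wB; rewrite lee_fin divr_ge0 ?powR_ge0//; exact: (@sphere_jacobian_ge0 R n.+1).
apply: eq_integral => w /set_mem wB.
have s0 := sphere_sum_gt0 e0 wB.
transitivity ((J w)%:E * \int[mu]_(rho in `]0%R, +oo[) (F rho (sphere_sum e w) / rho)%:E)%E.
  congr (_ * _)%E; apply: eq_integral => rho; rewrite inE/= in_itv/= andbT => rho0.
  rewrite euclid_sphere// shape_sphere// -EFinM; congr (_%:E).
  rewrite powRN -powR_mulrn ?(ltW rho0)// mulrAC mulrC; congr (_ * _).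
  rewrite powR_mulrn ?(ltW rho0)// powR_mulrn ?(ltW rho0)// exprSr.
  by field; rewrite expf_neq0 gt_eqF.
rewrite FE// -!EFinM; congr (_%:E); rewrite powRN.
by move: (J w) (_ `^ h) => x y; ring.
Qed.

End homogeneous_integral.

(** * The integrated bound and the three integrals of the extremal function *)

Section orthant_extremal.
Context (R : realType) (n : nat).
Local Notation leb := (lebesgue_tuple R).
Local Notation Rm := (measurableTypeR R).
Local Notation T := (n.+1.-tuple Rm).
Local Notation D := (orthant R n.+1).
Local Notation dim := (n.+1%:R : R).

Variables (p q r lam m : R).
Hypotheses (q1 : 1 <= q) (qp : q <= p) (qr : q <= r) (pqr : 0 < (p - q) + (r - q))
  (lam0 : 0 < lam) (m0 : 0 < m).

Local Notation kappa := (scaling_exponent p q r lam m).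
Local Notation G := (q * m / kappa).
Local Notation H := (q * lam / kappa).
Local Notation M := (p * m + r * lam).
Local Notation e := (dim * (r - 1) + m).

Let q0 : 0 < q. Proof. exact: lt_le_trans q1. Qed.
Let p0 : 0 < p. Proof. exact: lt_le_trans qp. Qed.
Let r0 : 0 < r. Proof. exact: lt_le_trans qr. Qed.
Let M0 : 0 < M. Proof. by rewrite addr_gt0 ?mulr_gt0. Qed.
Let kappa0 : 0 < kappa. Proof. exact: scaling_exponent_gt0. Qed.
Let G0 : 0 < G. Proof. by rewrite divr_gt0// mulr_gt0. Qed.
Let H0 : 0 < H. Proof. by rewrite divr_gt0// mulr_gt0. Qed.
Let e0 : 0 < e.
Proof. by rewrite ltr_wpDl// mulr_ge0// subr_ge0 (le_trans q1). Qed.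

(** The base of the power [1/q - alpha - beta] in the constant of the theorem. It is also the
    integral of [rho ^ (-d) Y] over the orthant for [a1 = a2 = 1]. *)
Definition carlson_integral : R :=
  @angular_integral R n.+1 e H / (lam + m) * euler_beta G H.

Lemma carlson_integral_gt0 : 0 < carlson_integral.
Proof.
by rewrite mulr_gt0 ?euler_beta_gt0// divr_gt0 ?addr_gt0// angular_integral_gt0.
Qed.

(** The origin, written as a degenerate box so that the box formula gives its measure. On the rest
    of the orthant the norm and the ratio are positive, as the pointwise bound requires. *)
Let null : set T := [set t | forall i, tnth t i \in `[0, 0]].

Let measurable_null : measurable null.
Proof. exact: (@measurable_forall_tnth R n.+1 `[0, 0]%classic). Qed.

Let null0 : leb n.+1 null = 0%E.
Proof.
have := @lebesgue_tuple_box R n.+1 [tuple 0 | i < n.+1] [tuple 0 | i < n.+1].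
rewrite (_ : [set t | _] = null); last first.
  by apply/seteqP; split => t H' i; have := H' i; rewrite !tnth_mktuple.
move=> ->; last by move=> i; rewrite !tnth_mktuple.
by rewrite big_ord_recl !tnth_mktuple subrr mul0r.
Qed.

Let pos_coord (t : T) : D t -> ~ null t -> exists i, 0 < tnth t i.
Proof.
move=> tD tN; apply: contrapT => tp; apply: tN => i; rewrite in_itv/= tD/= leNgt.
by apply/negP => ti; apply: tp; exists i.
Qed.

Let euclid_gt0 (t : T) : D t -> ~ null t -> 0 < euclid t.
Proof.
move=> tD /(pos_coord tD)[i ti]; rewrite powR_gt0// (bigD1 i)//= ltr_pwDl ?exprn_gt0//.
by apply: sumr_ge0 => j _; exact: sqr_ge0.
Qed.

Let coord_sum_gt0 (t : T) : D t -> ~ null t -> 0 < coord_sum e t.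
Proof.
move=> tD /(pos_coord tD)[i ti]; rewrite /coord_sum (bigD1 i)//= ltr_pwDl ?powR_gt0//.
by apply: sumr_ge0 => j _; exact: powR_ge0.
Qed.

Let shape_gt0 (t : T) : D t -> ~ null t -> 0 < shape_ratio e t.
Proof.
move=> tD tN; apply: divr_gt0; first exact: coord_sum_gt0.
by apply: powR_gt0; exact: euclid_gt0.
Qed.

Lemma ge0_le_orthant_integral (N : set T) (f g : T -> R) :
  measurable N -> leb n.+1 N = 0%E ->
  (forall t, 0 <= f t) -> (forall t, 0 <= g t) ->
  (forall t, D t -> ~ N t -> 0 < euclid t -> 0 < shape_ratio e t -> f t <= g t) ->
  (\int[leb n.+1]_(t in D) (f t)%:E <= \int[leb n.+1]_(t in D) (g t)%:E)%E.
Proof.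
move=> mN N0 f0 g0 fg; rewrite integral_mkcond [leRHS]integral_mkcond.
apply: (@ge0_le_integral_off_null _ _ _ _ (null `|` N)).
- exact: measurableU.
- have h : (leb n.+1 (null `|` N) <= leb n.+1 null + leb n.+1 N)%E by exact: measureU2.
  by rewrite null0 N0 adde0 in h; apply/eqP; rewrite eq_le h measure_ge0.
- by move=> t; apply: erestrict_ge0 => {}t _; rewrite lee_fin.
- by move=> t; apply: erestrict_ge0 => {}t _; rewrite lee_fin.
move=> t /not_orP[tN tN']; rewrite !patchE; case: ifPn => // /set_mem tD.
by rewrite lee_fin; apply: fg => //; [exact: euclid_gt0|exact: shape_gt0].
Qed.

Lemma ge0_eq_orthant_integral (N : set T) (f g : T -> R) :
  measurable N -> leb n.+1 N = 0%E ->
  (forall t, 0 <= f t) -> (forall t, 0 <= g t) ->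
  (forall t, D t -> ~ N t -> 0 < euclid t -> 0 < shape_ratio e t -> f t = g t) ->
  (\int[leb n.+1]_(t in D) (f t)%:E = \int[leb n.+1]_(t in D) (g t)%:E)%E.
Proof.
move=> mN N0 f0 g0 fg; apply/eqP; rewrite eq_le; apply/andP; split;
  by apply: (@ge0_le_orthant_integral N) => // t tD tN t1 t2; rewrite fg.
Qed.

Section fixed_multipliers.
Variables (a1 a2 : R).
Hypotheses (a10 : 0 < a1) (a20 : 0 < a2).
Local Notation u t := (extremal_share p q r lam m a1 a2 (euclid t) (shape_ratio e t)).
Local Notation Y t := (extremal_pow p q r lam m a1 a2 (euclid t) (shape_ratio e t)).
Local Notation mass := (a1 `^ G * a2 `^ H * carlson_integral).

Let mu_ : measurable_fun setT (fun t : T => u t).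
Proof. by apply: measurable_extremal_share => //; [exact: measurable_euclid|exact: measurable_shape]. Qed.

Let mY : measurable_fun setT (fun t : T => Y t).
Proof. by apply: measurable_extremal_pow => //; [exact: measurable_euclid|exact: measurable_shape]. Qed.

Let u01 (t : T) : 0 <= u t <= 1. Proof. exact: extremal_share_ge0_le1. Qed.
Let Y0 (t : T) : 0 <= Y t. Proof. exact: extremal_pow_ge0. Qed.

Let extremal_constant_ge0 : 0 <= extremal_constant p q r lam m a1 a2.
Proof.
apply: mulr_ge0; last by rewrite ltW// euler_beta_gt0.
apply: divr_ge0; first by rewrite mulr_ge0 ?powR_ge0.
by apply: mulr_ge0; [rewrite ltW// addr_gt0|exact: ltW].
Qed.

Lemma integral_orthant_p :
  (\int[leb n.+1]_(t in D) (euclid t `^ (- dim) * (Y t * (1 - u t)))%:E =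
   (p * m / M * mass)%:E)%E.
Proof.
pose F rho s := extremal_pow p q r lam m a1 a2 rho s * (1 - extremal_share p q r lam m a1 a2 rho s).
rewrite (@integral_homogeneous R n F e H (p * m * extremal_constant p q r lam m a1 a2)) //.
- rewrite /extremal_constant /carlson_integral; congr (_%:E).
  move: (angular_integral _ _ _) (euler_beta _ _) (a1 `^ G) (a2 `^ H) => x y z t.
  by field; rewrite (gt_eqF M0) (gt_eqF (addr_gt0 lam0 m0)).
- by rewrite mulr_ge0 ?extremal_constant_ge0// mulr_ge0// ltW.
- move=> x y; apply: mulr_ge0; first exact: extremal_pow_ge0.
  by rewrite subr_ge0; have /andP[] := extremal_share_ge0_le1 lam m a1 a2 qp qr pqr x y.
- by apply: measurable_funM => //; exact: measurable_funB.
- by move=> s s0; exact: integral_extremal_p.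
Qed.

Lemma integral_orthant_r :
  (\int[leb n.+1]_(t in D) (euclid t `^ (- dim) * (Y t * u t))%:E =
   (r * lam / M * mass)%:E)%E.
Proof.
pose F rho s := extremal_pow p q r lam m a1 a2 rho s * extremal_share p q r lam m a1 a2 rho s.
rewrite (@integral_homogeneous R n F e H (r * lam * extremal_constant p q r lam m a1 a2)) //.
- rewrite /extremal_constant /carlson_integral; congr (_%:E).
  move: (angular_integral _ _ _) (euler_beta _ _) (a1 `^ G) (a2 `^ H) => x y z t.
  by field; rewrite (gt_eqF M0) (gt_eqF (addr_gt0 lam0 m0)).
- by rewrite mulr_ge0 ?extremal_constant_ge0// mulr_ge0// ltW.
- move=> x y; apply: mulr_ge0; first exact: extremal_pow_ge0.
  by have /andP[] := extremal_share_ge0_le1 lam m a1 a2 qp qr pqr x y.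
- by apply: measurable_funM.
- by move=> s s0; exact: integral_extremal_r.
Qed.

Let lin (k l : R) (f g : T -> R) : 0 <= k -> 0 <= l ->
  measurable_fun setT f -> measurable_fun setT g -> (forall t, 0 <= f t) -> (forall t, 0 <= g t) ->
  (\int[leb n.+1]_(t in D) (k * f t + l * g t)%:E =
   k%:E * \int[leb n.+1]_(t in D) (f t)%:E + l%:E * \int[leb n.+1]_(t in D) (g t)%:E)%E.
Proof.
move=> k0 l0 mf mg f0 g0; have mD := @measurable_orthant R n.+1.
have Z (c : R) (h : T -> R) : 0 <= c -> measurable_fun setT h -> (forall t, 0 <= h t) ->
    (\int[leb n.+1]_(t in D) (c * h t)%:E = c%:E * \int[leb n.+1]_(t in D) (h t)%:E)%E.
  move=> c0 mh h0; have mh' : measurable_fun D (EFin \o h).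
    by apply: measurable_funTS; exact/measurable_EFinP.
  by apply: (@ge0_integralZl _ _ R (leb n.+1) D mD _ mh' c%:E) => [t _|]; rewrite lee_fin.
have mM (c : R) (h : T -> R) : measurable_fun setT h -> measurable_fun D (fun t => (c * h t)%:E).
  by move=> mh; apply: measurable_funTS; apply/measurable_EFinP; exact: measurable_funM.
rewrite -Z// -Z//.
under eq_integral do rewrite EFinD.
by apply: ge0_integralD => //; solve [exact: mM | by move=> t _; rewrite lee_fin mulr_ge0].
Qed.

Let mpow (h : T -> R) c : measurable_fun setT h -> measurable_fun setT (fun t => h t `^ c).
Proof.
move=> mh; apply: (@measurableT_comp _ _ _ _ _ _ (fun x : R => x `^ c)) => //.
Qed.

Let me : measurable_fun setT (@euclid R n). Proof. exact: measurable_euclid. Qed.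

Let coord_sum_ge0 c (t : T) : 0 <= coord_sum c t.
Proof. by apply: sumr_ge0 => i _; exact: powR_ge0. Qed.

Let coord_sumE (t : T) : 0 < euclid t -> coord_sum e t = shape_ratio e t * euclid t `^ e.
Proof. by move=> t0; rewrite /shape_ratio divfK// gt_eqF// powR_gt0. Qed.

Let rD (rho : R) a b : 0 < rho -> rho `^ a * rho `^ b = rho `^ (a + b).
Proof. by move=> rho0; rewrite powRD// (gt_eqF rho0) implybT. Qed.

Let powM (x y a c : R) : 0 <= y -> (x `^ a * y) `^ c = x `^ (a * c) * y `^ c.
Proof. by move=> y0; rewrite powRM ?powR_ge0// powRrM. Qed.

Let uC0 (t : T) : 0 <= 1 - u t.
Proof. by rewrite subr_ge0; have /andP[] := u01 t. Qed.

Let g30 (t : T) : 0 <= euclid t `^ (- dim) * (Y t * (1 - u t)).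
Proof. by rewrite mulr_ge0 ?powR_ge0// mulr_ge0. Qed.

Let g40 (t : T) : 0 <= euclid t `^ (- dim) * (Y t * u t).
Proof. by rewrite mulr_ge0 ?powR_ge0// mulr_ge0//; have /andP[] := u01 t. Qed.

Let mg3 : measurable_fun setT (fun t : T => euclid t `^ (- dim) * (Y t * (1 - u t))).
Proof.
by apply: measurable_funM; [exact: mpow|apply: measurable_funM => //; exact: measurable_funB].
Qed.

Let mg4 : measurable_fun setT (fun t : T => euclid t `^ (- dim) * (Y t * u t)).
Proof. by apply: measurable_funM; [exact: mpow|exact: measurable_funM]. Qed.

(** The pointwise bound at [y = rho ^ d xi], multiplied by [rho ^ (-d)] and integrated. The
    exponents of the radius become [d (q - 1)], [d p - lam - d] and [d (r - 1) + m], which are those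
    of the weights raised to the powers [q], [p], [r]. *)
Lemma orthant_bound (xi : T -> R) : measurable_fun setT xi -> (forall t, 0 <= xi t) ->
  (\int[leb n.+1]_(t in D) (euclid t `^ (dim * (q - 1)) * xi t `^ q)%:E <=
   (q / (p * a1))%:E * \int[leb n.+1]_(t in D) (euclid t `^ (dim * p - lam - dim) * xi t `^ p)%:E +
   (q / (r * a2))%:E * \int[leb n.+1]_(t in D) (coord_sum e t * xi t `^ r)%:E +
   ((1 - q / p) * (p * m / M * mass) + (1 - q / r) * (r * lam / M * mass))%:E)%E.
Proof.
move=> mxi xi0.
pose g1 (t : T) := euclid t `^ (dim * p - lam - dim) * xi t `^ p.
pose g2 (t : T) := coord_sum e t * xi t `^ r.
pose g3 (t : T) := euclid t `^ (- dim) * (Y t * (1 - u t)).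
pose g4 (t : T) := euclid t `^ (- dim) * (Y t * u t).
have g10 t : 0 <= g1 t by rewrite mulr_ge0 ?powR_ge0.
have g20 t : 0 <= g2 t by rewrite mulr_ge0 ?powR_ge0.
have mg1 : measurable_fun setT g1 by apply: measurable_funM; exact: mpow.
have mg2 : measurable_fun setT g2.
  by apply: measurable_funM; [exact: measurable_coord_sum|exact: mpow].
have k1 : 0 <= q / (p * a1) by rewrite divr_ge0 ?mulr_ge0 ?ltW.
have k2 : 0 <= q / (r * a2) by rewrite divr_ge0 ?mulr_ge0 ?ltW.
have k3 : 0 <= 1 - q / p by rewrite subr_ge0 ler_pdivrMr// mul1r.
have k4 : 0 <= 1 - q / r by rewrite subr_ge0 ler_pdivrMr// mul1r.
rewrite EFinD !(EFinM (1 - _)) -integral_orthant_p -integral_orthant_r.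
rewrite -!lin//.
pose g12 (t : T) := q / (p * a1) * g1 t + q / (r * a2) * g2 t.
pose g34 (t : T) := (1 - q / p) * g3 t + (1 - q / r) * g4 t.
have g120 t : 0 <= g12 t by rewrite addr_ge0// mulr_ge0.
have g340 t : 0 <= g34 t by apply: addr_ge0; [exact: mulr_ge0 k3 (g30 t)|exact: mulr_ge0 k4 (g40 t)].
have mg12 : measurable_fun setT g12 by apply: measurable_funD; exact: measurable_funM.
have mg34 : measurable_fun setT g34 by apply: measurable_funD; exact: measurable_funM.
have E := lin ler01 ler01 mg12 mg34 g120 g340.
rewrite !mul1e in E; rewrite -E.
apply: (ge0_le_orthant_integral measurable0 (measure0 _)).
- by move=> t; rewrite mulr_ge0 ?powR_ge0.
- by move=> t; rewrite !mul1r addr_ge0.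
move=> t tD _ rho0 s0; rewrite !mul1r.
have x0 := xi0 t.
have y0 : 0 <= euclid t `^ dim * xi t by rewrite mulr_ge0 ?powR_ge0.
have := extremal_bound q0 qp qr pqr lam0 m0 a10 a20 rho0 s0 y0.
have rd : 0 < euclid t `^ (- dim) by rewrite powR_gt0.
rewrite -(ler_pM2l rd).
have pw c : (euclid t `^ dim * xi t) `^ c = euclid t `^ (dim * c) * xi t `^ c.
  exact: powM.
have rDt (a b : R) : euclid t `^ a * euclid t `^ b = euclid t `^ (a + b) by exact: rD.
rewrite !pw.
have -> : euclid t `^ (- dim) * (euclid t `^ (dim * q) * xi t `^ q) =
    euclid t `^ (dim * (q - 1)) * xi t `^ q.
  by rewrite mulrA rDt; congr (_ `^ _ * _); ring.
move=> /le_trans; apply; rewrite le_eqVlt; apply/orP; left; apply/eqP.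
rewrite [LHS]mulrDr [X in X + _ = _]mulrDr; congr (_ + _ + _).
- rewrite mulrCA; congr (_ * _).
  rewrite /g1 !mulrA !rDt; congr (_ `^ _ * _); ring.
- rewrite mulrCA; congr (_ * _).
  have -> : euclid t `^ (- dim) * (euclid t `^ m * shape_ratio e t * (euclid t `^ (dim * r) * xi t `^ r)) =
      (euclid t `^ (- dim) * euclid t `^ m * euclid t `^ (dim * r)) * (shape_ratio e t * xi t `^ r) by ring.
  rewrite !rDt /g2 coord_sumE// (_ : - dim + m + dim * r = e); last by ring.
  by ring.
- by rewrite /g34 /g3 /g4; ring.
Qed.

(** Chosen so that [rho ^ d xi] equals [Y ^ (1/q)], the point of equality in the pointwise bound. *)
Definition extremal_fun (t : T) : R := euclid t `^ (- dim) * Y t `^ q^-1.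

Let xs0 t : 0 <= extremal_fun t. Proof. by rewrite mulr_ge0 ?powR_ge0. Qed.

Lemma measurable_extremal_fun : measurable_fun setT extremal_fun.
Proof. by apply: measurable_funM; exact: mpow. Qed.

Let xsE (t : T) c : extremal_fun t `^ c = euclid t `^ (- dim * c) * Y t `^ (c / q).
Proof. by rewrite /extremal_fun powM ?powR_ge0// -[(Y t `^ q^-1) `^ c]powRrM (mulrC q^-1). Qed.

Lemma extremal_fun_q :
  (\int[leb n.+1]_(t in D) (euclid t `^ (dim * (q - 1)) * extremal_fun t `^ q)%:E = mass%:E)%E.
Proof.
transitivity (\int[leb n.+1]_(t in D) (1 * (euclid t `^ (- dim) * (Y t * (1 - u t))) +
   1 * (euclid t `^ (- dim) * (Y t * u t)))%:E)%E.
  apply: (ge0_eq_orthant_integral measurable0 (measure0 _)).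
  - by move=> t; rewrite mulr_ge0 ?powR_ge0.
  - by move=> t; rewrite !mul1r addr_ge0.
  move=> t tD _ rho0 s0; rewrite xsE divff ?gt_eqF// powRr1//.
  rewrite mulrA rD// (_ : dim * (q - 1) + - dim * q = - dim); last by ring.
  by move: (euclid t `^ _) (Y t) => a b; ring.
rewrite lin// integral_orthant_p integral_orthant_r !mul1e -EFinD; congr (_%:E).
by move: mass => x; field; rewrite gt_eqF.
Qed.

(** The Euler-Lagrange relation turns the integrand into [a1] times the part of [rho ^ (-d) Y] with
    factor [1 - u], already integrated above. *)
Lemma extremal_fun_p :
  (\int[leb n.+1]_(t in D) (euclid t `^ (dim * p - lam - dim) * extremal_fun t `^ p)%:E =
   (a1 * (p * m / M * mass))%:E)%E.
Proof.
transitivity (\int[leb n.+1]_(t in D) (a1 * (euclid t `^ (- dim) * (Y t * (1 - u t))) +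
   0 * (euclid t `^ (- dim) * (Y t * u t)))%:E)%E.
  apply: (ge0_eq_orthant_integral measurable0 (measure0 _)).
  - by move=> t; rewrite mulr_ge0 ?powR_ge0.
  - by move=> t; rewrite mul0r addr0 mulr_ge0// ltW.
  move=> t tD _ rho0 s0; rewrite xsE mul0r addr0.
  rewrite mulrA rD// (_ : _ + _ = - dim + - lam); last by ring.
  rewrite -rD// -mulrA extremal_powE_p//.
  by move: (euclid t `^ _) (Y t) => a b; ring.
have a1' := ltW a10.
rewrite lin// integral_orthant_p -EFinM mul0e adde0//.
Qed.

Lemma extremal_fun_r :
  (\int[leb n.+1]_(t in D) (coord_sum e t * extremal_fun t `^ r)%:E =
   (a2 * (r * lam / M * mass))%:E)%E.
Proof.
transitivity (\int[leb n.+1]_(t in D) (0 * (euclid t `^ (- dim) * (Y t * (1 - u t))) +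
   a2 * (euclid t `^ (- dim) * (Y t * u t)))%:E)%E.
  apply: (ge0_eq_orthant_integral measurable0 (measure0 _)).
  - by move=> t; rewrite mulr_ge0 ?powR_ge0.
  - by move=> t; rewrite mul0r add0r mulr_ge0// ltW.
  move=> t tD _ rho0 s0; rewrite xsE mul0r add0r coord_sumE//.
  have -> : shape_ratio e t * euclid t `^ e * (euclid t `^ (- dim * r) * Y t `^ (r / q)) =
      (euclid t `^ e * euclid t `^ (- dim * r)) * (shape_ratio e t * Y t `^ (r / q)) by ring.
  rewrite rD// (_ : _ + _ = - dim + m); last by ring.
  rewrite -rD// -mulrA (mulrA (euclid t `^ m)) extremal_powE_r//.
  by move: (euclid t `^ _) (Y t) => a b; ring.
have a2' := ltW a20.
rewrite lin// integral_orthant_r mul0e add0e//.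
Qed.

End fixed_multipliers.
End orthant_extremal.

(** * The multiplicative inequality and its extremal function *)

Section carlson_bound.
Context (R : realType) (n : nat).
Local Notation leb := (lebesgue_tuple R).
Local Notation Rm := (measurableTypeR R).
Local Notation T := (n.+1.-tuple Rm).
Local Notation D := (orthant R n.+1).
Local Notation dim := (n.+1%:R : R).

Variables (p q r lam m : R).
Hypotheses (q1 : 1 <= q) (qp : q <= p) (qr : q <= r) (pqr : 0 < (p - q) + (r - q))
  (lam0 : 0 < lam) (m0 : 0 < m).

Local Notation kappa := (scaling_exponent p q r lam m).
Local Notation G := (q * m / kappa).
Local Notation H := (q * lam / kappa).
Local Notation M := (p * m + r * lam).
Local Notation e := (dim * (r - 1) + m).
Local Notation alpha := (m / M).
Local Notation beta := (lam / M).
Local Notation gamma := (kappa / (q * M)).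
Local Notation K := (carlson_integral n p q r lam m).

Let q0 : 0 < q. Proof. exact: lt_le_trans q1. Qed.
Let p0 : 0 < p. Proof. exact: lt_le_trans qp. Qed.
Let r0 : 0 < r. Proof. exact: lt_le_trans qr. Qed.
Let M0 : 0 < M. Proof. by rewrite addr_gt0 ?mulr_gt0. Qed.
Let kappa0 : 0 < kappa. Proof. exact: scaling_exponent_gt0. Qed.
Let K0 : 0 < K. Proof. exact: carlson_integral_gt0. Qed.

(** Its power [q] is the least value over [a1, a2 > 0] of the right side of [orthant_bound] when the
    two integrals there equal [U] and [V]. *)
Definition carlson_value (U V : R) : R :=
  K `^ gamma * (U / (p * alpha)) `^ alpha * (V / (r * beta)) `^ beta.

Lemma carlson_bound (xi : T -> R) (U V : R) : 0 < U -> 0 < V ->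
  measurable_fun setT xi -> (forall t, 0 <= xi t) ->
  (\int[leb n.+1]_(t in D) (euclid t `^ (dim * p - lam - dim) * xi t `^ p)%:E <= U%:E)%E ->
  (\int[leb n.+1]_(t in D) (coord_sum e t * xi t `^ r)%:E <= V%:E)%E ->
  (\int[leb n.+1]_(t in D) (euclid t `^ (dim * (q - 1)) * xi t `^ q)%:E <=
   (carlson_value U V `^ q)%:E)%E.
Proof.
move=> U0 V0 mxi xi0 leU leV.
set Q := carlson_value U V `^ q.
have al0 : 0 < p * alpha by rewrite mulr_gt0 ?divr_gt0.
have be0 : 0 < r * beta by rewrite mulr_gt0 ?divr_gt0.
have X0 : 0 < U / (p * alpha) by rewrite divr_gt0.
have Y0 : 0 < V / (r * beta) by rewrite divr_gt0.
have Q0 : 0 < Q by rewrite powR_gt0// !mulr_gt0// powR_gt0.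
(* Stationarity of the right side of [orthant_bound] in [a1] and [a2] gives these values with
   [Q = a1^G a2^H K], an equation whose solution is the present [Q]. The three terms are then
   [q alpha Q], [q beta Q] and [q gamma Q], with sum [Q]. *)
pose a1 := U / (p * alpha) / Q; pose a2 := V / (r * beta) / Q.
have a10 : 0 < a1 by rewrite divr_gt0.
have a20 : 0 < a2 by rewrite divr_gt0.
have massE : a1 `^ G * a2 `^ H * K = Q.
  have QM : Q `^ (M / kappa) = K * (U / (p * alpha)) `^ G * (V / (r * beta)) `^ H.
    rewrite /Q -powRrM /carlson_value.
    move: (U / _) (V / _) X0 Y0 => x y x0 y0.
    rewrite powRM ?mulr_ge0 ?powR_ge0// powRM ?powR_ge0// -!powRrM.
    rewrite (_ : gamma * _ = 1); last by field; rewrite !gt_eqF.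
    rewrite (_ : alpha * _ = G); last by field; rewrite !gt_eqF.
    rewrite (_ : beta * _ = H); last by field; rewrite !gt_eqF.
    by rewrite powRr1// ltW.
  have E1 : (U / (p * alpha)) `^ G = a1 `^ G * Q `^ G.
    by rewrite -powRM ?ltW// /a1 divfK// gt_eqF.
  have E2 : (V / (r * beta)) `^ H = a2 `^ H * Q `^ H.
    by rewrite -powRM ?ltW// /a2 divfK// gt_eqF.
  (* Because [M = kappa + q (lam + m)], the exponent [M / kappa] is [1 + G + H]. *)
  have E3 : Q `^ (M / kappa) = Q * (Q `^ G * Q `^ H).
    rewrite -powRD ?(gt_eqF Q0) ?implybT// -{2}[Q]powRr1 ?(ltW Q0)//.
    rewrite -powRD ?(gt_eqF Q0) ?implybT//; congr (_ `^ _).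
    rewrite -[X in X / _](_ : kappa + q * (lam + m) = M); last by rewrite /scaling_exponent; ring.
    by field; rewrite gt_eqF.
  have nz : Q `^ G * Q `^ H != 0 by rewrite mulf_neq0// gt_eqF// powR_gt0.
  apply: (mulIf nz); rewrite -E3 QM E1 E2.
  by move: (a1 `^ G) (a2 `^ H) (Q `^ G) (Q `^ H) K => x1 x2 x3 x4 x5; ring.
apply: (le_trans (orthant_bound q1 qp qr pqr lam0 m0 a10 a20 mxi xi0)).
rewrite massE.
apply: (@le_trans _ _ ((q / (p * a1))%:E * U%:E + (q / (r * a2))%:E * V%:E +
  ((1 - q / p) * (p * m / M * Q) + (1 - q / r) * (r * lam / M * Q))%:E)%E).
  have c1 : 0 <= q / (p * a1) by apply/ltW/divr_gt0 => //; exact: mulr_gt0 p0 a10.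
  have c2 : 0 <= q / (r * a2) by apply/ltW/divr_gt0 => //; exact: mulr_gt0 r0 a20.
  by apply: leeD => //; apply: leeD; rewrite lee_wpmul2l// ?lee_fin.
rewrite -!EFinM -!EFinD lee_fin /a1 /a2 le_eqVlt; apply/orP; left; apply/eqP.
move: Q Q0 {massE a1 a2 a10 a20} => Q Q0.
by field; rewrite !gt_eqF.
Qed.

End carlson_bound.

(** * Norms of complex-valued functions and the case of vanishing norms *)

Lemma normc_ge0 (R : rcfType) (z : R[i]) : 0 <= Normc.normc z.
Proof. by case: z => a b; exact: sqrtr_ge0. Qed.

Lemma normcZ (R : rcfType) (a : R) (z : R[i]) : 0 <= a ->
  Normc.normc (a%:C%C * z) = a * Normc.normc z.
Proof.
move=> a0; rewrite Normc.normcM; congr (_ * _).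
by rewrite /Normc.normc/= expr0n/= addr0 sqrtr_sqr ger0_norm.
Qed.

Lemma Lp_normE (R : realType) d (D : set (d.-tuple (measurableTypeR R))) (s : R) f : 0 < s ->
  Lp_norm D s f =
  ((\int[lebesgue_tuple R d]_(t in D) (Normc.normc (f t) `^ s)%:E) `^ s^-1)%E.
Proof.
move=> s0; rewrite /Lp_norm unlock; congr (_ `^ _)%E.
rewrite [RHS]integral_mkcond; apply: eq_integral => t _; rewrite !patchE.
case: ifPn => _; last by rewrite abse0 poweR0r// gt_eqF.
rewrite abse_EFin ger0_norm ?normc_ge0// poweR_EFin.
Qed.

Lemma powR_limit0 (R : realType) (L k s : R) : 0 < s -> 0 < k ->
  (forall x, 0 < x -> L <= k * x `^ s) -> L <= 0.
Proof.
move=> s0 k0 H; rewrite leNgt; apply/negP => L0.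
have e0 : 0 < L / (2 * k) by rewrite divr_gt0// mulr_gt0.
(* At this point the right side is [L / 2], which contradicts [L > 0]. *)
have := H ((L / (2 * k)) `^ s^-1) (powR_gt0 _ e0).
rewrite -powRrM mulVf ?gt_eqF// powRr1 ?(ltW e0)//.
rewrite (_ : k * _ = L / 2); last by field; rewrite gt_eqF.
by clear -L0; lra.
Qed.

(** Removes the positivity needed for the multipliers when a norm is zero. A vanishing variable is
    sent to 0 while the other stays fixed, at [b + 1] when [a = 0] so that it is positive even if
    [b = 0]. *)
Lemma powR_limit (R : realType) (L k s t a b : R) : 0 < s -> 0 < t -> 0 < k ->
  0 <= a -> 0 <= b ->
  (forall x y, a <= x -> b <= y -> 0 < x -> 0 < y -> L <= k * (x `^ s * y `^ t)) ->
  L <= k * (a `^ s * b `^ t).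
Proof.
move=> s0 t0 k0 a0 b0 H.
have [a_0|a_gt0] : a = 0 \/ 0 < a by move: a0; rewrite le_eqVlt => /predU1P[|]; auto.
  have b1 : 0 < b + 1 by rewrite ltr_wpDl.
  rewrite a_0 powR0 ?gt_eqF// mul0r mulr0.
  apply: (@powR_limit0 R L (k * (b + 1) `^ t) s) => //; first by rewrite mulr_gt0// powR_gt0.
  move=> x x0; rewrite mulrAC -mulrA; apply: H => //; last by rewrite lerDl.
  by rewrite a_0 ltW.
have [b_0|b_gt0] : b = 0 \/ 0 < b by move: b0; rewrite le_eqVlt => /predU1P[|]; auto.
  rewrite b_0 powR0 ?gt_eqF// !mulr0.
  apply: (@powR_limit0 R L (k * a `^ s) t) => //; first by rewrite mulr_gt0// powR_gt0.
  by move=> x x0; rewrite -mulrA; apply: H => //; rewrite b_0 ltW.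
exact: H.
Qed.

Lemma EFin_bigmax0 (R : realDomainType) n (b : 'I_n -> R) :
  (\big[maxe/0%E]_(j < n) (b j)%:E = (\big[Num.max/0]_(j < n) b j)%:E)%E.
Proof. by elim/big_ind2 : _ => // x1 x2 y1 y2 -> ->; rewrite EFin_max. Qed.

Section weighted_norms.
Context (R : realType) (n : nat).
Local Notation leb := (lebesgue_tuple R).
Local Notation Rm := (measurableTypeR R).
Local Notation T := (n.+1.-tuple Rm).
Local Notation D := (orthant R n.+1).
Local Notation dim := (n.+1%:R : R).

Lemma sum_sqr_powR (t : T) c : (\sum_(i < n.+1) tnth t i ^+ 2) `^ (c / 2) = euclid t `^ c.
Proof. by rewrite /euclid -powRrM mulrC. Qed.

Lemma euclid_tuple_perm s (t : T) : euclid (tuple_perm s t) = euclid t.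
Proof.
rewrite /euclid [in RHS](reindex_inj (@perm_inj _ s)); congr (_ `^ _).
by apply: eq_bigr => i _; rewrite tnth_mktuple.
Qed.

Lemma coord_sum_tuple_perm e s (t : T) : coord_sum e (tuple_perm s t) = coord_sum e t.
Proof.
rewrite /coord_sum [in RHS](reindex_inj (@perm_inj _ s)).
by apply: eq_bigr => i _; rewrite tnth_mktuple.
Qed.

Lemma extremal_fun_tuple_perm p q r lam m a1 a2 s (t : T) :
  extremal_fun p q r lam m a1 a2 (tuple_perm s t) = extremal_fun p q r lam m a1 a2 t.
Proof. by rewrite /extremal_fun /shape_ratio coord_sum_tuple_perm euclid_tuple_perm. Qed.

(** Measurability is given for the weighted function only. The modulus of its Borel representative
    is divided by the weight, which is positive away from the origin, and extended by zero outside
    the orthant; the resulting [xi] then serves all the norms. *)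
Lemma ae_measurable_euclid (c : R) (x : T -> R[i]) :
  ae_measurable D (weighted (fun t => euclid t `^ c) x) ->
  exists (xi : T -> R) (N : set T), [/\ measurable_fun setT xi, forall t, 0 <= xi t, measurable N,
    leb n.+1 N = 0%E &
    forall t, D t -> ~ N t -> 0 < euclid t -> Normc.normc (x t) = xi t].
Proof.
move=> [g [mre mim [N [mN N0 gN]]]].
have mD := @measurable_orthant R n.+1.
pose xi (t : T) := Normc.normc (g t) / euclid t `^ c.
have mxi : measurable_fun D xi.
  apply: measurable_funM.
    rewrite (_ : (fun t => _) = (fun t => (complex.Re (g t) ^+ 2 + complex.Im (g t) ^+ 2) `^ 2^-1)); last first.
      by apply/funext => t; rewrite powR12_sqrt ?addr_ge0 ?sqr_ge0// /Normc.normc; case: (g t).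
    apply: (@measurableT_comp _ _ _ _ _ _ (fun x : R => x `^ 2^-1)); first exact: measurable_powR.
    by apply: measurable_funD; exact: measurable_funX.
  apply: (@measurableT_comp _ _ _ _ _ _ (@GRing.inv R)); first exact: measurable_inv.
  apply: (@measurableT_comp _ _ _ _ _ _ (fun x : R => x `^ c)); first exact: measurable_powR.
  by apply: measurable_funTS; exact: measurable_euclid.
exists (xi \_ D), N; split => //.
- exact/(measurable_restrictT xi mD).
- by move=> t; rewrite patchE; case: ifP => // _; rewrite divr_ge0 ?normc_ge0 ?powR_ge0.
- move=> t tD tN t0; rewrite patchE mem_set// /xi.
  have <- : weighted (fun t => euclid t `^ c) x t = g t.
    by apply: contrapT => tg; apply: tN; apply: gN => /= /(_ tD).
  by rewrite /weighted normcZ ?powR_ge0// mulrAC mulfV ?mul1r// gt_eqF// powR_gt0.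
Qed.

End weighted_norms.

(** * The inequality for norms and its sharpness *)

Section carlson_sharp.
Context (R : realType) (n : nat).
Local Notation leb := (lebesgue_tuple R).
Local Notation Rm := (measurableTypeR R).
Local Notation T := (n.+1.-tuple Rm).
Local Notation D := (orthant R n.+1).
Local Notation dim := (n.+1%:R : R).

Variables (p q r lam m : R).
Hypotheses (q1 : 1 <= q) (qp : q <= p) (qr : q <= r) (pqr : 0 < (p - q) + (r - q))
  (lam0 : 0 < lam) (m0 : 0 < m).

Local Notation kappa := (scaling_exponent p q r lam m).
Local Notation M := (p * m + r * lam).
Local Notation e := (dim * (r - 1) + m).
Local Notation alpha := (m / M).
Local Notation beta := (lam / M).
Local Notation gamma := (kappa / (q * M)).
Local Notation K := (carlson_integral n p q r lam m).
Local Notation theta := (dim * (1 - 1 / q)).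
Local Notation theta0 := (dim - (lam + dim) / p).
Local Notation theta1 := (dim + (m - dim) / r).
Local Notation w := (fun t : T => euclid t `^ theta).
Local Notation w0 := (fun t : T => euclid t `^ theta0).
Local Notation wj j := (fun t : T => tnth t j `^ theta1).

Let q0 : 0 < q. Proof. exact: lt_le_trans q1. Qed.
Let p0 : 0 < p. Proof. exact: lt_le_trans qp. Qed.
Let r0 : 0 < r. Proof. exact: lt_le_trans qr. Qed.
Let M0 : 0 < M. Proof. by rewrite addr_gt0 ?mulr_gt0. Qed.
Let kappa0 : 0 < kappa. Proof. exact: scaling_exponent_gt0. Qed.
Let K0 : 0 < K. Proof. exact: carlson_integral_gt0. Qed.
Let alpha0 : 0 < alpha. Proof. by rewrite divr_gt0. Qed.
Let beta0 : 0 < beta. Proof. by rewrite divr_gt0. Qed.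

Definition carlson_constant : R :=
  dim `^ beta / ((p * alpha) `^ alpha * (r * beta) `^ beta) * K `^ gamma.

Let C0 : 0 < carlson_constant.
Proof.
apply: mulr_gt0; last exact: powR_gt0.
apply: divr_gt0; first exact: powR_gt0.
by apply: mulr_gt0; apply: powR_gt0; exact: mulr_gt0.
Qed.

(** If every [L_r]-norm is at most [b], the integral with [coord_sum] is at most [dim b ^ r]; this
    [dim], raised to the power [beta], is the factor [d ^ beta] of the constant. *)
Lemma carlson_valueE a b : 0 <= a -> 0 <= b ->
  carlson_value n p q r lam m (a `^ p) (dim * b `^ r) =
  carlson_constant * (a `^ (p * alpha) * b `^ (r * beta)).
Proof.
move=> a0 b0; rewrite /carlson_value /carlson_constant.
have pa : 0 < p * alpha by exact: mulr_gt0.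
have rb : 0 < r * beta by exact: mulr_gt0.
have div x y c : 0 <= x -> 0 < y -> (x / y) `^ c = x `^ c / y `^ c.
  by move=> x0 y0; rewrite powRM ?invr_ge0 ?(ltW y0)// -(powR_inv1 (ltW y0)) -powRrM mulN1r powRN.
rewrite !div ?mulr_ge0 ?powR_ge0// (@powRM _ dim (b `^ r))// ?powR_ge0// -!powRrM.
move: (_ `^ gamma) (_ `^ beta) (a `^ _) (b `^ _) => x y z t.
by field; rewrite !gt_eqF// powR_gt0.
Qed.

Lemma Lp_norm_weighted s (v E : T -> R) (x : T -> R[i]) xi (N : set T) : 0 < s ->
  (forall t, 0 <= v t) -> (forall t, 0 <= E t) -> (forall t, 0 <= xi t) ->
  (forall t, D t -> 0 < euclid t -> v t `^ s = E t) ->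
  measurable N -> leb n.+1 N = 0%E ->
  (forall t, D t -> ~ N t -> 0 < euclid t -> Normc.normc (x t) = xi t) ->
  Lp_norm D s (weighted v x) = ((\int[leb n.+1]_(t in D) (E t * xi t `^ s)%:E) `^ s^-1)%E.
Proof.
move=> s0 v0 E0 xi0 vE mN N0 xE; rewrite Lp_normE//; congr (_ `^ _)%E.
apply: (@ge0_eq_orthant_integral R n r m N _ _ mN N0).
- by move=> t; exact: powR_ge0.
- by move=> t; rewrite mulr_ge0 ?powR_ge0.
move=> t tD tN t0 _; rewrite /weighted normcZ// powRM ?normc_ge0// vE// xE//.
Qed.

Lemma theta_powR t : w t `^ q = euclid t `^ (dim * (q - 1)).
Proof. by rewrite -powRrM; congr (_ `^ _); field; rewrite gt_eqF. Qed.

Lemma theta0_powR t : w0 t `^ p = euclid t `^ (dim * p - lam - dim).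
Proof. by rewrite -powRrM; congr (_ `^ _); field; rewrite gt_eqF. Qed.

Lemma theta1_powR j t : wj j t `^ r = tnth t j `^ e.
Proof. by rewrite -powRrM; congr (_ `^ _); field; rewrite gt_eqF. Qed.

Lemma integral_coord_sum (xi : T -> R) : measurable_fun setT xi ->
  (\int[leb n.+1]_(t in D) (coord_sum e t * xi t `^ r)%:E =
   \sum_(j < n.+1) \int[leb n.+1]_(t in D) (tnth t j `^ e * xi t `^ r)%:E)%E.
Proof.
move=> mxi; rewrite -(@ge0_integral_sum _ _ _ (leb n.+1) D (@measurable_orthant R n.+1) _
   (fun j (t : T) => (tnth t j `^ e * xi t `^ r)%:E)).
- by apply: eq_integral => t _; rewrite sumEFin -mulr_suml.
- move=> j; apply: measurable_funTS; apply/measurable_EFinP; apply: measurable_funM.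
    apply: (@measurableT_comp _ _ _ _ _ _ (fun x : R => x `^ _)); first exact: measurable_powR.
    exact: measurable_tnth.
  by apply: (@measurableT_comp _ _ _ _ _ _ (fun x : R => x `^ _)) => //; exact: measurable_powR.
- by move=> j t _; rewrite lee_fin mulr_ge0 ?powR_ge0.
Qed.

Lemma poweR_fin s (X : \bar R) : 0 < s -> (0 <= X -> X `^ s^-1 < +oo ->
  exists a : R, [/\ (0 <= a)%R, X = (a `^ s)%:E & X `^ s^-1 = a%:E])%E.
Proof.
move=> s0; case: X => [x||] //; rewrite ?lee_fin; last first.
  by rewrite poweRyr ?ltxx// invr_eq0 gt_eqF.
move=> x0 _; exists (x `^ s^-1); split; first exact: powR_ge0.
  by rewrite -powRrM mulVf ?gt_eqF// powRr1.
by rewrite poweR_EFin.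
Qed.

Lemma carlson_inequality (x : T -> R[i]) :
  in_Lp D p (weighted w0 x) -> (forall j, in_Lp D r (weighted (wj j) x)) ->
  (Lp_norm D q (weighted w x) <= carlson_constant%:E *
    (Lp_norm D p (weighted w0 x) `^ (p * alpha) *
     (\big[maxe/0]_(j < n.+1) Lp_norm D r (weighted (wj j) x)) `^ (r * beta)))%E.
Proof.
move=> [ax xp] xr.
have [xi [N [mxi xi0 mN N0 xE]]] := ae_measurable_euclid ax.
have LE s (v E : T -> R) (s0 : 0 < s) (v0 : forall t, 0 <= v t) (E0 : forall t, 0 <= E t)
    (vE : forall t, D t -> 0 < euclid t -> v t `^ s = E t) :=
  Lp_norm_weighted s0 v0 E0 xi0 vE mN N0 xE.
have Ep := LE p w0 (fun t => euclid t `^ (dim * p - lam - dim)) p0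
  (fun t => powR_ge0 _ _) (fun t => powR_ge0 _ _) (fun t _ _ => theta0_powR t).
have Er j := LE r (wj j) (fun t => tnth t j `^ e) r0
  (fun t => powR_ge0 _ _) (fun t => powR_ge0 _ _) (fun t _ _ => theta1_powR j t).
have Eq := LE q w (fun t => euclid t `^ (dim * (q - 1))) q0
  (fun t => powR_ge0 _ _) (fun t => powR_ge0 _ _) (fun t _ _ => theta_powR t).
have ipos (E : T -> R) s : (forall t, 0 <= E t) ->
    (0 <= \int[leb n.+1]_(t in D) (E t * xi t `^ s)%:E)%E.
  by move=> E0; apply: integral_ge0 => t _; rewrite lee_fin mulr_ge0 ?powR_ge0.
move: xp; rewrite Ep => /(poweR_fin p0 (ipos _ _ (fun t => powR_ge0 _ _)))[a [a0 aE ->]].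
have /boolp.choice[b bE] : forall j, exists bj : R, [/\ 0 <= bj,
    (\int[leb n.+1]_(t in D) (tnth t j `^ e * xi t `^ r)%:E = (bj `^ r)%:E)%E &
    Lp_norm D r (weighted (wj j) x) = bj%:E].
  move=> j; have [_] := xr j; rewrite Er.
  by move=> /(poweR_fin r0 (ipos _ _ (fun t => powR_ge0 _ _)))[b [b0 bE ->]]; exists b.
under eq_bigr => j _ do (have [_ _ ->] := bE j).
rewrite EFin_bigmax0; set bm : R := \big[_/_]_(_ < _) _.
have b_le j : b j <= bm by apply: le_bigmax.
have bm0 : 0 <= bm by apply: bigmax_ge_id.
rewrite Eq !poweR_EFin -!EFinM.
(* The norms are replaced by arbitrary positive upper bounds, because [carlson_bound] needs [U] and
   [V] positive while a norm may vanish. *)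
have bound x1 y1 : a <= x1 -> bm <= y1 -> 0 < x1 -> 0 < y1 ->
    ((\int[leb n.+1]_(t in D) (euclid t `^ (dim * (q - 1)) * xi t `^ q)%:E) `^ q^-1 <=
     (carlson_constant * (x1 `^ (p * alpha) * y1 `^ (r * beta)))%:E)%E.
  move=> ax1 by1 x10 y10.
  have y1r : 0 < dim * y1 `^ r by rewrite mulr_gt0// powR_gt0.
  rewrite -carlson_valueE ?(ltW x10) ?(ltW y10)//.
  have cv0 : 0 <= carlson_value n p q r lam m (x1 `^ p) (dim * y1 `^ r).
    by rewrite !mulr_ge0// powR_ge0.
  have -> : carlson_value n p q r lam m (x1 `^ p) (dim * y1 `^ r) =
      (carlson_value n p q r lam m (x1 `^ p) (dim * y1 `^ r) `^ q) `^ q^-1.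
    by rewrite -powRrM mulfV ?gt_eqF// powRr1.
  rewrite -poweR_EFin.
  apply: gt0_ler_poweR; rewrite ?invr_ge0 ?(ltW q0)//.
  - by rewrite in_itv/= leey andbT ipos// => t; exact: powR_ge0.
  - by rewrite in_itv/= leey andbT lee_fin powR_ge0.
  apply: (carlson_bound q1 qp qr pqr lam0 m0 (powR_gt0 p x10) y1r mxi xi0).
  - by rewrite aE lee_fin ler_powR_base// ltW.
  - rewrite (integral_coord_sum mxi) (eq_bigr (fun j => (b j `^ r)%:E)); last first.
      by move=> j _; have [_ -> _] := bE j.
    rewrite sumEFin lee_fin.
    have -> : dim * y1 `^ r = \sum_(j < n.+1) y1 `^ r.
      by rewrite sumr_const card_ord mulr_natl.
    apply: ler_sum => j _; apply: ler_powR_base; rewrite ?(ltW r0)//.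
      by have [] := bE j.
    exact: le_trans (b_le j) by1.
have Lge : (0 <= (\int[leb n.+1]_(t in D) (euclid t `^ (dim * (q - 1)) * xi t `^ q)%:E) `^ q^-1)%E.
  exact: poweR_ge0.
(* One pair of positive upper bounds already excludes an infinite left side, so the limit is taken
   among reals. *)
move: Lge bound; move: (_ `^ q^-1)%E => [L _ bound||] //; last first.
  move=> _ /(_ (a + 1) (bm + 1)); rewrite !lerDl !ltr_wpDl// => /(_ ler01 ler01 isT isT).
  by rewrite leye_eq.
rewrite lee_fin.
apply: (powR_limit (mulr_gt0 p0 alpha0) (mulr_gt0 r0 beta0) C0 a0 bm0) => x1 y1 ? ? ? ?.
by rewrite -lee_fin; exact: bound.
Qed.

Let xs := @extremal_fun R n p q r lam m 1 1.

Let xs_ge0 t : 0 <= xs t. Proof. by rewrite mulr_ge0 ?powR_ge0. Qed.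

Let mxs : measurable_fun setT xs.
Proof. exact: measurable_extremal_fun. Qed.

Let one_mass k l : 1 `^ k * 1 `^ l * K = K.
Proof. by rewrite !powR1 !mul1r. Qed.

(** Only the sum over all coordinates is known from [extremal_fun_r]. The symmetry of [xs] makes its
    [dim] terms equal, so each is that sum divided by [dim]. *)
Lemma integral_extremal_coord j :
  (\int[leb n.+1]_(t in D) (tnth t j `^ e * xs t `^ r)%:E =
   (r * beta * K / dim)%:E)%E.
Proof.
have mpow : measurable_fun setT (fun t => (xs t `^ r)%:E).
  apply/measurable_EFinP.
  by apply: (@measurableT_comp _ _ _ _ _ _ (fun x : R => x `^ _)) => //; exact: measurable_powR.
have same k : (\int[leb n.+1]_(t in D) (tnth t k `^ e * xs t `^ r)%:E =
               \int[leb n.+1]_(t in D) (tnth t j `^ e * xs t `^ r)%:E)%E.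
  under eq_integral do rewrite EFinM; under [RHS]eq_integral do rewrite EFinM.
  apply: (@ge0_integral_orthant_coord R n.+1 k j (fun x => x `^ e) (fun t => (xs t `^ r)%:E)).
  - exact: measurable_powR.
  - by move=> x; exact: powR_ge0.
  - exact: mpow.
  - by move=> t; rewrite lee_fin powR_ge0.
  - by move=> s t; rewrite /xs extremal_fun_tuple_perm.
have := extremal_fun_r n q1 qp qr pqr lam0 m0 (@ltr01 R) (@ltr01 R).
rewrite one_mass (integral_coord_sum mxs).
rewrite (eq_bigr (fun=> \int[leb n.+1]_(t in D) (tnth t j `^ e * xs t `^ r)%:E)%E); last first.
  by move=> k _; exact: same.
have X0 : (0 <= \int[leb n.+1]_(t in D) (tnth t j `^ e * xs t `^ r)%:E)%E.
  by apply: integral_ge0 => t _; rewrite lee_fin mulr_ge0 ?powR_ge0.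
move: X0; case: (\int[_]_(_ in _) _)%E => [X||] //.
  rewrite sumEFin sumr_const card_ord => _ [E]; congr (_%:E).
  have -> : r * beta * K = X *+ n.+1 by rewrite E; field; rewrite gt_eqF.
  by rewrite -[X *+ _]mulr_natr mulfK// pnatr_eq0.
by rewrite big_ord_recl/= addye// -ltNye; apply: lt_le_trans (sume_ge0 _ _).
Qed.

Let Lp_xs s (v E : T -> R) (c : R) : 0 < s -> (forall t, 0 <= v t) ->
  (forall t, v t `^ s = E t) -> measurable_fun setT v ->
  (\int[leb n.+1]_(t in D) (E t * xs t `^ s)%:E = c%:E)%E ->
  let f := weighted v (fun t => (xs t)%:C%C) in
  in_Lp D s f /\ Lp_norm D s f = (c `^ s^-1)%:E.
Proof.
move=> s0 v0 vE mv ic f.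
have fE : Lp_norm D s f = (c `^ s^-1)%:E.
  have E0 t : 0 <= E t by rewrite -vE powR_ge0.
  have xE t : D t -> ~ set0 t -> 0 < euclid t -> Normc.normc (xs t)%:C%C = xs t.
    by move=> _ _ _; rewrite /Normc.normc/= expr0n addr0 sqrtr_sqr ger0_norm.
  have := Lp_norm_weighted s0 v0 E0 xs_ge0 (fun t _ _ => vE t) measurable0 (measure0 _) xE.
  by rewrite ic poweR_EFin.
split=> //; split; last by rewrite fE ltry.
exists f; split.
- apply: measurable_funTS; rewrite (_ : (fun t => _) = (fun t => v t * xs t)); last first.
    by apply/funext => t; rewrite /f /weighted/= mul0r subr0.
  exact: measurable_funM.
- rewrite (_ : (fun t => _) = (fun=> 0)); first exact: measurable_cst.
  by apply/funext => t; rewrite /f /weighted/= mulr0 mul0r addr0.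
- by apply: aeW.
Qed.

(** The witness is real-valued, so that a single function rules out every smaller constant among
    complex-valued and among real-valued functions. *)
Lemma carlson_extremal : exists x : T -> R[i],
  [/\ in_Lp D p (weighted w0 x), forall j, in_Lp D r (weighted (wj j) x),
      real_valued R n.+1 x &
      forall C', (Lp_norm D q (weighted w x) <= C'%:E *
        (Lp_norm D p (weighted w0 x) `^ (p * alpha) *
         (\big[maxe/0]_(j < n.+1) Lp_norm D r (weighted (wj j) x)) `^ (r * beta)))%E ->
      carlson_constant <= C'].
Proof.
have mpow (h : T -> R) c : measurable_fun setT h -> measurable_fun setT (fun t => h t `^ c).
  by move=> mh; apply: (@measurableT_comp _ _ _ _ _ _ (fun x : R => x `^ _)) => //; exact: measurable_powR.
have meu := @measurable_euclid R n.
exists (fun t => (xs t)%:C%C).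
have [] := @Lp_xs p w0 (fun t => euclid t `^ (dim * p - lam - dim)) (p * alpha * K) p0.
- by move=> t; exact: powR_ge0.
- exact: theta0_powR.
- exact: mpow.
- have := extremal_fun_p n q1 qp qr pqr lam0 m0 (@ltr01 R) (@ltr01 R).
  by rewrite one_mass mul1r (mulrA p).
move=> Lp0 ->.
have Lr j : in_Lp D r (weighted (wj j) (fun t => (xs t)%:C%C)) /\
    Lp_norm D r (weighted (wj j) (fun t => (xs t)%:C%C)) = ((r * beta * K / dim) `^ r^-1)%:E.
  apply: (@Lp_xs r (wj j) (fun t => tnth t j `^ e)) => //.
  - by move=> t; exact: powR_ge0.
  - exact: theta1_powR.
  - by apply: mpow; exact: measurable_tnth.
  - exact: integral_extremal_coord.
have [] := @Lp_xs q w (fun t => euclid t `^ (dim * (q - 1))) K q0.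
- by move=> t; exact: powR_ge0.
- exact: theta_powR.
- exact: mpow.
- have := extremal_fun_q n q1 qp qr pqr lam0 m0 (@ltr01 R) (@ltr01 R).
  by rewrite one_mass.
move=> _ ->; split=> //; first by move=> j; have [] := Lr j.
move=> C'; under eq_bigr => j _ do rewrite (Lr j).2.
rewrite EFin_bigmax0.
have X0 : 0 < p * alpha * K by rewrite mulr_gt0// mulr_gt0.
have Y0 : 0 < r * beta * K / dim by rewrite divr_gt0// mulr_gt0// mulr_gt0.
rewrite (_ : \big[_/_]_(_ < _) _ = (r * beta * K / dim) `^ r^-1); last first.
  apply/le_anti/andP; split; last exact: (le_bigmax _ _ ord0).
  by apply/bigmax_leP; split=> //; exact: powR_ge0.
rewrite !poweR_EFin -!EFinM lee_fin.
set b := _ `^ r^-1; set a := _ `^ p^-1.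
have a0 : 0 < a by exact: powR_gt0.
have b0 : 0 < b by exact: powR_gt0.
have ab0 : 0 < a `^ (p * alpha) * b `^ (r * beta) by rewrite mulr_gt0// powR_gt0.
(* Here [a ^ p = p alpha K] and [dim b ^ r = r beta K], so both quotients in [carlson_value] equal
   [K], and [alpha + beta + gamma = 1/q] makes the product [K ^ (1/q)], the [L_q]-norm of the
   witness. *)
suff <- : carlson_constant * (a `^ (p * alpha) * b `^ (r * beta)) = K `^ q^-1.
  by rewrite ler_pM2r.
rewrite -carlson_valueE ?(ltW a0) ?(ltW b0)// /a /b -!powRrM !mulVf ?gt_eqF// !powRr1 ?(ltW X0) ?(ltW Y0)//.
rewrite /carlson_value (_ : p * alpha * K / _ = K); last by field; rewrite !gt_eqF.
rewrite (_ : dim * _ / _ = K); last by field; rewrite !gt_eqF.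
rewrite -!powRD ?(gt_eqF K0) ?implybT//; congr (_ `^ _).
rewrite -[X in X / (q * _)](_ : M - q * (lam + m) = kappa); last by rewrite /scaling_exponent; ring.
by field; rewrite !gt_eqF.
Qed.

End carlson_sharp.

Theorem corollary6 (R : realType) (d : nat) (p q r lambda mu : R)
    (hd : (0 < d)%N)
    (hpqr : [\/ [/\ 1 <= q, q < p & q < r],
                [/\ 1 <= q, q = r & r < p] |
                [/\ 1 <= q, q = p & p < r]])
    (hlambda : 0 < lambda) (hmu : 0 < mu) :
  let theta := d%:R * (1 - 1 / q) in
  let theta0 := d%:R - (lambda + d%:R) / p in
  let theta1 := d%:R + (mu - d%:R) / r in
  let w (t : d.-tuple (measurableTypeR R)) : R :=
    (\sum_(i < d) tnth t i ^+ 2) `^ (theta / 2) in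
  let w0 (t : d.-tuple (measurableTypeR R)) : R :=
    (\sum_(i < d) tnth t i ^+ 2) `^ (theta0 / 2) in
  let wj (j : 'I_d) (t : d.-tuple (measurableTypeR R)) : R :=
    tnth t j `^ theta1 in
  let alpha := mu / (p * mu + r * lambda) in
  let beta := lambda / (p * mu + r * lambda) in
  let gamma := 1 / q - alpha - beta in
  let I := angular_integral d (d%:R * (r - 1) + mu) (beta / gamma) in
  let C := d%:R `^ beta / ((p * alpha) `^ alpha * (r * beta) `^ beta) *
    (I / (lambda + mu) * euler_beta (alpha / gamma) (beta / gamma)) `^ gamma in
  let D := orthant R d in
  let admissible : set (d.-tuple (measurableTypeR R) -> R[i]) :=
    [set x | in_Lp D p (weighted w0 x) /\
             forall j, in_Lp D r (weighted (wj j) x)] in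
  let lhs x := Lp_norm D q (weighted w x) in
  let rhs x :=
    ((Lp_norm D p (weighted w0 x) `^ (p * alpha)) *
     ((\big[maxe/0]_(j < d) Lp_norm D r (weighted (wj j) x)) `^ (r * beta)))%E in
  sharp_constant admissible lhs rhs C /\
  sharp_constant (admissible `&` real_valued R d) lhs rhs C.
Proof.
case: d hd => // n _ theta theta0 theta1 w w0 wj alpha beta gamma I C D admissible lhs rhs.
(* The three families of exponents enter only in this common form: [q] is at most [p] and [r] and
   differs from at least one of them. *)
have [q1 qp qr pqr] : [/\ 1 <= q, q <= p, q <= r & 0 < (p - q) + (r - q)].
  case: hpqr => -[q1 h1 h2]; split => //; rewrite ?h1 ?(ltW h1) ?(ltW h2)//;
    move: h1 h2; clear; lra.
have q0 : 0 < q by exact: lt_le_trans q1.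
have p0 : 0 < p by exact: lt_le_trans qp.
have r0 : 0 < r by exact: lt_le_trans qr.
have M0 : 0 < p * mu + r * lambda by rewrite addr_gt0 ?mulr_gt0.
have k0 := scaling_exponent_gt0 qp qr pqr hlambda hmu.
have gammaE : gamma = scaling_exponent p q r lambda mu / (q * (p * mu + r * lambda)).
  rewrite /gamma /alpha /beta -[scaling_exponent _ _ _ _ _](_ : p * mu + r * lambda - q * (lambda + mu) = _).
    by field; rewrite !gt_eqF.
  by rewrite /scaling_exponent; ring.
have CE : C = carlson_constant n p q r lambda mu.
  rewrite /C /carlson_constant /carlson_integral /I gammaE.
  set k := scaling_exponent _ _ _ _ _ in k0 *.
  rewrite (_ : alpha / _ = q * mu / k); last by rewrite /alpha; field; rewrite !gt_eqF.
  by rewrite (_ : beta / _ = q * lambda / k)//; rewrite /beta; field; rewrite !gt_eqF.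
have wE : w = (fun t => euclid t `^ theta) by apply/funext => t; exact: sum_sqr_powR.
have w0E : w0 = (fun t => euclid t `^ theta0) by apply/funext => t; exact: sum_sqr_powR.
have le x : admissible x -> (lhs x <= C%:E * rhs x)%E.
  rewrite /admissible /lhs /rhs /= wE w0E CE => -[x0 xj].
  exact: (carlson_inequality q1 qp qr pqr hlambda hmu x0 xj).
have [x [x0 xj xR xC]] := carlson_extremal n q1 qp qr pqr hlambda hmu.
have xA : admissible x by split; [rewrite w0E; exact: x0|exact: xj].
have xS C' : (lhs x <= C'%:E * rhs x)%E -> C <= C'.
  by rewrite /lhs /rhs wE w0E CE; exact: xC.
split; split => [y|C' yC'].
- exact: le.
- exact: xS (yC' x xA).
- by move=> [yA _]; exact: le.
- exact: xS (yC' x (conj xA xR)).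
Qed.
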